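(* Let $N\ge 3$ be an integer. For any $u \in W^{1,2}(\mathbb{H}^N)$ with $\|u\|_{L^2(\mathbb{H}^N)} = 1$, \[ \int_{\mathbb{H}^N} |u|^2 \ln |u| \, dV_{\mathbb{H}} \leq \frac{N}{4} \ln \left[ \frac{2}{\pi Ne} \left( \int_{\mathbb{H}^N} |\nabla_{\mathbb{H}} u|^2 \, dV_{\mathbb{H}} - \frac{N^2 (N-1)}{4 (N+2)} \int_{\mathbb{H}^N} |u|^2 \, dV_{\mathbb{H}} \right) \right]. \]
   Context: $\mathbb{H}^N$ is the $N$-dimensional hyperbolic space of constant sectional curvature $-1$, $dV_{\mathbb{H}}$ its Riemannian volume measure, $\nabla_{\mathbb{H}}$ its Riemannian gradient, $|\nabla_{\mathbb{H}}u|$ the Riemannian norm of the gradient. Convention: $0\ln 0=0$. *)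

(* Defs.v *)
From HB Require Import structures.
From mathcomp Require Import all_boot all_order all_algebra.
From mathcomp Require Import all_classical all_reals all_analysis.
From mathcomp Require Import measurable_realfun.

Set Implicit Arguments.
Unset Strict Implicit.
Unset Printing Implicit Defensive.

Import Order.TTheory GRing.Theory Num.Theory.
Import numFieldNormedType.Exports.

Local Open Scope classical_set_scope.
Local Open Scope ring_scope.

(* Borel sigma-algebra on row vectors: the one generated by the coordinates,
   as the library does for tuples. *)
Definition measure_rV_display : measure_display -> measure_display.
Proof. exact. Qed.

Section measurable_rV.
Context (R : realType) (n : nat).

Let coors : 'I_n -> 'rV[R]_n -> measurableTypeR R := fun i x => x ord0 i.

Let rV_set0 : g_sigma_preimage coors set0.
Proof. exact: sigma_algebra0. Qed.

Let rV_setC A : g_sigma_preimage coors A -> g_sigma_preimage coors (~` A).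
Proof. exact: sigma_algebraC. Qed.

Let rV_bigcup (F : _^nat) : (forall i, g_sigma_preimage coors (F i)) ->
  g_sigma_preimage coors (\bigcup_i (F i)).
Proof. exact: sigma_algebra_bigcup. Qed.

HB.instance Definition _ :=
  @isMeasurable.Build (measure_rV_display R.-ocitv.-measurable.-sigma)
    'rV[R]_n (g_sigma_preimage coors) rV_set0 rV_setC rV_bigcup.

Lemma measurable_coord (i : 'I_n) :
  measurable_fun [set: 'rV[R]_n] (fun x => x ord0 i : measurableTypeR R).
Proof.
move=> _ Y mY; rewrite setTI; apply: sub_sigma_algebra => /=.
rewrite -bigcup_seq/=; exists i => /=; first by rewrite mem_index_enum.
by exists Y => //; rewrite setTI.
Qed.

Lemma measurable_fun_rVP d (T : measurableType d) (f : T -> 'rV[R]_n) :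
  (forall i, measurable_fun [set: T] (fun x => f x ord0 i : measurableTypeR R)) ->
  measurable_fun [set: T] f.
Proof.
move=> mf.
suff : preimage_set_system [set: T] f (g_sigma_preimage coors) `<=` measurable.
  by move=> H _ Y mY; apply: H; exists Y.
rewrite -g_sigma_preimage_comp.
apply: smallest_sub; first exact: sigma_algebra_measurable.
by rewrite -bigcup_seq => A [i _ [B mB <-]]; exact: mf.
Qed.

End measurable_rV.

(* Lebesgue measure on R^(n+1), from one on R^n: the image of the product of
   one-dimensional Lebesgue measure with mu. *)
Section lebesgue_rV.
Local Open Scope ereal_scope.
Context (R : realType).

Definition rV_cons n (p : measurableTypeR R * 'rV[R]_n) : 'rV[R]_n.+1 :=
  row_mx ((p.1 : R)%:M : 'M[R]_1) p.2.

Definition rV_uncons n (x : 'rV[R]_n.+1) : measurableTypeR R * 'rV[R]_n :=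
  (x ord0 ord0, @rsubmx R 1 1 n x).

Lemma rV_consK n : cancel (@rV_cons n) (@rV_uncons n).
Proof.
move=> [a v]; rewrite /rV_uncons /rV_cons row_mxKr; congr pair.
by rewrite mxE; case: splitP => // j _; rewrite mxE !ord1 eqxx mulr1n.
Qed.

Lemma rV_unconsK n : cancel (@rV_uncons n) (@rV_cons n).
Proof.
move=> x; rewrite /rV_cons /rV_uncons /=.
rewrite (_ : _%:M = @lsubmx R 1 1 n x); first exact: (@hsubmxK R 1 1 n x).
apply/rowP => i; rewrite !mxE !ord1 eqxx mulr1n.
by congr (x _ _); exact/val_inj.
Qed.

Lemma measurable_rV_cons n : measurable_fun setT (@rV_cons n).
Proof.
apply: measurable_fun_rVP => i; rewrite /rV_cons.
case: (@splitP 1 n i) => j ij.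
- rewrite (_ : (fun _ => _) = fst); first exact: measurable_fst.
  apply/funext => -[a v] /=.
  rewrite (_ : i = lshift n j); last exact/val_inj.
  apply: etrans (@row_mxEl R 1 1 n _ _ _ _) _.
  by rewrite mxE !ord1 eqxx mulr1n.
- rewrite (_ : (fun _ => _) = (fun x : 'rV[R]_n => x ord0 j) \o snd).
    by apply: measurableT_comp => //; exact: measurable_coord.
  apply/funext => -[a v] /=.
  rewrite (_ : i = rshift 1 j); last exact/val_inj.
  exact: (@row_mxEr R 1 1 n).
Qed.

Lemma measurable_rV_uncons n : measurable_fun setT (@rV_uncons n).
Proof.
apply/measurable_fun_pairP; split; first exact: measurable_coord.
apply: measurable_fun_rVP => i.
rewrite (_ : (fun _ => _) = fun x : 'rV[R]_n.+1 => x ord0 (rshift 1 i)).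
  exact: measurable_coord.
by apply/funext => x /=; rewrite mxE.
Qed.

Section succ.
Context n (mu : {sigma_finite_measure set 'rV[R]_n -> \bar R}).

Definition lebesgue_rVS : set 'rV[R]_n.+1 -> \bar R :=
  pushforward (@lebesgue_measure R \x mu) (@rV_cons n).

Let m0 : lebesgue_rVS set0 = 0.
Proof. by rewrite /lebesgue_rVS /pushforward preimage_set0 measure0. Qed.

Let m_ge0 A : 0 <= lebesgue_rVS A.
Proof. by rewrite /lebesgue_rVS /pushforward; exact: measure_ge0. Qed.

Let m_sigma_additive : semi_sigma_additive lebesgue_rVS.
Proof.
move=> F mF tF mUF; rewrite /lebesgue_rVS /pushforward preimage_bigcup.
apply: measure_semi_sigma_additive.
- by move=> k; rewrite -[X in measurable X]setTI; exact: measurable_rV_cons.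
- apply/trivIsetP => /= i j _ _ ij; rewrite -preimage_setI.
  by move/trivIsetP : tF => /(_ _ _ _ _ ij) ->//; rewrite preimage_set0.
- rewrite -preimage_bigcup -[X in measurable X]setTI.
  exact: measurable_rV_cons.
Qed.

HB.instance Definition _ := isMeasure.Build _ _ _ lebesgue_rVS
  m0 m_ge0 m_sigma_additive.

Let m_sigma_finite : sigma_finite setT lebesgue_rVS.
Proof.
have /sigma_finiteP[F [TF ndF Foo]] := sigma_finiteT (@lebesgue_measure R).
have /sigma_finiteP[G [TG ndG Goo]] := sigma_finiteT mu.
exists (fun k => @rV_uncons n @^-1` (F k `*` G k)).
  rewrite -preimage_bigcup -(preimage_setT (@rV_uncons n)); congr preimage.
  rewrite -setXTT TF TG predeqE => -[x y]; split.
    move=> [/= [i _ Fx] [j _ Gy]]; exists (maxn i j) => //; split.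
    - by move: x Fx; exact/subsetPset/ndF/leq_maxl.
    - by move: y Gy; exact/subsetPset/ndG/leq_maxr.
  by move=> [i _ []/= ? ?]; split; exists i.
move=> k; have [mF muF] := Foo k; have [mG muG] := Goo k; split.
  rewrite -[X in measurable X]setTI; apply: measurable_rV_uncons => //.
  exact: measurableX.
rewrite /lebesgue_rVS /pushforward -comp_preimage.
rewrite (_ : _ \o _ = id); last by apply/funext => x /=; rewrite rV_consK.
by rewrite preimage_id product_measure1E// lte_mul_pinfty// ge0_fin_numE.
Qed.

HB.instance Definition _ := Measure_isSigmaFinite.Build _ _ _ lebesgue_rVS
  m_sigma_finite.

End succ.

Fixpoint lebesgue_rV n : {sigma_finite_measure set 'rV[R]_n -> \bar R} :=
  match n with
  | 0 => \d_(0%R : 'rV[R]_0)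
  | n'.+1 => lebesgue_rVS (lebesgue_rV n')
  end.

End lebesgue_rV.
Arguments lebesgue_rV {R} n.

(* Hyperbolic space as the Poincare ball: the open Euclidean unit ball with the
   metric (2 / (1 - |x|^2))^2 |dx|^2, of curvature -1.  The library's norm
   `|x| on row vectors is the sup norm, so the Euclidean norm is expressed
   through dotp. *)
Section hyperbolic_space.
Context (R : realType) (N : nat).
Local Notation E := 'rV[R]_N.
Implicit Types (x v w : E) (u phi : E -> R) (X : E -> E).

Definition dotp v w : R := \sum_(i < N) v ord0 i * w ord0 i.

Definition hspace : set E := [set x | dotp x x < 1].

Definition hconf x : R := 2 / (1 - dotp x x).

Definition hmetric x v w : R := hconf x ^+ 2 * dotp v w.

Definition hnorm x v : R := Num.sqrt (hmetric x v v).

(* The Riemannian volume sqrt(det g) dx = hconf^N dx, extended by 0 outside the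
   ball. *)
Definition hdensity : E -> R := (fun x => hconf x ^+ N) \_ hspace.

Definition hvol (A : set E) : \bar R :=
  (\int[lebesgue_rV N]_(x in A) (hdensity x)%:E)%E.

Lemma measurable_dotp : measurable_fun [set: E] (fun x => dotp x x).
Proof.
rewrite /dotp; apply: measurable_sum => i.
by apply: measurable_funM; exact: measurable_coord.
Qed.

Lemma measurable_hspace : measurable hspace.
Proof.
rewrite (_ : hspace = setT `&` (fun x => dotp x x) @^-1` `]-oo, 1[).
  by apply: measurable_dotp.
by rewrite setTI; apply/seteqP; split => x; rewrite /hspace /= in_itv.
Qed.

Lemma hdensity_ge0 x : 0 <= hdensity x.
Proof.
rewrite /hdensity patchE; case: ifPn => //; rewrite inE /hspace /= => x1.
by rewrite exprn_ge0// divr_ge0// subr_ge0 ltW.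
Qed.

Lemma measurable_hdensity : measurable_fun setT hdensity.
Proof.
apply/(measurable_restrictT (fun x => hconf x ^+ N) measurable_hspace).
apply: measurable_funX.
apply: measurable_funM => //.
apply: (@eq_measurable_fun _ _ _ _ _ (fun x => (1 - dotp x x) `^ (-1))).
  move=> x; rewrite inE /hspace /= => x1.
  by rewrite powR_inv1// subr_ge0 ltW.
apply: measurable_funTS.
apply: (@measurableT_comp _ _ _ _ _ _ (fun y : R => y `^ (-1)) _
  (fun x => 1 - dotp x x)); first exact: measurable_powR.
by apply: measurable_funB => //; exact: measurable_dotp.
Qed.

Let hvol0 : hvol set0 = 0%E.
Proof. by rewrite /hvol integral_set0. Qed.

Let hvol_ge0 A : (0 <= hvol A)%E.
Proof. by apply: integral_ge0 => x _; rewrite lee_fin hdensity_ge0. Qed.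

Let hvol_sigma_additive : semi_sigma_additive hvol.
Proof.
apply: semi_sigma_additive_nng_induced.
  by apply/measurable_EFinP; apply: measurable_hdensity.
by move=> x; rewrite lee_fin hdensity_ge0.
Qed.

HB.instance Definition _ := isMeasure.Build _ _ _ hvol
  hvol0 hvol_ge0 hvol_sigma_additive.

Definition basis_rV (i : 'I_N) : E := delta_mx ord0 i.

Fixpoint Ck (k : nat) phi : Prop :=
  if k is k'.+1 then
    [/\ continuous phi,
        forall i x, derivable phi x (basis_rV i) &
        forall i, Ck k' (fun x => 'D_(basis_rV i) phi x)]
  else continuous phi.

(* C_c^oo of the ball, each function being extended by 0 to R^N. *)
Definition test_function phi : Prop :=
  let supp := closure [set x | phi x != 0] in
  [/\ forall k, Ck k phi, compact supp & supp `<=` hspace].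

(* X is the weak Riemannian gradient of u when the 1-form v |-> g(X, v) is the
   distributional differential of u: its components g(X, e_i) are the weak
   partial derivatives of u in the coordinates of the ball. *)
Definition weak_hgrad u X : Prop :=
  forall phi, test_function phi -> forall i : 'I_N,
    \int[lebesgue_rV N]_(x in hspace) (u x * 'D_(basis_rV i) phi x) =
    - \int[lebesgue_rV N]_(x in hspace)
        (hmetric x (X x) (basis_rV i) * phi x).

(* u belongs to W^{1,2} of hyperbolic space, and X is its gradient (X is
   determined by u almost everywhere).  Values outside hspace are irrelevant. *)
Definition W12 u X : Prop :=
  [/\ measurable_fun hspace u,
      hvol.-integrable hspace (fun x => (u x ^+ 2)%:E),
      measurable_fun hspace X,
      hvol.-integrable hspace (fun x => (hnorm x (X x) ^+ 2)%:E) &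
      weak_hgrad u X].

Definition L2norm u : R :=
  Num.sqrt (\int[hvol]_(x in hspace) (`|u x| ^+ 2)).

End hyperbolic_space.

(* Main.v *)
(* The half-space coordinates (s, y) on the ball, with hyperbolic metric
   ds^2 + e^(-2s) |dy|^2 and volume e^(-ns) ds dy, n = N - 1, reduce the theorem to
   Lebesgue measure: w = e^(-ns/2) u is in L^2(ds dy), and since w^2 has
   derivative in s of integral 0,
     int w_s^2 + e^(2s) |w_y|^2 ds dy = int |grad u|^2 dV - (n^2/4) int u^2 dV.
   The one-dimensional sharp logarithmic Sobolev inequality, proved by
   transporting to a Gaussian, is tensorised by the chain rule of entropy:
   the density w^2 is disintegrated over s, and each slice is treated at scale
   e^s, which turns ln w^2 into ln (e^(ns) w^2) = ln u^2 and the y-derivatives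
   into e^s w_y.  This bounds 2 int u^2 ln |u| dV, for every a > 0, by
     a (int |grad u|^2 dV - n^2/4) - N (1 + ln (pi a) / 2).
   As n^2/4 > N^2 (N-1) / (4 (N+2)) for N >= 3, choosing a = N / (2 energy) yields
   the theorem.  That w has weak derivatives in the coordinates (s, y), and is
   therefore absolutely continuous on almost every coordinate line, is obtained
   by testing the weak gradient with compactly supported fields along the
   coordinate directions.  Applied to u = 1, the same fields show that the
   measure J dx is mapped to a multiple of Lebesgue measure. *)
Require Import Defs.
From HB Require Import structures.
From mathcomp Require Import all_boot all_order all_algebra.
From mathcomp Require Import all_classical all_reals all_analysis.
From mathcomp Require Import perm measurable_realfun ring lra.
Import Order.TTheory GRing.Theory Num.Theory.
Import numFieldNormedType.Exports.
Set Implicit Arguments.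
Unset Strict Implicit.
Unset Printing Implicit Defensive.
Local Open Scope classical_set_scope.
Local Open Scope ring_scope.

(** * Lebesgue measure on row vectors *)

(** On a space of infinite volume the negative part of [u^2 ln |u|] may have infinite integral, so
    an entropy bound does not pass from slices to the whole by Fubini alone. Each entropy lemma
    therefore gives three facts together: the positive part is integrable, its integral has an
    explicit bound, and the sharp estimate holds if the entropy is integrable. The bounds on
    positive parts control the integration over slices and leave only negative parts to the
    integrability assumption. The hypothesis carried along is [D^2 <= 4 G K]. It models [G = w^2],
    [D = 2 w w'], [K = w'^2], survives integrating out variables by Cauchy-Schwarz, and avoids
    differentiating a square root where it vanishes. For [N = n + 1], the spectral constant
    [n^2 / 4] exceeds [N^2 (N-1) / (4 (N+2))] by [(N-1) (N-2) / (4 (N+2))], which keeps the argument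
    of the final logarithm positive. *)

Section fubini_rV.
Context (R : realType).
Local Notation lam := (@lebesgue_measure R).
Local Notation L := (@lebesgue_rV R).
Local Open Scope ereal_scope.

Lemma measurable_rV_comp n d (T : measurableType d) (f : 'rV[R]_n.+1 -> T) :
  measurable_fun setT f ->
  measurable_fun setT (fun p : measurableTypeR R * 'rV[R]_n => f (rV_cons p)).
Proof. by move=> mf; apply: (measurableT_comp mf); exact: measurable_rV_cons. Qed.

Lemma ge0_integral_rVS n (f : 'rV[R]_n.+1 -> \bar R) :
  measurable_fun setT f -> (forall y, 0 <= f y) ->
  \int[L n.+1]_y f y = \int[(lam \x L n)%E]_p f (rV_cons p).
Proof.
move=> mf f0.
have := @ge0_integral_pushforward _ _ _ _ R _ (@measurable_rV_cons R n)
  (lam \x L n)%E setT f measurableT mf (fun y _ => f0 y).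
by rewrite preimage_setT.
Qed.

Lemma integrable_rVS n (f : 'rV[R]_n.+1 -> \bar R) :
  measurable_fun setT f ->
  (L n.+1).-integrable setT f <->
  (lam \x L n)%E.-integrable setT (fun p => f (rV_cons p)).
Proof.
move=> mf; split => /integrableP[_ h]; apply/integrableP; split => //.
- exact: measurable_rV_comp.
- move: h; rewrite ge0_integral_rVS//; exact: measurableT_comp.
- rewrite ge0_integral_rVS//; exact: measurableT_comp.
Qed.

Lemma integral_rVS n (f : 'rV[R]_n.+1 -> \bar R) :
  (L n.+1).-integrable setT f ->
  \int[L n.+1]_y f y = \int[(lam \x L n)%E]_p f (rV_cons p).
Proof.
move=> fi; have mf := measurable_int _ fi.
have := @integral_pushforward _ _ _ _ R _ (@measurable_rV_cons R n)
  (lam \x L n)%E setT f mf.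
rewrite preimage_setT; apply => //.
exact/integrable_rVS.
Qed.

Lemma rV_cons0 n (p : measurableTypeR R * 'rV[R]_n) : rV_cons p ord0 ord0 = p.1.
Proof. by rewrite -[in RHS](rV_consK p). Qed.

Lemma rV_consS n (p : measurableTypeR R * 'rV[R]_n) (j : 'I_n) :
  rV_cons p ord0 (lift ord0 j) = p.2 ord0 j.
Proof.
rewrite -[in RHS](rV_consK p) /=; move: (rV_cons p) => y.
by rewrite mxE; congr (y _ _); exact/val_inj.
Qed.

Lemma ge0_integral0_ae d (T : measurableType d)
    (m : {measure set T -> \bar R}) (f : T -> \bar R) :
  measurable_fun setT f -> (forall x, 0 <= f x) -> \int[m]_x f x = 0 ->
  {ae m, forall x, f x = 0}.
Proof.
move=> mf f0 If0.
have /(ae_eq_integral_abs _ measurableT mf) : \int[m]_x `|f x| = 0.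
  by rewrite -{}If0; apply: eq_integral => x _; rewrite gee0_abs.
by apply: filterS => x; exact.
Qed.

(** The indicator of the exceptional null set has both iterated integrals equal to 0 by Tonelli, and
    a nonnegative function of integral 0 vanishes almost everywhere; applied twice, this passes to
    almost every slice in each variable. *)
Lemma ae_prod d1 d2 (T1 : measurableType d1) (T2 : measurableType d2)
    (m1 : {sigma_finite_measure set T1 -> \bar R})
    (m2 : {sigma_finite_measure set T2 -> \bar R}) (P : T1 * T2 -> Prop) :
  {ae (m1 \x m2), forall p, P p} ->
  {ae m1, forall x, {ae m2, forall y, P (x, y)}} /\
  {ae m2, forall y, {ae m1, forall x, P (x, y)}}.
Proof.
move=> [A [mA A0 PA]].
have mi : measurable_fun setT (fun p : T1 * T2 => (\1_A p)%:E : \bar R).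
  exact/measurable_EFinP/measurable_indic.
have i0 p : 0 <= (\1_A p)%:E :> \bar R by rewrite lee_fin.
have I0 : \int[(m1 \x m2)]_p (\1_A p)%:E = 0.
  by rewrite integral_indic// setIT.
have PA' p : (\1_A p)%:E = 0 :> \bar R -> P p.
  move=> [] /eqP; rewrite indicE pnatr_eq0 eqb0 notin_setE => nAp.
  by apply: contrapT => nP; apply: nAp; exact: PA.
split.
- have : \int[m1]_x (\int[m2]_y (\1_A (x, y))%:E) = 0.
    by rewrite -I0 fubini_tonelli1.
  move=> /ge0_integral0_ae [].
  + exact: (@measurable_fun_fubini_tonelli_F _ _ T1 T2 R m2 _ mi i0).
  + by move=> x; exact: integral_ge0.
  + move=> B [mB B0 PB]; exists B; split => // x /= nP; apply: PB => /= h.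
  apply: nP; apply: filterS (ge0_integral0_ae _ _ h) => [y|//|//].
    exact: PA'.
  exact: (measurableT_comp mi).
- have : \int[m2]_y (\int[m1]_x (\1_A (x, y))%:E) = 0.
    by rewrite -I0 fubini_tonelli2.
  move=> /ge0_integral0_ae [].
  + exact: (@measurable_fun_fubini_tonelli_G _ _ T1 T2 R m1 _ mi i0).
  + by move=> x; exact: integral_ge0.
  + move=> B [mB B0 PB]; exists B; split => // x /= nP; apply: PB => /= h.
  apply: nP; apply: filterS (ge0_integral0_ae _ _ h) => [y|//|//].
    exact: PA'.
  exact: (measurableT_comp mi).
Qed.

Lemma ae_rVS n (P : 'rV[R]_n.+1 -> Prop) :
  {ae L n.+1, forall y, P y} ->
  {ae (lam \x L n), forall p, P (rV_cons p)}.
Proof.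
move=> [A [mA A0 PA]]; exists (@rV_cons R n @^-1` A); split => //.
  by rewrite -[X in measurable X]setTI; exact: measurable_rV_cons.
by move=> p /= nP; exact: PA.
Qed.

Lemma rVS_ae n (P : 'rV[R]_n.+1 -> Prop) :
  {ae (lam \x L n), forall p, P (rV_cons p)} ->
  {ae L n.+1, forall y, P y}.
Proof.
move=> [A [mA A0 PA]]; exists (@rV_uncons R n @^-1` A); split.
- by rewrite -[X in measurable X]setTI; exact: measurable_rV_uncons.
- rewrite -[RHS]A0 /= /lebesgue_rVS /pushforward; congr (_ _).
  by apply/funext => p; rewrite /preimage/= rV_consK.
- by move=> y /= nP; apply: PA => /=; rewrite rV_unconsK.
Qed.

End fubini_rV.

(** * Boxes and uniqueness of measures *)

Section box.
Context (R : realType).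
Local Notation lam := (@lebesgue_measure R).
Local Notation L := (@lebesgue_rV R).

Definition box n (a b : 'I_n -> R) : set 'rV[R]_n :=
  [set y | forall i, a i < y ord0 i < b i].

Lemma measurable_box n (a b : 'I_n -> R) : measurable (box a b).
Proof.
rewrite (_ : box a b =
    \bigcap_(i in [set: 'I_n]) ((fun y : 'rV[R]_n => y ord0 i) @^-1` `]a i, b i[)).
  apply: fin_bigcap_measurable => // i _; rewrite -[X in measurable X]setTI.
  by apply: measurable_coord => //; exact: measurable_itv.
apply/seteqP; split => y /=.
  by move=> h i _ /=; rewrite in_itv /=; exact: h.
by move=> h i; have := h i I; rewrite /= in_itv.
Qed.

Lemma boxI n (a b c d : 'I_n -> R) : box a b `&` box c d =
  box (fun i => Num.max (a i) (c i)) (fun i => Num.min (b i) (d i)).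
Proof.
apply/seteqP; split => y /=.
  move=> [h k] i; have /andP[? ?] := h i; have /andP[? ?] := k i.
  by rewrite gt_max lt_min; apply/andP; split; apply/andP.
move=> h; split => i; have := h i; rewrite gt_max lt_min;
  by move=> /andP[/andP[? ?] /andP[? ?]]; apply/andP.
Qed.

Definition boxes n := [set A | exists a b : 'I_n -> R, A = box a b].

Lemma bigcup_box n :
  \bigcup_k box (fun=> - k%:R) (fun _ : 'I_n => k%:R) = setT.
Proof.
apply/seteqP; split => // y _.
exists (Num.bound (\sum_i `|y ord0 i|)) => // i.
have : `|y ord0 i| < (Num.bound (\sum_i `|y ord0 i|))%:R.
  apply: le_lt_trans (archi_boundP _); last exact: sumr_ge0.
  by rewrite (bigD1 i)//= lerDl sumr_ge0.
by rewrite ltr_norml.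
Qed.

Lemma measurable_boxesE n : @measurable _ 'rV[R]_n = <<s @boxes n >>.
Proof.
apply/seteqP; split; last first.
  apply: smallest_sub; first exact: sigma_algebra_measurable.
  by move=> _ [a [b ->]]; exact: measurable_box.
apply: smallest_sub; first exact: smallest_sigma_algebra.
rewrite -bigcup_seq => A [i _ [B mB <-]].
suff : measurable_fun setT
    (fun x : g_sigma_algebraType (@boxes n) => x ord0 i : measurableTypeR R).
  by move=> /(_ measurableT _ mB).
apply: (@measurability _ _ _ _ _ _ (@RGenOInfty.G R)).
  exact: RGenOInfty.measurableE.
move=> _ [_ [x ->] <-]; rewrite setTI.
(* A half-space is a countable union of boxes: the [i]-th side starts at [x], every other bound
   recedes with [k]. *)
rewrite (_ : _ @^-1` _ = \bigcup_k
    box (fun j => if j == i then x else - k%:R) (fun _ : 'I_n => k%:R)).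
  by apply: bigcupT_measurable => k; apply: sub_sigma_algebra; do 2 eexists.
apply/seteqP; split => y /=.
  rewrite in_itv/= andbT => xy.
  have : (\bigcup_k box (fun=> - k%:R) (fun _ : 'I_n => k%:R)) y.
    by rewrite bigcup_box.
  move=> [k _ yk]; exists k => // j; have := yk j.
  by case: eqP => [->|//]; rewrite xy => /andP[].
by move=> [k _ /(_ i)]; rewrite eqxx in_itv/= andbT => /andP[].
Qed.

(** Boxes form a pi-system generating the sigma-algebra, and the boxes of half-side [k] exhaust the
    space. The identifications of measures on row vectors below go through this: coordinate swaps,
    densities compared by tests, the image of [J dx]. *)
Lemma measure_box_unique n (m1 m2 : {measure set 'rV[R]_n -> \bar R}) :
  (forall a b, m1 (box a b) = m2 (box a b)) ->
  (forall a b, (m1 (box a b) < +oo)%E) ->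
  forall A, measurable A -> m1 A = m2 A.
Proof.
move=> m12 m1oo; apply: (measure_unique (@boxes n)
  (fun k => box (fun=> - k%:R) (fun _ : 'I_n => k%:R))).
- exact: measurable_boxesE.
- by move=> _ _ [a [b ->]] [c [d ->]]; rewrite boxI; do 2 eexists.
- by move=> k; do 2 eexists.
- exact: bigcup_box.
- by move=> _ [a [b ->]].
- by move=> k; exact: m1oo.
Qed.

Lemma lebesgue_rV_box n (a b : 'I_n -> R) :
  L n (box a b) = (\prod_i Num.max (b i - a i) 0)%:E.
Proof.
elim: n a b => [|n ih] a b.
  rewrite big_ord0 /= diracE mem_set// => -[].
  by case.
rewrite big_ord_recl /= /lebesgue_rVS /pushforward.
rewrite (_ : _ @^-1` _ = `]a ord0, b ord0[ `*`
    box (fun j => a (lift ord0 j)) (fun j => b (lift ord0 j))); last first.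
  apply/seteqP; split => -[t v] /=.
    move=> h; split.
      by have := h ord0; rewrite rV_cons0 in_itv.
    by move=> j; have := h (lift ord0 j); rewrite rV_consS.
  move=> [h k] i; case: (unliftP ord0 i) => [j ->|->].
    by rewrite rV_consS; exact: k.
  by rewrite rV_cons0; move: h; rewrite in_itv.
rewrite product_measure1E//; last exact: measurable_box.
rewrite [X in (_ * X)%E](ih _ _) EFinM; congr (_ * _)%E.
have : lam `]a ord0, b ord0[%classic = (Num.max (b ord0 - a ord0) 0)%:E.
  rewrite lebesgue_measure_itv/= lte_fin; case: ltP => [ab|ba].
    by rewrite max_l ?subr_ge0 1?ltW// EFinB.
  by rewrite max_r// subr_le0.
exact.
Qed.

Lemma lebesgue_rV_box_fin n (a b : 'I_n -> R) : (L n (box a b) < +oo)%E.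
Proof. by rewrite lebesgue_rV_box ltry. Qed.

End box.

(** * Integrals of real-valued functions *)

Section real_integrals.
Context d (T : measurableType d) (R : realType) (m : {measure set T -> \bar R}).
Local Notation intg f := (m.-integrable setT (EFin \o f)).
Implicit Types f g : T -> R.

Lemma ae_imp (P Q : T -> Prop) : {ae m, forall x, P x} ->
  (forall x, P x -> Q x) -> {ae m, forall x, Q x}.
Proof. by move=> h PQ; apply: filterS h. Qed.

Lemma ae_imp2 (P Q S : T -> Prop) : {ae m, forall x, P x} ->
  {ae m, forall x, Q x} -> (forall x, P x -> Q x -> S x) -> {ae m, forall x, S x}.
Proof. by move=> hP hQ PQ; apply: filterS2 hP hQ. Qed.

Lemma EFin_Rintegral f : intg f -> (\int[m]_x f x)%:E = (\int[m]_x (f x)%:E)%E.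
Proof. by move=> fi; rewrite fineK// integrable_fin_num. Qed.

Lemma integrable_measurable f : intg f -> measurable_fun setT f.
Proof. by move=> /measurable_int /measurable_EFinP. Qed.

Lemma le_intg f g : measurable_fun setT f -> (forall x, `|f x| <= g x) ->
  intg g -> intg f.
Proof.
move=> mf fg; apply: le_integrable => //; first exact/measurable_EFinP.
by move=> x _ /=; rewrite lee_fin (le_trans (fg x))// ler_norm.
Qed.

Lemma intgD f g : intg f -> intg g -> intg (fun x => f x + g x).
Proof. by move=> fi gi; have := integrableD measurableT fi gi. Qed.

Lemma intgB f g : intg f -> intg g -> intg (fun x => f x - g x).
Proof. by move=> fi gi; have := integrableB measurableT fi gi. Qed.

Lemma intgZ (k : R) f : intg f -> intg (fun x => k * f x).
Proof. by move=> fi; have := integrableZl measurableT k fi. Qed.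

Lemma ge0_intg_le f (M : R) : measurable_fun setT f -> (forall x, 0 <= f x) ->
  (\int[m]_x (f x)%:E <= M%:E)%E -> intg f /\ \int[m]_x f x <= M.
Proof.
move=> mf f0 fM; have fi : intg f.
  apply/integrableP; split; first exact/measurable_EFinP.
  under eq_integral do rewrite /= ger0_norm//.
  by rewrite (le_lt_trans fM)// ltry.
by split=> //; rewrite -lee_fin EFin_Rintegral.
Qed.

Lemma ae_eq_Rintegral f g : measurable_fun setT f -> measurable_fun setT g ->
  {ae m, forall x, f x = g x} -> \int[m]_x f x = \int[m]_x g x.
Proof.
move=> mf mg fg; congr fine; apply: ae_eq_integral => //;
  [exact/measurable_EFinP..|].
by apply: filterS fg => x + _; move=> /= ->.
Qed.

Lemma ae_eq_intg f g : measurable_fun setT g ->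
  {ae m, forall x, f x = g x} -> intg f -> intg g.
Proof.
move=> mg fg /integrableP[mf fi].
apply/integrableP; split; first exact/measurable_EFinP.
rewrite (_ : \int[m]_x _ = \int[m]_x `|(EFin \o f) x|)%E//.
apply: ae_eq_integral => //.
- by apply: measurableT_comp => //; exact/measurable_EFinP.
- by apply: measurableT_comp.
by apply: filterS fg => x + _; move=> /= ->.
Qed.

Lemma ae_le_Rintegral f g : intg f -> intg g ->
  {ae m, forall x, f x <= g x} -> \int[m]_x f x <= \int[m]_x g x.
Proof.
move=> fi gi fg.
(* Replacing [g] by [max f g], which equals it almost everywhere, makes the inequality hold
   everywhere. *)
have hi : intg (fun x => Num.max (f x) (g x)).
  apply: (@le_intg _ (fun x => `|f x| + `|g x|)).
  - by apply: measurable_maxr; exact: integrable_measurable.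
  - move=> x; case: (leP (f x) (g x)) => _.
      by rewrite lerDr.
    by rewrite lerDl.
  by apply: intgD; exact: integrable_norm.
rewrite (@ae_eq_Rintegral g (fun x => Num.max (f x) (g x))).
- by apply: le_Rintegral => // x _; rewrite le_max lexx.
- exact: integrable_measurable.
- exact: integrable_measurable.
- by apply: filterS fg => x fgx; rewrite max_r.
Qed.

Lemma dominated_Rintegral (f_ : nat -> T -> R) f g :
  (forall n, measurable_fun setT (f_ n)) -> measurable_fun setT f ->
  {ae m, forall x, f_ ^~ x @ \oo --> f x} ->
  intg g -> (forall n x, `|f_ n x| <= g x) ->
  (fun n => \int[m]_x f_ n x) @ \oo --> \int[m]_x f x.
Proof.
move=> mf_ mf ff gi fg.
have [| | | | |fi _ H] := @dominated_convergence _ _ _ m setT measurableT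
  (fun n => EFin \o f_ n) (EFin \o f) (EFin \o g).
- by move=> n; exact/measurable_EFinP.
- exact/measurable_EFinP.
- by apply: filterS ff => x fx _; apply: cvg_EFin => //; exact: nearW.
- exact: gi.
- by apply: aeW => x n _ /=; rewrite lee_fin.
apply: fine_cvg; rewrite EFin_Rintegral//.
Qed.

Lemma Rintegral0_ae f : intg f -> (forall x, 0 <= f x) -> \int[m]_x f x = 0 ->
  {ae m, forall x, f x = 0}.
Proof.
move=> fi f0 If; have : (\int[m]_x (f x)%:E)%E = 0%E.
  by rewrite -EFin_Rintegral// If.
move=> /ge0_integral0_ae []//; first exact: measurable_int fi.
by move=> A [mA A0 PA]; exists A; split => // x /= fx; apply: PA => /= -[].
Qed.

Lemma RintegralZ (k : R) f : intg f -> \int[m]_x (k * f x) = k * \int[m]_x f x.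
Proof. by move=> fi; rewrite RintegralZl. Qed.

End real_integrals.

(** * Primitives vanishing at -oo *)

Section primitive.
Context (R : realType).
Local Notation lam := (@lebesgue_measure R).
Local Notation intg f := (lam.-integrable setT (EFin \o f)).
Implicit Types f F : R -> R.

(** For integrable [D], an identity [W = prim D] says that [W] is absolutely continuous with
    derivative [D] and tends to 0 at -oo; absolute continuity on lines is expressed in this form
    throughout. *)
Definition prim f (x : R) := \int[lam]_(r in `]-oo, x]) f r.

(** Moves the endpoint of integration into the integrand, so that the dependence on [x] is handled
    by dominated convergence and Fubini on the whole line. *)
Definition cutl f (x r : R) := (r <= x)%R%:R * f r.

Lemma primE f x : prim f x = \int[lam]_r cutl f x r.
Proof.
rewrite /prim Rintegral_mkcond; congr fine; apply: eq_integral => r _ /=.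
rewrite patchE /cutl; case: ifPn; rewrite ?inE ?notin_setE /= in_itv/=.
  by move=> ->; rewrite mul1r.
by move=> /negP/negbTE ->; rewrite mul0r.
Qed.

Lemma measurable_le_cst (x : R) : measurable_fun [set: R] (fun r => (r <= x)%R%:R : R).
Proof.
rewrite (_ : (fun _ => _) = \1_(`]-oo, x]%classic)).
  exact: measurable_indic.
by apply/funext => r; rewrite indicE mem_setE in_itv.
Qed.

Lemma integrable_prim f x : intg f -> intg (cutl f x).
Proof.
move=> fi; apply: (le_intg _ _ (integrable_norm fi)).
  apply: measurable_funM; first exact: measurable_le_cst.
  exact: integrable_measurable fi.
by move=> r /=; rewrite /cutl; case: (r <= x); rewrite ?mul1r// mul0r normr0.
Qed.

Lemma ae_neq (x0 : R) : {ae lam, forall r : R, r != x0}.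
Proof.
exists [set x0]; split => //; first exact: lebesgue_measure_set1.
by move=> r /= /negP; rewrite negbK => /eqP.
Qed.

(** One dominated convergence argument behind both limits at infinity and the continuity of
    [prim f]; only the pointwise limit [h] of the cut functions changes. *)
Lemma prim_cvg_seq f (u : R^nat) (h : R -> R) : intg f ->
  measurable_fun setT h ->
  {ae lam, forall r : R, cutl f (u n) r @[n --> \oo] --> h r} ->
  prim f (u n) @[n --> \oo] --> \int[lam]_r h r.
Proof.
move=> fi mh uh; under eq_fun do rewrite primE.
apply: (@dominated_Rintegral _ _ _ lam (fun n => cutl f (u n)) h
  (Num.norm \o f) _ mh uh (integrable_norm fi)).
  move=> n; apply: measurable_funM; first exact: measurable_le_cst.
  exact: integrable_measurable fi.
by move=> n r /=; rewrite /cutl; case: (r <= _); rewrite ?mul1r// mul0r normr0.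
Qed.

Lemma prim_cvgy f : intg f -> prim f x @[x --> +oo] --> \int[lam]_r f r.
Proof.
move=> fi; apply/cvg_pinftyP => u uoo; apply: prim_cvg_seq => //.
  exact: integrable_measurable fi.
apply: aeW => r; apply: cvg_near_cst; near=> n.
suff rn : r <= u n by rewrite /cutl rn mul1r.
by near: n; move/cvgryPge : uoo; exact.
Unshelve. all: by end_near. Qed.

Lemma prim_cvgNy f : intg f -> prim f x @[x --> -oo] --> 0.
Proof.
move=> fi; apply/cvg_ninftyP => u uoo.
rewrite -(Rintegral_set0 lam f) Rintegral_mkcond.
apply: prim_cvg_seq => //; first by rewrite patch_set0; exact: measurable_cst.
apply: aeW => r; rewrite patch_set0; apply: cvg_near_cst; near=> n.
suff rn : (r <= u n) = false by rewrite /cutl rn mul0r.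
apply/negbTE; rewrite -ltNge.
by near: n; move/cvgrNyPlt : uoo; exact.
Unshelve. all: by end_near. Qed.

Lemma continuous_prim f : intg f -> continuous (prim f).
Proof.
move=> fi x; apply/(@cvg_nbhsP _ R^o) => u ux; rewrite [X in _ --> X]primE.
apply: prim_cvg_seq => //; first exact: integrable_measurable (integrable_prim x fi).
apply: (ae_imp (ae_neq x)) => r rx.
case/lt_total/orP : rx => rx; apply: cvg_near_cst; near=> n; rewrite /cutl.
  have ru : r < u n by near: n; move/cvgr_gt : ux; exact.
  by rewrite !ltW.
have ru : u n < r by near: n; move/cvgr_lt : ux; exact.
by rewrite !leNgt rx ru.
Unshelve. all: by end_near. Qed.

Lemma is_derive_prim f (x : R) : intg f -> {for x, continuous f} ->
  is_derive x 1 (prim f) (f x).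
Proof.
move=> fi cf.
have h1 : lam.-integrable `]-oo, x + 1] (EFin \o f) by exact: integrableS fi.
have x1 : x < x + 1 by rewrite ltrDl.
have [H1 H2] := @continuous_FTC1 R f -oo%O x (x + 1) x1 h1 (ltNyr x) cf.
split; first exact: H1.
by rewrite -derive1E; exact: H2.
Qed.

Lemma prim_ge0 f x : (forall r, 0 <= f r) -> 0 <= prim f x.
Proof. by move=> f0; apply: Rintegral_ge0. Qed.

Lemma prim_ndecr f : intg f -> (forall r, 0 <= f r) ->
  {homo prim f : x y / x <= y}.
Proof.
move=> fi f0 x y xy; rewrite !primE; apply: le_Rintegral => //.
- exact: integrable_prim.
- exact: integrable_prim.
move=> r _; rewrite /cutl ler_wpM2r// ler_nat; case: (leP r x) => [rx|//].
by rewrite (le_trans rx xy).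
Qed.

Lemma prim_le f x : intg f -> (forall r, 0 <= f r) ->
  prim f x <= \int[lam]_r f r.
Proof.
move=> fi f0; rewrite primE; apply: le_Rintegral => //.
  exact: integrable_prim.
by move=> r _; rewrite /cutl; case: (r <= x); rewrite ?mul1r// mul0r.
Qed.

Lemma prim_itv f (a b : R) : intg f -> a <= b ->
  prim f b - prim f a = \int[lam]_(r in `[a, b]) f r.
Proof.
move=> fi ab; rewrite Rintegral_mkcond !primE -RintegralB//; [|exact: integrable_prim..].
apply: ae_eq_Rintegral.
- apply: measurable_funB; exact: integrable_measurable (integrable_prim _ fi).
- by apply/measurable_restrict => //; apply: measurable_funTS; exact: integrable_measurable fi.
(* [cutl f b - cutl f a] is [f] cut to []a, b]], which differs from the closed interval at the
   single point [a]. *)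
apply: (ae_imp (ae_neq a)) => r; rewrite /cutl patchE mem_setE in_itv/=.
case: (ltgtP r a) => //= ra _.
  by rewrite (le_trans (ltW ra) ab) subrr.
by case: (r <= b); rewrite ?mul1r ?mul0r subr0.
Qed.

Lemma FTC2_closed f F (a b : R) : a <= b ->
  (forall x : R, a <= x <= b -> is_derive x 1 F (f x)) ->
  (forall x : R, a <= x <= b -> {for x, continuous f}) ->
  \int[lam]_(x in `[a, b]) f x = F b - F a.
Proof.
rewrite le_eqVlt => /predU1P[<-|ab] dF cf.
  by rewrite set_itv1 Rintegral_set1 subrr.
have cF x : a <= x <= b -> {for x, continuous F}.
  move=> /dF h; have /derivable1_diffP := @ex_derive _ _ _ _ _ _ _ h.
  exact: differentiable_continuous.
rewrite /Rintegral (@continuous_FTC2 _ f F)//.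
- apply/continuous_in_subspaceT => x; rewrite inE/= in_itv/= => ?; exact: cf.
- split.
  + move=> x; rewrite in_itv/= => /andP[ax xb].
    by apply: ex_derive; apply: dF; rewrite !ltW.
  + by apply: cvg_at_right_filter; apply: cF; rewrite lexx ltW.
  + by apply: cvg_at_left_filter; apply: cF; rewrite lexx ltW.
- move=> x; rewrite in_itv/= => /andP[ax xb].
  by rewrite derive1E; apply: derive_val; apply: dF; rewrite !ltW.
Qed.

End primitive.

(** * The one-dimensional logarithmic Sobolev inequality *)

Section gaussian.
Context (R : realType).
Local Notation lam := (@lebesgue_measure R).
Local Notation intg f := (lam.-integrable setT (EFin \o f)).

Definition gauss (t : R) : R := (Num.sqrt (pi *+ 2))^-1 * expR (- (t ^+ 2 / 2)).

Lemma gaussE : gauss = normal_pdf 0 1.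
Proof.
rewrite normal_pdfE ?oner_neq0//; apply/funext => t.
by rewrite /gauss /normal_peak /normal_fun subr0 expr1n mul1r mulNr.
Qed.

Lemma gauss_gt0 t : 0 < gauss t.
Proof.
by rewrite mulr_gt0 ?expR_gt0// invr_gt0 sqrtr_gt0 mulrn_wgt0// pi_gt0.
Qed.

Lemma ln_gauss t : ln (gauss t) = - (t ^+ 2 / 2) - ln (pi *+ 2) / 2.
Proof.
rewrite lnM ?posrE ?expR_gt0//; last by rewrite invr_gt0 sqrtr_gt0 mulrn_wgt0// pi_gt0.
rewrite expRK lnV ?posrE; last by rewrite sqrtr_gt0 mulrn_wgt0// pi_gt0.
have p0 : 0 < pi *+ 2 :> R by rewrite mulrn_wgt0// pi_gt0.
rewrite addrC; congr (_ - _).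
rewrite -[in RHS](sqr_sqrtr (ltW p0)) lnXn ?sqrtr_gt0//.
by rewrite -[X in X / 2]mulr_natr mulfK.
Qed.

Lemma is_derive_gauss (t : R) : is_derive t 1 gauss (- t * gauss t).
Proof.
rewrite /gauss; apply: is_derive_eq.
rewrite /GRing.scale /=; move: (_^-1) => c.
by field.
Qed.

Lemma continuous_gauss : continuous gauss.
Proof.
move=> t; apply: differentiable_continuous; apply/derivable1_diffP.
exact: (@ex_derive _ _ _ _ _ _ _ (is_derive_gauss t)).
Qed.

Lemma integrable_gauss : intg gauss.
Proof. by rewrite gaussE; exact: integrable_normal_pdf. Qed.

Lemma Rintegral_gauss : \int[lam]_t gauss t = 1.
Proof. by rewrite gaussE /Rintegral integral_normal_pdf. Qed.

Definition Gauss := prim gauss.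

Lemma is_derive_Gauss (t : R) : is_derive t 1 Gauss (gauss t).
Proof.
exact: is_derive_prim integrable_gauss (@continuous_gauss t).
Qed.

Lemma continuous_Gauss : continuous Gauss.
Proof. exact: continuous_prim integrable_gauss. Qed.

Lemma Gauss_lt : {mono Gauss : x y / x < y}.
Proof.
apply: leW_mono; apply: le_mono => x y xy; rewrite -subr_gt0.
have cG : {within `[x, y], continuous Gauss}.
  exact/continuous_subspaceT/continuous_Gauss.
have [z _ ->] := MVT xy (fun t _ => is_derive_Gauss t) cG.
by rewrite mulr_gt0 ?subr_gt0// gauss_gt0.
Qed.

Lemma Gauss_cvgNy : Gauss x @[x --> -oo] --> (0 : R).
Proof. exact: prim_cvgNy integrable_gauss. Qed.

Lemma Gauss_cvgy : Gauss x @[x --> +oo] --> (1 : R).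
Proof. by rewrite -Rintegral_gauss; exact: prim_cvgy integrable_gauss. Qed.

Lemma Gauss_gt0 t : 0 < Gauss t.
Proof.
apply: (@le_lt_trans _ _ (Gauss (t - 1))); last by rewrite Gauss_lt ltrBlDr ltrDl.
by apply: prim_ge0 => r; exact/ltW/gauss_gt0.
Qed.

Lemma Gauss_lt1 t : Gauss t < 1.
Proof.
apply: (@lt_le_trans _ _ (Gauss (t + 1))); first by rewrite Gauss_lt ltrDl.
rewrite -Rintegral_gauss; apply: prim_le integrable_gauss _ => r.
exact/ltW/gauss_gt0.
Qed.

Lemma is_derive_continuous (f : R -> R) (x df : R) :
  is_derive x 1 f df -> {for x, continuous f}.
Proof.
move=> h; apply: differentiable_continuous; apply/derivable1_diffP.
exact: (@ex_derive _ _ _ _ _ _ _ h).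
Qed.

Lemma mul_gauss_cvgy : t * gauss t @[t --> +oo] --> (0 : R).
Proof.
pose c : R := (Num.sqrt (pi *+ 2))^-1.
have c0 : 0 <= c by rewrite invr_ge0.
have h : t^-1 * (c * 2) @[t --> +oo] --> (0 : R).
  rewrite -(mul0r (c * 2)); apply: cvgMr_tmp.
  by apply/gtr0_cvgV0; [near=> t|exact: cvg_id].
apply: (@squeeze_cvgr _ _ _ _ (cst 0) (fun t => t^-1 * (c * 2))) => //; last exact: cvg_cst.
near=> t; have t0 : 0 < t by near: t; exact: nbhs_pinfty_gt.
rewrite mulr_ge0 ?(ltW t0) ?(ltW (gauss_gt0 _))//= /gauss -/c expRN.
(* Since [1 + t^2 / 2 <= exp (t^2 / 2)], the product [t * gauss t] is at most [2 c / t]. *)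
have h2 : 0 < 1 + t ^+ 2 / 2 by rewrite addr_gt0// divr_gt0// exprn_gt0.
rewrite mulrCA (_ : t^-1 * _ = c * (2 / t)); last by ring.
rewrite ler_wpM2l// ler_pdivlMr//.
rewrite mulrAC ler_pdivrMr ?expR_gt0//.
apply: (@le_trans _ _ (2 * (1 + t ^+ 2 / 2))).
  by rewrite mulrDr mulr1 mulrCA divff// mulr1 expr2 lerDr.
by rewrite ler_wpM2l// expR_ge1Dx// divr_ge0// sqr_ge0.
Unshelve. all: by end_near. Qed.

(** Mills ratio bound for a Gaussian tail [H]: the difference [gauss t / t - H t] has derivative
    [- gauss t / t^2] and tends to 0 at +oo, hence is nonnegative for [t > 0]. *)
Lemma gauss_mills (H : R -> R) :
  (forall x : R, is_derive x 1 H (- gauss x)) ->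
  H x @[x --> +oo] --> (0 : R) ->
  forall t : R, 0 < t -> t * H t <= gauss t.
Proof.
move=> dH cH t t0; rewrite -ler_pdivlMl// mulrC -subr_ge0.
pose q := fun t => gauss t / t - H t; rewrite -[leRHS]/(q t).
have dq (x : R) : 0 < x -> is_derive x 1 q (- (gauss x / x ^+ 2)).
  move=> x0; have := is_derive_gauss x; have := dH x => ? ?.
  have x00 : x != 0 by rewrite gt_eqF.
  have := is_deriveV x00 (is_derive_id x 1) => ?.
  rewrite /q; apply: is_derive_eq.
  by rewrite /GRing.scale /=; field.
have q_cvg : q x @[x --> +oo] --> (0 : R).
  rewrite -(subrr 0); apply: (@cvgB _ R^o) => //.
  apply: (@squeeze_cvgr _ _ _ _ (cst 0) (fun t => t * gauss t)) => //;
    [|exact: cvg_cst|exact: mul_gauss_cvgy].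
  near=> x; have x1 : 1 <= x by near: x; exact: nbhs_pinfty_ge.
  have x0 : 0 < x by rewrite (lt_le_trans _ x1).
  rewrite divr_ge0 ?(ltW x0) ?(ltW (gauss_gt0 _))//= mulrC ler_wpM2r ?(ltW (gauss_gt0 _))//.
  by rewrite (le_trans _ x1)// invf_le1.
have qdec (x y : R) : t / 2 <= x -> x <= y -> q y <= q x.
  apply: ler0_derive1_nincry => [z|z|].
  - rewrite in_itv/= andbT => tz; apply: (@ex_derive _ _ _ _ _ _ _ (dq z _)).
    by rewrite (lt_trans _ tz)// divr_gt0.
  - rewrite in_itv/= andbT => tz; have z0 : 0 < z by rewrite (lt_trans _ tz)// divr_gt0.
    rewrite derive1E (@derive_val _ _ _ _ _ _ _ (dq z z0)) oppr_le0 divr_ge0//.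
      exact/ltW/gauss_gt0.
    exact: sqr_ge0.
  - apply: continuous_in_subspaceT => z; rewrite inE/= in_itv/= andbT => tz.
    by apply: is_derive_continuous (dq z _); rewrite (lt_le_trans _ tz)// divr_gt0.
apply: (cvgr_to_le q_cvg); near=> x; apply: qdec.
  by rewrite ler_pdivrMr// ler_peMr ?(ltW t0)// ler1n.
by near: x; apply: nbhs_pinfty_ge; exact: num_real.
Unshelve. all: by end_near. Qed.

Lemma Gauss_millsr (t : R) : 0 < t -> t * (1 - Gauss t) <= gauss t.
Proof.
apply: (@gauss_mills (fun t => 1 - Gauss t)) => [x|].
  have := is_derive_Gauss x => ?; apply: is_derive_eq.
  by rewrite /GRing.scale /= add0r mul1r.
by rewrite -(subrr 1); apply: (@cvgB _ R^o); [exact: cvg_cst|exact: Gauss_cvgy].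
Qed.

Lemma gaussN t : gauss (- t) = gauss t.
Proof. by rewrite /gauss sqrrN. Qed.

Lemma Gauss_millsl (t : R) : 0 < t -> t * Gauss (- t) <= gauss t.
Proof.
apply: (@gauss_mills (fun t => Gauss (- t))) => [x|].
  have := is_derive_Gauss (- x) => ?; apply: is_derive_eq.
  by rewrite gaussN /GRing.scale /= mulrN1.
have := Gauss_cvgNy; move/cvgNy_compNP; exact.
Qed.

End gaussian.

Lemma ae_eq_integrable d (T : measurableType d) (R : realType)
    (m : {measure set T -> \bar R}) (f g : T -> \bar R) :
  measurable_fun setT g -> {ae m, forall x, f x = g x} ->
  m.-integrable setT f -> m.-integrable setT g.
Proof.
move=> mg fg /integrableP[mf fi]; apply/integrableP; split => //.
rewrite (_ : \int[m]_x _ = \int[m]_x `|f x|)%E//.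
apply: ae_eq_integral => //; [exact: measurableT_comp..|].
by apply: filterS fg => x + _; move=> /= ->.
Qed.

(** * Fubini for real-valued integrals *)

Section product_integrals.
Context d1 d2 (T1 : measurableType d1) (T2 : measurableType d2) (R : realType).
Context (m1 : {sigma_finite_measure set T1 -> \bar R}).
Context (m2 : {sigma_finite_measure set T2 -> \bar R}).

Lemma integrable_prodM (f : T1 -> R) (g : T2 -> R) :
  m1.-integrable setT (EFin \o f) -> m2.-integrable setT (EFin \o g) ->
  (m1 \x m2)%E.-integrable setT (EFin \o (fun p => f p.1 * g p.2)).
Proof.
move=> fi gi; have mf := integrable_measurable fi.
have mg := integrable_measurable gi.
apply/integrable12ltyP.
  apply/measurable_EFinP; apply: measurable_funM.
  - exact: (measurableT_comp mf).
  - exact: (measurableT_comp mg).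
rewrite (_ : (fun x => _) = fun x => `|f x|%:E * \int[m2]_y `|g y|%:E)%E; last first.
  apply/funext => x /=; under eq_integral do rewrite normrM EFinM.
  by rewrite ge0_integralZl//; apply/measurable_EFinP; exact: measurableT_comp.
rewrite ge0_integralZr//; last exact: integral_ge0.
  move/integrableP : fi => [_ ?]; move/integrableP : gi => [_ ?].
  by rewrite lte_mul_pinfty// ?ge0_fin_numE//; exact: integral_ge0.
by apply/measurable_EFinP; exact: measurableT_comp.
Qed.

Lemma measurable_Rintegral1 (f : T1 * T2 -> R) : measurable_fun setT f ->
  measurable_fun setT (fun x => \int[m2]_y f (x, y)).
Proof.
move=> /measurable_EFinP mf.
have -> : (fun x => \int[m2]_y f (x, y)) =
    fun x => fine (\int[m2]_y (EFin \o f)^\+ (x, y) -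
                   \int[m2]_y (EFin \o f)^\- (x, y))%E.
  apply/funext => x; rewrite /Rintegral [in LHS]integralE; congr (fine (_ - _))%E;
    by apply: eq_integral => z _; rewrite ?funeposE ?funenegE.
apply: measurableT_comp => //.
by apply: emeasurable_funB; apply: measurable_fun_fubini_tonelli_F => //;
  [exact: measurable_funepos|exact: measurable_funeneg].
Qed.

Lemma measurable_Rintegral2 (f : T1 * T2 -> R) : measurable_fun setT f ->
  measurable_fun setT (fun y => \int[m1]_x f (x, y)).
Proof.
move=> /measurable_EFinP mf.
have -> : (fun y => \int[m1]_x f (x, y)) =
    fun y => fine (\int[m1]_x (EFin \o f)^\+ (x, y) -
                   \int[m1]_x (EFin \o f)^\- (x, y))%E.
  apply/funext => y; rewrite /Rintegral [in LHS]integralE; congr (fine (_ - _))%E;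
    by apply: eq_integral => z _; rewrite ?funeposE ?funenegE.
apply: measurableT_comp => //.
by apply: emeasurable_funB; apply: measurable_fun_fubini_tonelli_G => //;
  [exact: measurable_funepos|exact: measurable_funeneg].
Qed.

Section integrable.
Context (f : T1 * T2 -> R).
Hypothesis fi : (m1 \x m2)%E.-integrable setT (EFin \o f).
Let mf : measurable_fun setT f. Proof. exact: integrable_measurable fi. Qed.

Let fubini_FE : {ae m1, forall x,
  (\int[m2]_y (f (x, y))%:E)%E = (\int[m2]_y f (x, y))%:E}.
Proof.
by apply: filterS (ae_integrable1 fi) => x hx; rewrite EFin_Rintegral.
Qed.

Let fubini_GE : {ae m2, forall y,
  (\int[m1]_x (f (x, y))%:E)%E = (\int[m1]_x f (x, y))%:E}.
Proof.
by apply: filterS (ae_integrable2 fi) => x hx; rewrite EFin_Rintegral.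
Qed.

Lemma integrable_Rintegral1 :
  m1.-integrable setT (EFin \o (fun x => \int[m2]_y f (x, y))).
Proof.
apply: (@ae_eq_integrable _ _ _ _ (fubini_F m2 (EFin \o f))).
- by apply/measurable_EFinP; exact: measurable_Rintegral1.
- exact: fubini_FE.
- exact: integrable_fubini_F fi.
Qed.

Lemma integrable_Rintegral2 :
  m2.-integrable setT (EFin \o (fun y => \int[m1]_x f (x, y))).
Proof.
apply: (@ae_eq_integrable _ _ _ _ (fubini_G m1 (EFin \o f))).
- by apply/measurable_EFinP; exact: measurable_Rintegral2.
- exact: fubini_GE.
- have h := integral21_prod_meas1 fi; have mG := measurable_fubini_G fi.
  apply/integrableP; split => //.
  apply: le_lt_trans ((integrable21ltyP m1 m2 (measurable_int _ fi)).1 fi).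
  apply: ge0_le_integral => //.
  + exact: measurableT_comp.
  + exact: (@measurable_fun_fubini_tonelli_G _ _ T1 T2 R m1 (abse \o (EFin \o f))
      (measurableT_comp _ (measurable_int _ fi)) (fun p => abse_ge0 _)).
  + move=> y _; apply: le_abse_integral => //.
    exact: (measurableT_comp (measurable_int _ fi)).
Qed.

Lemma Rfubini1 : \int[(m1 \x m2)%E]_p f p = \int[m1]_x \int[m2]_y f (x, y).
Proof.
rewrite /Rintegral -[in LHS](integral12_prod_meas1 fi); congr fine.
apply: ae_eq_integral => //.
- exact: measurable_fubini_F fi.
- by apply/measurable_EFinP; exact: measurable_Rintegral1.
- by apply: filterS fubini_FE => x hx _.
Qed.

Lemma Rfubini2 : \int[(m1 \x m2)%E]_p f p = \int[m2]_y \int[m1]_x f (x, y).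
Proof.
rewrite /Rintegral -[in LHS](integral21_prod_meas1 fi); congr fine.
apply: ae_eq_integral => //.
- exact: measurable_fubini_G fi.
- by apply/measurable_EFinP; exact: measurable_Rintegral2.
- by apply: filterS fubini_GE => x hx _.
Qed.

End integrable.

End product_integrals.

Lemma measurable_ler_ind d (T : measurableType d) (R : realType) (f g : T -> R) :
  measurable_fun setT f -> measurable_fun setT g ->
  measurable_fun setT (fun x => (f x <= g x)%R%:R : R).
Proof.
move=> mf mg.
rewrite (_ : (fun _ => _) = fun x => if f x <= g x then 1 else 0); last first.
  by apply/funext => x; case: ifP.
by apply: measurable_fun_ifT => //; exact: measurable_fun_ler.
Qed.

Section one_dimensional.
Context (R : realType).
Local Notation lam := (@lebesgue_measure R).
Local Notation intg f := (lam.-integrable setT (EFin \o f)).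

Lemma continuous_surj (f : R -> R) (l1 l2 v : R) : continuous f ->
  f x @[x --> -oo] --> l1 -> f x @[x --> +oo] --> l2 -> l1 < v < l2 ->
  exists c, f c = v.
Proof.
move=> cf f1 f2 /andP[v1 v2].
have [a [a0 fa]] : exists a, a <= 0 /\ f a < v.
  near (-oo : set_system R) => a; exists a; split.
    by near: a; apply: nbhs_ninfty_le; exact: num_real.
  by near: a; move/cvgr_lt : f1; exact.
have [b [b0 fb]] : exists b, 0 <= b /\ v < f b.
  near (+oo : set_system R) => b; exists b; split.
    by near: b; apply: nbhs_pinfty_ge; exact: num_real.
  by near: b; move/cvgr_gt : f2; exact.
have [||c _ fc] := @IVT R f a b v (le_trans a0 b0).
- exact/continuous_subspaceT.
- by rewrite min_l ?max_r ?ltW// (lt_trans fa).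
by exists c.
Unshelve. all: by end_near. Qed.

Lemma Rintegral_itv_cst (k a b : R) : a <= b ->
  \int[lam]_(x in `[a, b]) k = k * (b - a).
Proof.
move=> ab; have dk (x : R) : a <= x <= b -> is_derive x 1 (fun x => k * x) (cst k x).
  by move=> _; apply: is_derive_eq; rewrite /GRing.scale/= mulr1.
have ck (x : R) : a <= x <= b -> {for x, continuous (cst k : R -> R)}.
  by move=> _; exact: cvg_cst.
by rewrite [LHS](FTC2_closed ab dk ck) mulrBr.
Qed.

(** A nonzero limit would keep [|f|] above [|l| / 2] on a half-line, hence on intervals of any
    length, against the finite integral of [|f|]. Consequently the derivative of an integrable
    primitive has integral 0. *)
Lemma intg_cvgy_eq0 (f : R -> R) (l : R) : intg f ->
  f x @[x --> +oo] --> l -> l = 0.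
Proof.
move=> fi fl; apply/eqP; apply: contraT => l0.
have l20 : 0 < `|l| / 2 by rewrite divr_gt0 ?normr_gt0.
have [a Ha] : exists a : R, forall x, a <= x -> `|l| / 2 <= `|f x|.
  have : \forall x \near +oo, `|l| / 2 < `|f x|.
    move/cvg_norm : fl => /cvgr_gt; apply.
    by rewrite ltr_pdivrMr// ltr_pMr ?normr_gt0// ltr1n.
  move=> [a [_ Ha]]; exists (a + 1) => x ax; apply/ltW/Ha.
  by rewrite (lt_le_trans _ ax)// ltrDl.
have gi : intg (fun x => `|f x|) by exact: integrable_norm.
have H (b : R) : 0 <= b -> `|l| / 2 * b <= \int[lam]_x `|f x|.
  move=> b0; have aab : a <= a + b by rewrite lerDl.
  have -> : `|l| / 2 * b = \int[lam]_(x in `[a, a + b]) (`|l| / 2).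
    by rewrite Rintegral_itv_cst// addrAC subrr add0r.
  apply: (@le_trans _ _ (\int[lam]_(x in `[a, a + b]) `|f x|)).
    apply: le_Rintegral => //.
    - apply: continuous_compact_integrable; first exact: segment_compact.
      by apply: continuous_subspaceT => x; exact: cvg_cst.
    - exact: integrableS gi.
    - by move=> x; rewrite /= in_itv/= => /andP[ax _]; exact: Ha.
  rewrite -prim_itv// -[leRHS]subr0; apply: lerB.
    by apply: prim_le gi _ => r.
  by apply: prim_ge0 => r.
(* For this length the lower bound exceeds the integral of [|f|] by 1. *)
have := H ((\int[lam]_x `|f x| + 1) / (`|l| / 2)).
rewrite mulrCA divff ?gt_eqF// mulr1 => /(_ _)/wrap[].
  by rewrite divr_ge0 ?(ltW l20)// addr_ge0// Rintegral_ge0.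
by rewrite gerDl ler10.
Qed.

(** Integration by parts as Fubini on the half-plane [r <= x]; this form applies to a [D] that is
    merely integrable. *)
Lemma prim_swap (D E : R -> R) : intg D -> intg E ->
  \int[lam]_x (E x * prim D x) =
  \int[lam]_r (D r * \int[lam]_x (E x * (r <= x)%R%:R)).
Proof.
move=> Di Ei.
pose f (p : measurableTypeR R * measurableTypeR R) : R :=
  (E p.1 * D p.2) * ((p.2 : R) <= p.1)%R%:R.
have fi : (lam \x lam)%E.-integrable setT (EFin \o f).
  apply: le_intg (integrable_norm (integrable_prodM Ei Di)).
    apply: measurable_funM.
      exact: integrable_measurable (integrable_prodM Ei Di).
    by apply: measurable_ler_ind; [exact: measurable_snd|exact: measurable_fst].
  move=> p; rewrite /f normrM ler_piMr//=.
  by case: (_ <= p.1); rewrite ?normr1 ?normr0.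
transitivity (\int[lam]_x \int[lam]_r f (x, r)).
  apply: eq_Rintegral => x _; rewrite primE -RintegralZ; last exact: integrable_prim.
  by apply: eq_Rintegral => r _; rewrite /f/cutl/=; ring.
rewrite -Rfubini1// Rfubini2//; apply: eq_Rintegral => r _.
rewrite -RintegralZ.
  by apply: eq_Rintegral => x _; rewrite /f/=; ring.
apply: le_intg (integrable_norm Ei) => [|x].
  apply: measurable_funM; first exact: integrable_measurable Ei.
  by apply: measurable_ler_ind; [exact: measurable_cst|exact: measurable_id].
by rewrite normrM ler_piMr//; case: (r <= x); rewrite ?normr1 ?normr0.
Qed.

End one_dimensional.

Section log_sobolev_line.
Local Opaque gauss.
Context (R : realType).
Local Notation lam := (@lebesgue_measure R).
Local Notation intg f := (lam.-integrable setT (EFin \o f)).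

Lemma Gauss_inj : injective (@Gauss R).
Proof.
move=> x y xy; have [xy'|xy'|//] := ltgtP x y.
  by move: xy'; rewrite -Gauss_lt xy ltxx.
by move: xy'; rewrite -Gauss_lt xy ltxx.
Qed.

(** Quantile function of the standard Gaussian; [get] returns an arbitrary value outside []0, 1[],
    so its properties are used for [0 < p < 1]. *)
Definition Gauss_inv (p : R) : R := get [set t | Gauss t = p].

Lemma Gauss_invK p : 0 < p < 1 -> Gauss (Gauss_inv p) = p.
Proof.
move=> p01; have [t tp] := continuous_surj (@continuous_Gauss R) (@Gauss_cvgNy R) (@Gauss_cvgy R) p01.
by have /= := getPex (ex_intro [set t | Gauss t = p] t tp).
Qed.

Lemma GaussK : cancel (@Gauss R) Gauss_inv.
Proof.
by move=> t; apply: Gauss_inj; rewrite Gauss_invK// Gauss_gt0 Gauss_lt1.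
Qed.

Lemma is_derive_Gauss_inv (p : R) : 0 < p < 1 ->
  is_derive p 1 Gauss_inv (gauss (Gauss_inv p))^-1.
Proof.
move=> p01; rewrite -[X in is_derive X](Gauss_invK p01).
apply: is_derive_inverse.
- by near=> t; exact: GaussK.
- by near=> t; exact: continuous_Gauss.
- exact: is_derive_Gauss.
- by rewrite gt_eqF// gauss_gt0.
Unshelve. all: by end_near. Qed.

Lemma ln_le_sub1 (y : R) : 0 < y -> ln y <= y - 1.
Proof.
by move=> y0; rewrite -[y in ln y](subrK 1) addrC le_ln1Dx// ltrBrDl subrr.
Qed.

Lemma intg_itv (h : R -> R) (a b : R) :
  (forall x : R, a <= x <= b -> {for x, continuous h}) -> intg (h \_ `[a, b]).
Proof.
move=> ch; have hi : lam.-integrable `[a, b] (EFin \o h).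
  apply: continuous_compact_integrable; first exact: segment_compact.
  by apply: continuous_in_subspaceT => x; rewrite inE/= in_itv/=; exact: ch.
rewrite (_ : EFin \o (h \_ `[a, b]) = (EFin \o h) \_ `[a, b]); last first.
  by rewrite restrict_EFin.
have := (integrable_mkcond (mu := lam) (EFin \o h) (measurable_itv `[a, b])).1 hi.
exact.
Qed.

(** [G] is the density, [D] its derivative, [K] plays the part of the squared derivative of
    [sqrt G], and [lam0] is the scale. The map [T = Gauss_inv (F / m)] transports [G dx / m] to the
    standard Gaussian. *)
Section transport.
Context (G D K : R -> R) (lam0 : R).
Hypotheses (Gi : intg G) (Di : intg D) (Ki : intg K).
Hypotheses (G0 : forall x, 0 <= G x) (K0 : forall x, 0 <= K x).
Hypothesis DGK : {ae lam, forall x : R, D x ^+ 2 <= 4 * G x * K x}.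
Hypothesis GD : forall x, G x = prim D x.
Hypothesis l0 : 0 < lam0.
Let m := \int[lam]_x G x.
Let kap := \int[lam]_x K x.
Hypothesis m0 : 0 < m.
Let F := prim G.
Let T x := Gauss_inv (F x / m).
Let f x := G x * ln (lam0 * G x / m).

Let cG : continuous G.
Proof. by rewrite (_ : G = prim D); [exact: continuous_prim|exact/funext]. Qed.

Let dF (x : R) : is_derive x 1 F (G x).
Proof. exact: is_derive_prim Gi (@cG x). Qed.

Let ID0 : \int[lam]_x D x = 0.
Proof.
apply: intg_cvgy_eq0 Gi _; rewrite (_ : G = prim D); last exact/funext.
exact: prim_cvgy.
Qed.

Let F_nd : {homo F : x y / x <= y}. Proof. exact: prim_ndecr Gi G0. Qed.

Let S := \int[lam]_x `|D x|.

Let GS x : G x <= S.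
Proof.
have nDi : intg (fun x => `|D x|) by exact: integrable_norm.
rewrite GD (@le_trans _ _ (prim (fun x => `|D x|) x))//; last first.
  by apply: prim_le nDi _ => r.
rewrite !primE; apply: le_Rintegral => //; [exact: integrable_prim..|].
by move=> r _; rewrite /cutl ler_wpM2l ?ler0n// ler_norm.
Qed.

(** From [|D t| <= 2 sqrt (G K) |t|] and AM-GM with a weight [th], kept free so that it can be
    optimised together with [b] at the end. *)
Let DT_le (th : R) (t : R -> R) : 0 < th ->
  {ae lam, forall x : R, `|D x * t x| <= th * K x + th^-1 * (G x * t x ^+ 2)}.
Proof.
move=> th0; apply: (ae_imp DGK) => x /= h.
have tK : 0 <= th * K x + th^-1 * (G x * t x ^+ 2).
  by rewrite addr_ge0// mulr_ge0 ?(ltW th0) ?invr_ge0 ?(ltW th0)// mulr_ge0// sqr_ge0.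
rewrite -(@ler_pXn2r _ 2)// ?nnegrE//.
rewrite real_normK ?num_real// exprMn.
apply: (@le_trans _ _ (4 * G x * K x * t x ^+ 2)).
  by rewrite ler_wpM2r// sqr_ge0.
rewrite -subr_ge0.
rewrite (_ : _ - _ = (th * K x - th^-1 * (G x * t x ^+ 2)) ^+ 2) ?sqr_ge0//.
by field; rewrite gt_eqF.
Qed.

Let S_le : lam0 * S <= m + lam0 ^+ 2 * kap.
Proof.
rewrite -(@ler_pM2l _ lam0^-1) ?invr_gt0// mulrA mulVf ?gt_eqF// mul1r.
have -> : lam0^-1 * (m + lam0 ^+ 2 * kap) = \int[lam]_x (lam0 * K x + lam0^-1 * G x).
  rewrite RintegralD//; [|exact: intgZ..].
  by rewrite !RintegralZ// /m /kap; field; rewrite gt_eqF.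
apply: ae_le_Rintegral; [exact: integrable_norm|by apply: intgD; exact: intgZ|].
apply: (ae_imp (DT_le (cst 1) l0)) => x /=.
by rewrite !mulr1 expr1n mulr1.
Qed.

(** [ln y <= y] combined with [G <= S], where [S] is the total variation of [G]. This crude bound
    provides an integrable majorant of the positive part and handles the region left out by the
    window below. *)
Let f_le x : f x <= G x * (lam0 * S / m).
Proof.
rewrite /f ler_wpM2l//; have [->|Gx] := eqVneq (G x) 0.
  by rewrite mulr0 mul0r ln0// divr_ge0 ?(ltW m0)// mulr_ge0 ?(ltW l0)// Rintegral_ge0.
have Gx0 : 0 < G x by rewrite lt_neqAle eq_sym Gx G0.
rewrite (@le_trans _ _ (lam0 * G x / m))//.
  by apply/ltW/ln_sublinear; rewrite divr_gt0// mulr_gt0.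
by rewrite ler_pM2r ?invr_gt0// ler_pM2l// GS.
Qed.

Lemma line_pos : forall x, Num.max (f x) 0 <= G x * (lam0 * S / m).
Proof.
move=> x; rewrite ge_max f_le mulr_ge0// divr_ge0 ?(ltW m0)// mulr_ge0 ?(ltW l0)//.
exact: Rintegral_ge0.
Qed.

(** [T] is meaningful only where [0 < F / m < 1], and is unbounded there. The estimate is made
    between the points where [T = - A] and [T = A], a region of [G]-mass [m * pA], with [f_le]
    outside; [A] tends to +oo afterwards. *)
Section window.
Context (A : R) (A0 : 0 < A).
Let pA : R := Gauss A - Gauss (- A).

Let Fsurj v : 0 < v < 1 -> exists c, F c = m * v.
Proof.
move=> /andP[v0 v1]; apply: (continuous_surj (continuous_prim Gi) (prim_cvgNy Gi) (prim_cvgy Gi)).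
by rewrite mulr_gt0//= gtr_pMr.
Qed.

Let Fx01 x a b : F a = m * Gauss (- A) -> F b = m * Gauss A -> a <= x <= b ->
  0 < F x / m < 1.
Proof.
move=> Fa Fb /andP[ax xb]; rewrite ltr_pdivlMr// ltr_pdivrMr// mul0r mul1r.
rewrite (lt_le_trans _ (F_nd ax)) ?Fa ?mulr_gt0 ?Gauss_gt0//=.
by rewrite (le_lt_trans (F_nd xb))// Fb gtr_pMr// Gauss_lt1.
Qed.

(** The terms come, in order, from [- T^2 / 2] and from the constant in [ln (gauss T)], from the
    bound on the integral of [G T'], from the rest of [ln y <= y - 1] at [y = b lam0 T'], and from
    [f_le] outside the window. *)
Lemma window_le (th b : R) : 0 < th -> 0 < b ->
  intg f ->
  \int[lam]_x f x <= - (m / 2) * (pA - 2 * A * gauss A) - ln (pi *+ 2) / 2 * (m * pA)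
   + b * lam0 * (th * kap + th^-1 * m) - (1 + ln b) * (m * pA)
   + (lam0 * S / m) * (m * (1 - pA)).
Proof.
move=> th0 b0 fi.
have [|al Fal] := @Fsurj (Gauss (- A)); first by rewrite Gauss_gt0 Gauss_lt1.
have [|be Fbe] := @Fsurj (Gauss A); first by rewrite Gauss_gt0 Gauss_lt1.
have ab : al <= be.
  rewrite leNgt; apply/negP => /ltW/F_nd; rewrite Fal Fbe ler_pM2l// leNgt Gauss_lt.
  by rewrite gtrN.
have F01 x : al <= x <= be -> 0 < F x / m < 1 by exact: Fx01.
have TE x : al <= x <= be -> Gauss (T x) = F x / m by move=> /F01; exact: Gauss_invK.
pose T' x := G x / (m * gauss (T x)).
have dT (x : R) : al <= x <= be -> is_derive x 1 T (T' x).
  move=> /F01 h; have H1 := is_derive_Gauss_inv h; have H2 := dF x.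
  have H3 : is_derive x 1 (fun x => F x / m) (G x / m).
    by apply: is_derive_eq; rewrite /GRing.scale/= mulr0 add0r mulrC.
  have [d1 d2] := @is_derive1_comp _ Gauss_inv (fun x => F x / m) x _ _ H1 H3.
  by split => //; rewrite [LHS]d2 /T' /T /GRing.scale/= [in RHS]invfM mulrC mulrA.
have cT (x : R) : al <= x <= be -> {for x, continuous T}.
  by move=> /dT; exact: is_derive_continuous.
have cT' (x : R) : al <= x <= be -> {for x, continuous T'}.
  move=> h; apply: (@cvgM R); first exact: cG.
  apply: (@cvgV R); first by rewrite mulf_neq0// gt_eqF// gauss_gt0.
  apply: (@cvgM R); first exact: cvg_cst.
  by apply: (@continuous_comp _ _ _ T (@gauss R)); [exact: cT|exact: continuous_gauss].
have Tal : T al = - A by rewrite /T Fal mulrAC divff ?gt_eqF// mul1r GaussK.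
have Tbe : T be = A by rewrite /T Fbe mulrAC divff ?gt_eqF// mul1r GaussK.
have TA x : al <= x <= be -> - A <= T x <= A.
  move=> /[dup] h /andP[ax xb]; apply/andP; split; rewrite leNgt -Gauss_lt TE// -leNgt.
    by rewrite ler_pdivlMr// mulrC -Fal F_nd.
  by rewrite ler_pdivrMr// mulrC -Fbe F_nd.
pose I : set R := `[al, be]%classic.
have Ii (h : R -> R) : (forall x, al <= x <= be -> {for x, continuous h}) ->
    intg (h \_ I).
  exact: intg_itv.
have IE (h : R -> R) x : (h \_ I) x = if al <= x <= be then h x else 0.
  by rewrite patchE mem_setE in_itv.
(* Clamping [r] to the window makes [Tc] the truncation of [T] to [[-A, A]], continuous and bounded
   on the whole line. *)
pose cl r := Num.max al (Num.min r be).
have clI r : al <= cl r <= be by rewrite le_max lexx/= ge_max ab ge_min lexx orbT.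
pose Tc r := T (cl r).
have cTc : continuous Tc.
  move=> r; apply: (@continuous_comp _ _ _ cl T); last exact: cT.
  apply: continuous_max; first exact: cvg_cst.
  by apply: continuous_min; [exact: cvg_id|exact: cvg_cst].
have mTc : measurable_fun setT Tc by exact: continuous_measurable_fun.
have TcA r : `|Tc r| <= A by rewrite ler_norml TA.
have Ei : intg (T' \_ I) by exact: Ii.
(* This is the tail integral that [prim_swap] produces; its constant part [A] will be killed by
   [ID0]. *)
have tailE (r : R) : \int[lam]_x ((T' \_ I) x * (r <= x)%R%:R) = A - Tc r.
  have [rb|br] := leP r be.
    have clr : cl r = Num.max al r by rewrite /cl min_l.
    have /andP[acl clb] := clI r.
    have sub x : cl r <= x <= be -> al <= x <= be.
      by move=> /andP[cx ->]; rewrite andbT (le_trans _ cx).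
    have := @FTC2_closed _ T' T _ _ clb (fun x h => dT x (sub x h)) (fun x h => cT' x (sub x h)).
    rewrite Tbe => <-; rewrite [RHS]Rintegral_mkcond; congr fine.
    apply: eq_integral => x _ /=.
    rewrite IE patchE mem_setE in_itv/= clr ge_max; congr EFin.
    by case: (al <= x); case: (r <= x); case: (x <= be) => //=; rewrite ?mulr1 ?mulr0.
  have clr : cl r = be by rewrite /cl min_r ?max_r// ltW.
  rewrite /Tc clr Tbe subrr.
  transitivity (\int[lam]_(x in [set: R]) (0 : R)); last by rewrite /Rintegral integral0.
  apply: eq_Rintegral => x _; rewrite IE.
  have [/andP[_ xb]|] := boolP (al <= x <= be); last by rewrite mul0r.
  by rewrite leNgt (le_lt_trans xb br) mulr0.
have DTi : intg (fun x => D x * Tc x).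
  apply: (@le_intg _ _ _ lam _ (fun x => A * `|D x|)).
  - by apply: measurable_funM => //; exact: integrable_measurable Di.
  - by move=> x; rewrite normrM mulrC ler_wpM2r.
  - by apply: intgZ; exact: integrable_norm.
have mG : measurable_fun setT G by exact: integrable_measurable Gi.
have GTi : intg (fun x => G x * Tc x ^+ 2).
  apply: (@le_intg _ _ _ lam _ (fun x => A ^+ 2 * G x)); last exact: intgZ.
  - by apply: measurable_funM => //; exact: measurable_funX.
  - move=> x; rewrite normrM (ger0_norm (G0 x)) mulrC ler_wpM2r//.
    by rewrite normrX lerXn2r// nnegrE (le_trans _ (TcA x)).
have IG : \int[lam]_x (G \_ I) x = m * pA.
  rewrite -Rintegral_mkcond -prim_itv// -[prim G be]/(F be) -[prim G al]/(F al).
  by rewrite Fal Fbe mulrBr.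
(* Change of variables [t = T x], an antiderivative of [t^2 gauss t] being [Gauss t - t gauss t]. *)
have IGT2 : \int[lam]_x ((fun x => G x * T x ^+ 2) \_ I) x = m * (pA - 2 * A * gauss A).
  rewrite -Rintegral_mkcond.
  have dM (x : R) : al <= x <= be ->
      is_derive x 1 (fun x => m * (Gauss (T x) - T x * gauss (T x))) (G x * T x ^+ 2).
    move=> xI; have h1 := dT x xI; have h2 := is_derive_Gauss (T x).
    have h3 := is_derive_gauss (T x).
    have h4 := @is_derive1_comp _ (@Gauss R) T x _ _ h2 h1.
    have h5 := @is_derive1_comp _ (@gauss R) T x _ _ h3 h1.
    have [d1 d2] := is_deriveZ m (is_deriveB h4 (is_deriveM h1 h5)).
    split => //; rewrite [LHS]d2 /GRing.scale/= /T'.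
    have g0 := gauss_gt0 (T x).
    by field; rewrite !gt_eqF.
  have cM (x : R) : al <= x <= be -> {for x, continuous (fun x => G x * T x ^+ 2)}.
    move=> xI; apply: (@cvgM R); first exact: cG.
    by apply: (@continuous_comp _ _ _ T (fun t => t ^+ 2)); [exact: cT|exact: exprn_continuous].
  rewrite [LHS](FTC2_closed ab dM cM) Tal Tbe gaussN /pA; ring.
(* Truncating a Gaussian variable at [A] does not raise its second moment above 1: the contribution
   [A^2 (1 - pA)] of the two ends is absorbed by the Mills bounds. *)
have IGTc : \int[lam]_x (G x * Tc x ^+ 2) <= m.
  have -> : \int[lam]_x (G x * Tc x ^+ 2) =
      \int[lam]_x (A ^+ 2 * (G x - (G \_ I) x) + ((fun x => G x * T x ^+ 2) \_ I) x).
    apply: eq_Rintegral => x _; rewrite !IE; case: ifPn => xI.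
      rewrite subrr mulr0 add0r /Tc /cl; congr (_ * T _ ^+ 2).
      by move/andP : xI => [? ?]; rewrite min_l// max_r.
    rewrite subr0 addr0 mulrC; congr (_ * _).
    move: xI; rewrite negb_and -!ltNge => /orP[xa|bx].
      rewrite /Tc /cl min_l ?max_l ?Tal ?sqrrN// ?ltW//.
      by rewrite (lt_le_trans xa).
    by rewrite /Tc /cl min_r ?max_r ?Tbe// ltW.
  have i1 : intg (G \_ I) by apply: Ii => x _; exact: cG.
  have i2 : intg ((fun x => G x * T x ^+ 2) \_ I).
    apply: Ii => x xI; apply: (@cvgM R); first exact: cG.
    by apply: (@continuous_comp _ _ _ T (fun t => t ^+ 2)); [exact: cT|exact: exprn_continuous].
  rewrite RintegralD//; last by apply: intgZ; exact: intgB.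
  rewrite RintegralZ; last exact: intgB.
  rewrite RintegralB// IG IGT2 -/m.
  have := Gauss_millsr A0; have := Gauss_millsl A0; have := Gauss_gt0 (- A).
  have := Gauss_lt1 A; rewrite /pA; move: (Gauss A) (Gauss (- A)) (gauss A) => p q g p1 q0 h1 h2.
  have h3 : A * (A * q + A * (1 - p)) <= A * (g + g) by rewrite ler_pM2l// lerD.
  rewrite -subr_ge0 (_ : _ - _ = m * (1 - (p - q) + A * (g + g) - A * (A * q + A * (1 - p)))); last by ring.
  apply: mulr_ge0; first exact: ltW.
  by rewrite -addrA addr_ge0// ?subr_ge0//; lra.
have GT'i : intg ((fun x => G x * T' x) \_ I).
  by apply: Ii => x xI; apply: (@cvgM R); [exact: cG|exact: cT'].
(* Integration by parts: the integral of [G T'] over the window is minus that of [D Tc], to which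
   [DT_le] applies. *)
have IGT' : \int[lam]_x ((fun x => G x * T' x) \_ I) x <= th * kap + th^-1 * m.
  have -> : \int[lam]_x ((fun x => G x * T' x) \_ I) x = - \int[lam]_x (D x * Tc x).
    transitivity (\int[lam]_x ((T' \_ I) x * prim D x)).
      apply: eq_Rintegral => x _; rewrite !IE; case: ifP => _; last by rewrite mul0r.
      by rewrite -GD mulrC.
    rewrite prim_swap//.
    transitivity (\int[lam]_x (A * D x - D x * Tc x)).
      by apply: eq_Rintegral => x _; rewrite tailE mulrBr mulrC.
    by rewrite RintegralB// ?RintegralZ ?ID0 ?mulr0 ?sub0r//; exact: intgZ.
  rewrite -mulN1r -RintegralZ//.
  apply: (@le_trans _ _ (\int[lam]_x (th * K x + th^-1 * (G x * Tc x ^+ 2)))).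
    apply: ae_le_Rintegral.
    - exact: intgZ.
    - by apply: intgD; exact: intgZ.
    - by apply: (ae_imp (DT_le Tc th0)) => x; apply: le_trans; rewrite mulN1r -normrN ler_norm.
  rewrite RintegralD//; [|exact: intgZ..].
  by rewrite !RintegralZ// lerD2l ler_pM2l ?invr_gt0.
pose c := lam0 * S / m.
pose h x := - 2^-1 * ((fun x => G x * T x ^+ 2) \_ I) x
  - (ln (pi *+ 2) / 2 + (1 + ln b)) * (G \_ I) x
  + b * lam0 * ((fun x => G x * T' x) \_ I) x + c * (G x - (G \_ I) x).
have fh x : f x <= h x.
  rewrite /h !IE; case: ifPn => xI; last first.
    rewrite !mulr0 subr0 !add0r subr0 mulrC; exact: f_le.
  rewrite subrr mulr0 addr0 /f.
  have [Gx|Gx] := eqVneq (G x) 0.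
    by rewrite /T' Gx !(mul0r, mulr0) subr0 addr0.
  have Gx0 : 0 < G x by rewrite lt_neqAle eq_sym Gx G0.
  have gT := gauss_gt0 (T x).
  have T'0 : 0 < T' x by rewrite divr_gt0// mulr_gt0.
  (* The transport equation [G / m = gauss T * T'], with [b] inserted as the free parameter in
     [ln y <= y - 1]. *)
  have -> : lam0 * G x / m = gauss (T x) * ((b * (lam0 * T' x)) / b).
    by rewrite /T'; field; rewrite !gt_eqF.
  have blT : 0 < b * (lam0 * T' x) by rewrite mulr_gt0// mulr_gt0.
  rewrite lnM ?posrE ?divr_gt0// ln_div ?posrE// ln_gauss.
  have := ln_le_sub1 blT; rewrite -subr_ge0 => lnb.
  have pos : 0 <= G x * (b * (lam0 * T' x) - 1 - ln (b * (lam0 * T' x))) by exact: mulr_ge0.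
  rewrite -subr_ge0; apply: le_trans pos _; rewrite le_eqVlt; apply/orP; left.
  by apply/eqP; field.
have i1 : intg (G \_ I) by apply: Ii => x _; exact: cG.
have i2 : intg ((fun x => G x * T x ^+ 2) \_ I).
  apply: Ii => x xI; apply: (@cvgM R); first exact: cG.
  by apply: (@continuous_comp _ _ _ T (fun t => t ^+ 2)); [exact: cT|exact: exprn_continuous].
apply: (@le_trans _ _ (\int[lam]_x h x)).
  apply: le_Rintegral => //.
  by rewrite /h; apply: intgD; [apply: intgD; [apply: intgB|]|]; apply: intgZ => //; exact: intgB.
rewrite /h RintegralD//; last 2 first.
- by apply: intgD; [apply: intgB|]; apply: intgZ.
- by apply: intgZ; exact: intgB.
rewrite RintegralD//; last 2 first.
- by apply: intgB; apply: intgZ.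
- exact: intgZ.
rewrite RintegralB//; [|exact: intgZ..].
rewrite !RintegralZ//; last exact: intgB.
rewrite RintegralB// IG IGT2 -/m.
have pos : 0 <= b * lam0 * (th * kap + th^-1 * m -
   \int[lam]_x ((fun x => G x * T' x) \_ I) x).
  by rewrite mulr_ge0 ?subr_ge0// mulr_ge0// ltW.
rewrite -subr_ge0; apply: le_trans pos _; rewrite le_eqVlt; apply/orP; left.
by apply/eqP; rewrite /c; field; rewrite !gt_eqF.
Qed.

End window.

(** Limit [A -> +oo]: there [pA -> 1] and [A gauss A -> 0], and the error from outside the window
    carries the factor [1 - pA]. *)
Lemma line_le (th b : R) : 0 < th -> 0 < b -> intg f ->
  \int[lam]_x f x <= - (m / 2) - ln (pi *+ 2) / 2 * m
   + b * lam0 * (th * kap + th^-1 * m) - (1 + ln b) * m.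
Proof.
move=> th0 b0 fi.
pose B (A : R) := - (m / 2) * ((Gauss A - Gauss (- A)) - 2 * (A * gauss A))
   - ln (pi *+ 2) / 2 * (m * (Gauss A - Gauss (- A)))
   + b * lam0 * (th * kap + th^-1 * m) - (1 + ln b) * (m * (Gauss A - Gauss (- A)))
   + (lam0 * S / m) * (m * (1 - (Gauss A - Gauss (- A)))).
have cp : Gauss A - Gauss (- A) @[A --> +oo] --> (1 : R).
  rewrite -[X in _ --> X]subr0; apply: (@cvgB _ R^o); first exact: Gauss_cvgy.
  by have := @Gauss_cvgNy R; move/cvgNy_compNP; exact.
have cst_ (k : R) : (fun=> k) A @[A --> +oo] --> k by exact: cvg_cst.
have cB : B A @[A --> +oo] --> - (m / 2) - ln (pi *+ 2) / 2 * m
   + b * lam0 * (th * kap + th^-1 * m) - (1 + ln b) * m.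
  rewrite [X in _ --> X](_ : _ = - (m / 2) * (1 - 2 * 0)
   - ln (pi *+ 2) / 2 * (m * 1)
   + b * lam0 * (th * kap + th^-1 * m) - (1 + ln b) * (m * 1)
   + (lam0 * S / m) * (m * (1 - 1))); last first.
    by rewrite subrr !(mulr0, mulr1, subr0, addr0).
  have c1 : - (m / 2) * ((Gauss A - Gauss (- A)) - 2 * (A * gauss A)) @[A --> +oo]
      --> - (m / 2) * (1 - 2 * 0).
    apply: (@cvgM R) => //; apply: (@cvgB _ R^o) => //.
    by apply: (@cvgM R) => //; exact: mul_gauss_cvgy.
  have c2 (k : R) : k * (m * (Gauss A - Gauss (- A))) @[A --> +oo] --> k * (m * 1).
    by apply: (@cvgM R) => //; apply: (@cvgM R).
  have c3 (k : R) : k * (m * (1 - (Gauss A - Gauss (- A)))) @[A --> +oo] --> k * (m * (1 - 1)).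
    by apply: (@cvgM R) => //; apply: (@cvgM R) => //; apply: (@cvgB _ R^o).
  by apply: (@cvgD _ R^o) => //; apply: (@cvgB _ R^o) => //;
    apply: (@cvgD _ R^o) => //; apply: (@cvgB _ R^o).
apply: (cvgr_to_ge cB); near=> A.
have A0 : 0 < A by near: A; exact: nbhs_pinfty_gt.
by rewrite /B [2 * (A * _)]mulrA; exact: window_le.
Unshelve. all: by end_near. Qed.

Let fm : measurable_fun setT f.
Proof.
have mG : measurable_fun setT G by exact: integrable_measurable Gi.
apply: measurable_funM => //; apply: measurableT_comp => //.
by apply: measurable_funM => //; exact: measurable_funM.
Qed.

Lemma line_pos_integral :
  intg (fun x => Num.max (f x) 0) /\
  \int[lam]_x Num.max (f x) 0 <= m + lam0 ^+ 2 * kap.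
Proof.
have hi : intg (fun x => (lam0 * S / m) * G x) by exact: intgZ.
have fi : intg (fun x => Num.max (f x) 0).
  apply: le_intg hi; first by apply: measurable_maxr => //; exact: measurable_cst.
  by move=> x; rewrite ger0_norm ?le_max ?lexx ?orbT// mulrC; exact: line_pos.
split => //; rewrite (le_trans _ S_le)//.
apply: (@le_trans _ _ (\int[lam]_x ((lam0 * S / m) * G x))).
  by apply: le_Rintegral => // x _; rewrite mulrC; exact: line_pos.
by rewrite RintegralZ// -/m divfK// gt_eqF.
Qed.

End transport.

Lemma continuous_ae_ge0 (g : R -> R) : continuous g ->
  {ae lam, forall x : R, 0 <= g x} -> forall x, 0 <= g x.
Proof.
move=> cg [A [mA A0 PA]] x; rewrite leNgt; apply/negP => gx.
have /nbhs_ballP[e /= e0 He] : \forall y \near x, g y < 0.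
  by have := cg x; move/cvgr_lt; exact.
have sub : `]x - e, x + e[ `<=` A.
  move=> y; rewrite /= in_itv/= => xy; apply: PA => /=; apply/negP; rewrite -ltNge.
  by apply: He; rewrite /ball/= distrC ltr_distl.
have : (lam [set` `]x - e, x + e[%R] <= lam A)%E.
  by apply: le_measure => //; rewrite inE//; exact: measurable_itv.
rewrite A0 lebesgue_measure_itv/= lte_fin ltrD2l gtrN// -EFinD lee_fin.
by clear -e0 => h; lra.
Qed.

(* G is transported to the Gaussian density gamma by T with gamma(T) T' = G / m.
   In ln(l G / m) = ln gamma(T) + ln(l T') the last term is at most
   b l T' - 1 - ln b; integrating G T' by parts leaves the integral of T D, which
   AM-GM bounds because D^2 <= 4 G K. *)
Lemma log_sobolev_line (G D K : R -> R) (l a : R) :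
  intg G -> intg D -> intg K ->
  (forall x, 0 <= G x) -> (forall x, 0 <= K x) ->
  {ae lam, forall x : R, D x ^+ 2 <= 4 * G x * K x} ->
  {ae lam, forall x : R, G x = prim D x} -> 0 < l -> 0 < a ->
  let m := \int[lam]_x G x in let kap := \int[lam]_x K x in
  let f := fun x => G x * ln (l * G x / m) in
  [/\ intg (fun x => Num.max (f x) 0),
      \int[lam]_x Num.max (f x) 0 <= m + l ^+ 2 * kap &
      intg f -> \int[lam]_x f x <= a * l ^+ 2 * kap - m * (1 + ln (pi * a) / 2)].
Proof.
move=> Gi Di Ki G0 K0 DGK GD l0 a0 m kap f.
have kap0 : 0 <= kap by exact: Rintegral_ge0.
have m0 : 0 <= m by exact: Rintegral_ge0.
(* When [m = 0] the quotient is 0 by the convention [0^-1 = 0], and [ln 0 = 0], so [f] vanishes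
   identically. *)
have [mE|mN] := eqVneq m 0.
  have f0 : f = cst 0.
    by apply/funext => x; rewrite /f mE invr0 mulr0 ln0// mulr0.
  have mf0 : (fun x => Num.max (f x) 0) = cst 0.
    by apply/funext => x; rewrite f0 maxxx.
  rewrite mf0 f0 mE mul0r subr0 add0r /Rintegral integral0/=.
  split => [||_]; first exact: integrable0.
  - by rewrite mulr_ge0// sqr_ge0.
  - by rewrite !mulr_ge0// ?ltW// sqr_ge0.
have {m0 mN}m0 : 0 < m by rewrite lt_neqAle eq_sym mN.
have mG := integrable_measurable Gi.
(* The continuous representative of [G], for which the identity with [prim D] holds at every point,
   as the transport argument assumes. *)
pose g := prim D.
have cg : continuous g by exact: continuous_prim.
have mg : measurable_fun setT g by exact: continuous_measurable_fun.
have g0 : forall x, 0 <= g x.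
  by apply: continuous_ae_ge0 => //; apply: (ae_imp GD) => x; rewrite /g => <-.
have gi : intg g by apply: ae_eq_intg GD Gi.
have mE : m = \int[lam]_x g x by exact: ae_eq_Rintegral.
have DgK : {ae lam, forall x : R, D x ^+ 2 <= 4 * g x * K x}.
  by apply: (ae_imp2 GD DGK) => x; rewrite /g => <-.
pose h x := g x * ln (l * g x / \int[lam]_x g x).
have mln (k : R -> R) : measurable_fun setT k ->
    measurable_fun setT (fun x => k x * ln (l * k x / m)).
  move=> mk; apply: measurable_funM => //; apply: measurableT_comp => //.
  by apply: measurable_funM => //; exact: measurable_funM.
have mf : measurable_fun setT f by exact: mln.
have mh : measurable_fun setT h by rewrite /h -mE; exact: mln.
have hf : {ae lam, forall x : R, h x = f x}.
  by apply: (ae_imp GD) => x; rewrite /h /f -mE /g => <-.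
have hf' : {ae lam, forall x : R, Num.max (h x) 0 = Num.max (f x) 0}.
  by apply: (ae_imp hf) => x ->.
have mm (k : R -> R) : measurable_fun setT k ->
    measurable_fun setT (fun x => Num.max (k x) 0).
  by move=> mk; apply: measurable_maxr => //; exact: measurable_cst.
have m0' : 0 < \int[lam]_x g x by rewrite -mE.
have [P1 P2] := line_pos_integral gi Di Ki g0 K0 DgK (fun=> erefl) l0 m0'.
split.
- by apply: ae_eq_intg hf' P1; exact: mm.
- by rewrite -(ae_eq_Rintegral _ _ hf') ?mE//; exact: mm.
move=> fi; have -> : \int[lam]_x f x = \int[lam]_x h x.
  by apply/esym; apply: ae_eq_Rintegral.
have hi : intg h.
  by apply: ae_eq_intg fi => //; apply: (ae_imp hf) => x ->.
(* With [th = a l / b] the term in [th] becomes [a l^2 kap + (b^2 / a) m]; the choice [b^2 = a / 2]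
   makes the second summand [m / 2], which cancels [- m / 2], and [ln b] turns [ln (2 pi)] into
   [ln (pi a)]. *)
pose b := Num.sqrt (a / 2).
have b0 : 0 < b by rewrite sqrtr_gt0 divr_gt0.
have b2 : b ^+ 2 = a / 2 by rewrite sqr_sqrtr// ltW// divr_gt0.
have th0 : 0 < a * l / b by rewrite divr_gt0// mulr_gt0.
apply: (le_trans (line_le gi Di Ki g0 K0 DgK (fun=> erefl) l0 m0' th0 b0 hi)).
rewrite -mE -/kap.
have lnb : ln b = ln (pi * a) / 2 - ln (pi *+ 2) / 2.
  have p0 := @pi_gt0 R.
  have : ln (b ^+ 2) = ln (pi * a) - ln (pi *+ 2).
    rewrite b2 (_ : a / 2 = pi * a / (pi *+ 2)); last first.
      by rewrite -[pi *+ 2]mulr_natr invfM mulrACA divff ?mul1r// gt_eqF.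
    by rewrite ln_div// posrE ?mulr_gt0// mulrn_wgt0.
  by rewrite lnXn// => h1; rewrite -mulrBl -h1 -[ln b *+ 2]mulr_natr mulfK.
rewrite lnb le_eqVlt; apply/orP; left; apply/eqP.
have -> : a = b ^+ 2 * 2 by rewrite b2 divfK.
by field; rewrite !gt_eqF.
Qed.

End log_sobolev_line.

(** [1 / y = y * (y^2)^(-1)] reduces inversion to a power of a nonnegative number; at [y = 0] both
    sides are 0. *)
Lemma measurable_invr d (T : measurableType d) (R : realType) (f : T -> R) :
  measurable_fun setT f -> measurable_fun setT (fun x => (f x)^-1).
Proof.
move=> mf; rewrite (_ : (fun _ => _) = fun x => f x * (f x ^+ 2) `^ (-1)).
  apply: measurable_funM => //; apply: (measurableT_comp (measurable_powR _)).
  exact: measurable_funX.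
apply/funext => x; rewrite powR_inv1 ?sqr_ge0//.
have [->|f0] := eqVneq (f x) 0; first by rewrite invr0 mul0r.
by rewrite expr2 invfM mulrA divff// mul1r.
Qed.

(** * Tensorisation *)

Section ae_extra.
Context d (T : measurableType d) (R : realType) (m : {measure set T -> \bar R}).
Local Notation intg f := (m.-integrable setT (EFin \o f)).

Lemma ae_le_intg (f g : T -> R) : measurable_fun setT f ->
  {ae m, forall x, `|f x| <= g x} -> intg g -> intg f.
Proof.
move=> mf fg gi; have mg := integrable_measurable gi.
pose h x := Num.min (`|f x|) `|g x|.
have hi : intg h.
  apply: le_intg (integrable_norm gi) => [|x].
    by apply: measurable_minr; exact: measurableT_comp.
  by rewrite /h ger0_norm ?le_min ?normr_ge0// ge_min lexx orbT.
have nfi : intg (Num.norm \o f).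
  apply: (@ae_eq_intg _ _ _ m h); [exact: measurableT_comp| |exact: hi].
  apply: (ae_imp fg) => x fgx; rewrite /h min_l//.
  by rewrite (le_trans fgx)// ler_norm.
by apply: le_intg nfi.
Qed.

Lemma ae_ge0_intg_le (f g : T -> R) : measurable_fun setT f ->
  {ae m, forall x, 0 <= f x} ->
  {ae m, forall x, f x <= g x} -> intg g -> intg f /\ \int[m]_x f x <= \int[m]_x g x.
Proof.
move=> mf f0 fg gi; have fi : intg f.
  by apply: ae_le_intg gi => //; apply: (ae_imp2 f0 fg) => x h; rewrite ger0_norm.
by split => //; exact: ae_le_Rintegral.
Qed.

End ae_extra.

(** Recovers the quadratic inequality from its AM-GM family by the choice [th = 2 g / |d|]. The
    family is linear in [g] and [k], so it can be integrated before being optimised. *)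
Lemma sqr_le_of_AMGM (R : realType) (d g k : R) : 0 <= g -> 0 <= k ->
  (forall th : R, 0 < th -> `|d| <= th * k + th^-1 * g) -> d ^+ 2 <= 4 * g * k.
Proof.
move=> g0 k0 H; rewrite -real_normK ?num_real//; move: (normr_ge0 d) H.
move: `|d| => e e0 H; have [->|eN] := eqVneq e 0.
  by rewrite expr0n/= !mulr_ge0.
have {eN e0}e0 : 0 < e by rewrite lt_neqAle eq_sym eN.
have [gE|gN] := eqVneq g 0.
  have k1 : 0 < k + 1 by rewrite ltr_wpDl.
  (* For [g = 0] this small [th] gives [|d| <= |d| k / (2 (k + 1)) < |d|], which is absurd. *)
  have th0 : 0 < e / (2 * (k + 1)) by rewrite divr_gt0// mulr_gt0.
  have := H _ th0; rewrite gE mulr0 addr0 mulrAC ler_pdivlMr ?mulr_gt0// ler_pM2l//.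
  by move=> h; exfalso; lra.
have {gN g0}g0 : 0 < g by rewrite lt_neqAle eq_sym gN.
have th0 : 0 < 2 * g / e by rewrite divr_gt0// mulr_gt0.
have := H _ th0; rewrite -(ler_pM2r e0) => h.
have E : (2 * g / e * k + (2 * g / e)^-1 * g) * e = 2 * g * k + e ^+ 2 / 2.
  by field; rewrite !gt_eqF.
rewrite E in h; rewrite expr2; rewrite expr2 in h; lra.
Qed.

(** An inequality [x <= y + z] bounds [z] from below, hence its negative part; integrability of the
    positive part of [z], of [x] and of [y] then gives that of [z]. *)
Lemma norm_le_max_sub (R : realType) (x y z : R) : x <= y + z ->
  `|z| <= Num.max z 0 *+ 2 + (y - x).
Proof.
by move=> h; rewrite ler_norml; case: (leP z 0) => h0; apply/andP; split;
  rewrite ?mul0rn; lra.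
Qed.

Section disintegration.
Context (R : realType) d (Y : measurableType d).
Context (mu : {sigma_finite_measure set Y -> \bar R}).
Local Notation lam := (@lebesgue_measure R).
Local Notation X := (measurableTypeR R).
Local Notation P := (lam \x mu)%E.
Local Notation intgP f := (P.-integrable setT (EFin \o f)).
Local Notation intgY f := (mu.-integrable setT (EFin \o f)).
Local Notation intg f := (lam.-integrable setT (EFin \o f)).

Lemma ae_slice_intg (f : X * Y -> R) : intgP f ->
  {ae lam, forall t, intgY (fun v => f (t, v))}.
Proof. by move=> fi; exact: (ae_integrable1 fi). Qed.

(** Integrating out [v] preserves the hypotheses of [log_sobolev_line]: Fubini commutes with [prim],
    and Cauchy-Schwarz, in its AM-GM form, carries the quadratic bound over to the integrals. *)
Lemma log_sobolev_marginal (W D K : X * Y -> R) (l a : R) :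
  intgP W -> intgP D -> intgP K -> (forall p, 0 <= W p) -> (forall p, 0 <= K p) ->
  (forall p, D p ^+ 2 <= 4 * W p * K p) ->
  {ae P, forall p, W p = prim (fun r => D (r, p.2)) p.1} ->
  0 < l -> 0 < a ->
  let g := fun t => \int[mu]_v W (t, v) in
  let m := \int[P]_p W p in let kap := \int[P]_p K p in
  let f := fun t => g t * ln (l * g t / m) in
  [/\ intg (fun x => Num.max (f x) 0),
      \int[lam]_x Num.max (f x) 0 <= m + l ^+ 2 * kap &
      intg f -> \int[lam]_x f x <= a * l ^+ 2 * kap - m * (1 + ln (pi * a) / 2)].
Proof.
move=> Wi Di Ki W0 K0 DWK WD l0 a0 g m kap f.
pose dD (t : R) := \int[mu]_v D (t, v); pose k (t : R) := \int[mu]_v K (t, v).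
have gi : intg g by exact: integrable_Rintegral1.
have di : intg dD by exact: integrable_Rintegral1.
have ki : intg k by exact: integrable_Rintegral1.
have -> : kap = \int[lam]_t k t by exact: Rfubini1.
have mE : m = \int[lam]_t g t by exact: Rfubini1.
rewrite /f mE.
apply: (log_sobolev_line gi di ki _ _ _ _ l0 a0).
- by move=> t; exact: Rintegral_ge0.
- by move=> t; exact: Rintegral_ge0.
- apply: (ae_imp2 (ae_slice_intg Di) (ae_imp2 (ae_slice_intg Wi) (ae_slice_intg Ki) (fun _ => pair))).
  move=> t hD [hW hK]; apply: sqr_le_of_AMGM; [exact: Rintegral_ge0..|].
  move=> th th0; apply: (le_trans (le_normr_Rintegral measurableT hD)).
  rewrite -!RintegralZ// -RintegralD//; [|exact: intgZ..].
  apply: le_Rintegral => //; first exact: integrable_norm.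
    by apply: intgD; exact: intgZ.
  move=> v _; have DK := DWK (t, v).
  have tK : 0 <= th * K (t, v) + th^-1 * W (t, v).
    by rewrite addr_ge0// mulr_ge0// ltW// invr_gt0.
  rewrite -(@ler_pXn2r _ 2)// ?nnegrE//.
  rewrite real_normK ?num_real//; apply: (le_trans DK).
  have pos := sqr_ge0 (th * K (t, v) - th^-1 * W (t, v)).
  rewrite -subr_ge0; apply: le_trans pos _; rewrite le_eqVlt; apply/orP; left.
  by apply/eqP; field; rewrite gt_eqF.
- have [WD1 _] := ae_prod WD.
  have mD := integrable_measurable Di.
  apply: (ae_imp2 WD1 (ae_slice_intg Wi)) => t Wt hW.
  pose h (q : X * Y) : R := ((q.1 : R) <= t)%R%:R * D q.
  have mh : measurable_fun setT h.
    apply: measurable_funM => //.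
    by apply: measurable_ler_ind; [exact: measurable_fst|exact: measurable_cst].
  have hi : intgP h.
    apply: le_intg mh _ (integrable_norm Di) => q.
    by rewrite /h normrM ler_piMl//; case: (_ <= t); rewrite ?normr1 ?normr0.
  rewrite /g (@ae_eq_Rintegral _ _ _ mu _ (fun v => \int[lam]_r h (r, v))).
  + rewrite -(@Rfubini2 _ _ _ _ _ lam mu h hi) (@Rfubini1 _ _ _ _ _ lam mu h hi) primE; apply: ae_eq_Rintegral.
    * exact: measurable_Rintegral1.
    * exact: (integrable_measurable (integrable_prim t di)).
    apply: (ae_imp (ae_slice_intg Di)) => r hr.
    by rewrite /h/= RintegralZ.
  + exact: integrable_measurable hW.
  + exact: measurable_Rintegral2.
  + by apply: (ae_imp Wt) => v ->; rewrite primE.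
Qed.

(* The entropy of W splits into those of its slices W(t, .) / g(t) and that of its
   marginal g; the factor La of the slices may depend on t. *)
Lemma chain_step (W : X * Y -> R) (La Bp B : R -> R) (l Cp C : R) :
  intgP W -> (forall p, 0 <= W p) -> measurable_fun setT La ->
  (forall t, 0 < La t) -> 0 < l ->
  let g := fun t => \int[mu]_v W (t, v) in
  let m := \int[P]_p W p in
  let f := fun t v => W (t, v) * ln (La t * W (t, v) / g t) in
  let f0 := fun t => g t * ln (l * g t / m) in
  {ae lam, forall t : R, [/\ intgY (fun v => Num.max (f t v) 0),
     \int[mu]_v Num.max (f t v) 0 <= Bp t &
     intgY (f t) -> \int[mu]_v f t v <= B t]} ->
  intg Bp -> intg B ->
  [/\ intg (fun t => Num.max (f0 t) 0), \int[lam]_t Num.max (f0 t) 0 <= Cp &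
      intg f0 -> \int[lam]_t f0 t <= C] ->
  let F := fun p => W p * ln (l * La p.1 * W p / m) in
  [/\ intgP (fun p => Num.max (F p) 0),
      \int[P]_p Num.max (F p) 0 <= \int[lam]_t Bp t + Cp &
      intgP F -> \int[P]_p F p <= \int[lam]_t B t + C].
Proof.
move=> Wi W0 mLa La0 l0 g m f f0 slices Bpi Bi [f0i f0le f0C] F.
have mW := integrable_measurable Wi.
have mg : measurable_fun setT g by exact: measurable_Rintegral1.
have g0 t : 0 <= g t by exact: Rintegral_ge0.
have gi : intg g by exact: integrable_Rintegral1.
have mfst (h : R -> R) : measurable_fun setT h ->
    measurable_fun setT (fun p : X * Y => h p.1).
  by move=> mh; exact: (measurableT_comp mh).
have mF : measurable_fun setT F.
  apply: measurable_funM => //; apply: measurableT_comp => //.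
  apply: measurable_funM => //; apply: measurable_funM => //.
  by apply: measurable_funM => //; exact: mfst.
have mf : measurable_fun setT (fun p => f p.1 p.2).
  rewrite (_ : (fun p => _) = fun p => W p * ln (La p.1 * W p / g p.1)); last first.
    by apply/funext => -[].
  apply: measurable_funM => //; apply: measurableT_comp => //.
  by apply: measurable_funM; [apply: measurable_funM => //; exact: mfst|apply: measurable_invr; exact: mfst].
have mf0 : measurable_fun setT f0.
  apply: measurable_funM => //; apply: measurableT_comp => //.
  by apply: measurable_funM => //; exact: measurable_funM.
(* The marginal's share in [ln (l La W / m) = ln (La W / g) + ln (l g / m)]. *)
pose r (p : X * Y) : R := W p * ln (l * g p.1 / m).
(* Where [g] vanishes, division by it returns 0 and the logarithm does not split; but [W] vanishes
   almost everywhere over such [t]. *)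
have gpos : {ae P, forall p, W p = 0 \/ 0 < g p.1}.
  pose w (p : X * Y) : R := W p * (g p.1 <= 0)%R%:R.
  have mw : measurable_fun setT w.
    by apply: measurable_funM => //; apply: measurable_ler_ind; [exact: mfst|exact: measurable_cst].
  have wi : intgP w.
    apply: le_intg mw _ Wi => p; rewrite /w normrM (ger0_norm (W0 p)) ler_piMr//.
    by case: (_ <= 0); rewrite ?normr1 ?normr0.
  have w0 : \int[P]_p w p = 0.
    rewrite Rfubini1//; transitivity (\int[lam]_(x in [set: R]) (0 : R)); last by rewrite /Rintegral integral0.
    apply: ae_eq_Rintegral; [exact: measurable_Rintegral1|exact: measurable_cst|].
    apply: (ae_imp (ae_slice_intg Wi)) => t ht; rewrite /w/=.
    under eq_Rintegral do rewrite mulrC.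
    rewrite RintegralZ// -/(g t); case: (leP (g t) 0) => [gt|]; last by rewrite mul0r.
    by rewrite mul1r; apply/eqP; rewrite eq_le gt g0.
  have w00 p : 0 <= w p by rewrite mulr_ge0.
  apply: (ae_imp (Rintegral0_ae wi w00 w0)) => p /eqP.
  rewrite mulf_eq0 => /orP[/eqP|]; first by left.
  by rewrite pnatr_eq0 eqb0 -ltNge; right.
have mpos : {ae P, forall p, W p = 0 \/ 0 < m}.
  have [m0|] := eqVneq m 0.
    by apply: (ae_imp (Rintegral0_ae Wi W0 m0)) => p ->; left.
  move=> mN; apply: aeW => p; right; rewrite lt_neqAle eq_sym mN; exact: Rintegral_ge0.
have FE : {ae P, forall p, F p = f p.1 p.2 + r p}.
  apply: (ae_imp2 gpos mpos) => -[t v] /= h1 h2; rewrite /F /f /r/=.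
  have [->|Wn] := eqVneq (W (t, v)) 0; first by rewrite !mul0r addr0.
  have {Wn}W1 : 0 < W (t, v) by rewrite lt_neqAle eq_sym Wn W0.
  case: h1 => [h|g1]; first by rewrite h ltxx in W1.
  case: h2 => [h|m1]; first by rewrite h ltxx in W1.
  rewrite -mulrDr -lnM ?posrE ?divr_gt0 ?mulr_gt0//; congr (_ * ln _).
  by field; rewrite !gt_eqF.
pose q (p : X * Y) : R := W p * Num.max (ln (l * g p.1 / m)) 0.
have mq : measurable_fun setT q.
  apply: measurable_funM => //; apply: measurable_maxr; last exact: measurable_cst.
  apply: measurableT_comp => //; apply: measurable_funM => //.
  by apply: measurable_funM => //; exact: mfst.
have q0 p : 0 <= q p by rewrite mulr_ge0// le_max lexx orbT.
(* The logarithm in [r] depends on [t] alone, so integrating [q] over [v] gives exactly the positive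
   part of [f0]. *)
have [qi qle] : intgP q /\ \int[P]_p q p <= \int[lam]_t Num.max (f0 t) 0.
  apply: ge0_intg_le => //.
  have eq0 p : (0 <= (q p)%:E)%E by rewrite lee_fin.
  have emq : measurable_fun setT (fun p => (q p)%:E) by exact/measurable_EFinP.
  rewrite (fubini_tonelli1 _ emq eq0).
    rewrite EFin_Rintegral//; apply: ae_ge0_le_integral => //.
    - by move=> t _; apply: integral_ge0 => v _; rewrite lee_fin.
    - exact: measurable_fun_fubini_tonelli_F emq eq0.
    - by move=> t _; rewrite lee_fin le_max lexx orbT.
    - by apply/measurable_EFinP; exact: integrable_measurable f0i.
    - apply: (ae_imp (ae_slice_intg Wi)) => t ht _; rewrite /fubini_F /q/=.
      rewrite -EFin_Rintegral; last first.
        by under eq_fun do rewrite mulrC; exact: intgZ.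
      under eq_Rintegral do rewrite mulrC.
      rewrite RintegralZ// -/(g t) lee_fin mulrC /f0.
      by case: (leP (ln _) 0) => h; rewrite ?mulr0 ?le_max ?lexx ?orbT.
pose fp (p : X * Y) : R := Num.max (f p.1 p.2) 0.
have fp0 p : 0 <= fp p by rewrite le_max lexx orbT.
have mfp : measurable_fun setT fp by apply: measurable_maxr => //; exact: measurable_cst.
have [fpi fple] : intgP fp /\ \int[P]_p fp p <= \int[lam]_t Bp t.
  apply: ge0_intg_le => //.
  have efp0 p : (0 <= (fp p)%:E)%E by rewrite lee_fin.
  have emfp : measurable_fun setT (fun p => (fp p)%:E) by exact/measurable_EFinP.
  rewrite (fubini_tonelli1 _ emfp efp0).
    pose Bp' (t : R) := Num.max (Bp t) 0.
    have mBp' : measurable_fun setT Bp'.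
      by apply: measurable_maxr; [exact: integrable_measurable Bpi|exact: measurable_cst].
    have BpE : {ae lam, forall t, Bp t = Bp' t}.
      apply: (ae_imp slices) => t [_ h _]; rewrite /Bp' max_l// (le_trans _ h)//.
      by apply: Rintegral_ge0 => v _; rewrite le_max lexx orbT.
    have Bpi' : intg Bp' by exact: (@ae_eq_intg _ _ _ lam Bp Bp' mBp' BpE Bpi).
    have -> : \int[lam]_t Bp t = \int[lam]_t Bp' t.
      by apply: ae_eq_Rintegral => //; exact: integrable_measurable Bpi.
    rewrite EFin_Rintegral//; apply: ae_ge0_le_integral => //.
    - by move=> t _; apply: integral_ge0 => v _; rewrite lee_fin.
    - exact: measurable_fun_fubini_tonelli_F emfp efp0.
    - by move=> t _; rewrite lee_fin le_max lexx orbT.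
    - exact/measurable_EFinP.
    - apply: (ae_imp2 BpE slices) => t <- [fi fle _] _.
      by rewrite /fubini_F /fp/= -EFin_Rintegral// lee_fin.
have Fle : {ae P, forall p, Num.max (F p) 0 <= fp p + q p}.
  apply: (ae_imp FE) => p ->; rewrite ge_max addr_ge0// andbT /fp /q /r lerD//.
    by rewrite le_max lexx.
  by rewrite ler_wpM2l// le_max lexx.
have mF0 : measurable_fun setT (fun p => Num.max (F p) 0).
  by apply: measurable_maxr => //; exact: measurable_cst.
have [F1 F2] : intgP (fun p => Num.max (F p) 0) /\
    \int[P]_p Num.max (F p) 0 <= \int[P]_p (fp p + q p).
  apply: ae_ge0_intg_le => //; last exact: intgD.
  by apply: aeW => p; rewrite le_max lexx orbT.
split => //.
  rewrite (le_trans F2)// RintegralD//; apply: lerD => //.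
  exact: le_trans qle f0le.
move=> Fi.
pose H (t : R) := \int[mu]_v F (t, v).
have Hi : intg H by exact: integrable_Rintegral1.
(* Integrability of [F] gives that of almost every slice, and subtracting [r] that of [f t], so the
   conditional bound on the slices becomes available. *)
have HB : {ae lam, forall t : R, H t <= B t + f0 t}.
  have [FE1 _] := ae_prod FE.
  apply: (ae_imp2 (ae_imp2 slices FE1 (fun _ => pair))
    (ae_imp2 (ae_slice_intg Wi) (ae_slice_intg Fi) (fun _ => pair))).
  move=> t [[_ _ ft] FEt] [Wt Ft].
  have rt : intgY (fun v => r (t, v)).
    by rewrite /r/=; under eq_fun do rewrite mulrC; exact: intgZ.
  have mft : measurable_fun setT (f t).
    by have := measurableT_comp mf (measurable_pair1 t).
  have E : {ae mu, forall v, F (t, v) - r (t, v) = f t v}.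
    by apply: (ae_imp FEt) => v ->; rewrite addrK.
  have fti : intgY (f t) by apply: ae_eq_intg mft E _; exact: intgB.
  have /= := ft fti; rewrite -(ae_eq_Rintegral _ mft E); last first.
    by apply: measurable_funB; [exact: (integrable_measurable Ft)|exact: (integrable_measurable rt)].
  rewrite RintegralB// lerBlDr; congr (_ <= _ + _).
  by rewrite /r/=; under eq_Rintegral do rewrite mulrC; rewrite RintegralZ// mulrC.
(* [f0] is bounded below by the integrable [H - B] and has an integrable positive part. *)
have f0int : intg f0.
  apply: (@ae_le_intg _ _ _ lam _ (fun t => Num.max (f0 t) 0 *+ 2 + (B t - H t))) => //.
    by apply: (ae_imp HB) => t; exact: norm_le_max_sub.
  apply: intgD; last exact: intgB.
  by under eq_fun do rewrite -mulr_natl; exact: intgZ.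
rewrite Rfubini1//; apply: (@le_trans _ _ (\int[lam]_t (B t + f0 t))).
  by apply: ae_le_Rintegral => //; exact: intgD.
by rewrite RintegralD// lerD2l; exact: f0C.
Qed.

End disintegration.

Section sum_integrals.
Context d (T : measurableType d) (R : realType) (m : {measure set T -> \bar R}).
Local Notation intg f := (m.-integrable setT (EFin \o f)).

Lemma intg_sum (I : Type) (s : seq I) (f : I -> T -> R) : (forall i, intg (f i)) ->
  intg (fun x => \sum_(i <- s) f i x).
Proof.
move=> fi; elim: s => [|i s ih].
  by under eq_fun do rewrite big_nil; exact: integrable0.
by under eq_fun do rewrite big_cons; exact: intgD.
Qed.

Lemma Rintegral_sum (I : Type) (s : seq I) (f : I -> T -> R) : (forall i, intg (f i)) ->
  \int[m]_x (\sum_(i <- s) f i x) = \sum_(i <- s) \int[m]_x f i x.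
Proof.
move=> fi; elim: s => [|i s ih].
  by under eq_Rintegral do rewrite big_nil; rewrite big_nil /Rintegral integral0.
under eq_Rintegral do rewrite big_cons.
by rewrite RintegralD//; [rewrite ih big_cons|exact: intg_sum].
Qed.

End sum_integrals.

Section log_sobolev_rV.
Context (R : realType).
Local Notation lam := (@lebesgue_measure R).
Local Notation L := (@lebesgue_rV R).
Local Notation intgL n f := ((L n).-integrable setT (EFin \o f)).

Definition upd n (y : 'rV[R]_n) (j : 'I_n) (t : R) : 'rV[R]_n :=
  \row_i (if i == j then t else y ord0 i).

Lemma upd_consS n (t : R) (v : 'rV[R]_n) (j : 'I_n) (r : R) :
  upd (rV_cons (t, v)) (lift ord0 j) r = rV_cons (t, upd v j r).
Proof.
apply/rowP => i; rewrite mxE; case: (unliftP ord0 i) => [k ->|->].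
  by rewrite !rV_consS !mxE (inj_eq lift_inj).
by rewrite !rV_cons0.
Qed.

Lemma upd_cons0 n (t : R) (v : 'rV[R]_n) (r : R) :
  upd (rV_cons (t, v)) ord0 r = rV_cons (r, v).
Proof.
apply/rowP => i; rewrite mxE; case: (unliftP ord0 i) => [k ->|->].
  by rewrite !rV_consS.
by rewrite !rV_cons0.
Qed.

(* D j is the j-th partial derivative of W, in the sense that W is absolutely
   continuous on almost every line parallel to the j-th axis. *)
Definition partial_derivative n (W : 'rV[R]_n -> R) (j : 'I_n) (D : 'rV[R]_n -> R) :=
  {ae L n, forall y, W y = prim (fun t => D (upd y j t)) (y ord0 j)}.

Definition sobolev_density n (W : 'rV[R]_n -> R) (D K : 'I_n -> 'rV[R]_n -> R) :=
  [/\ intgL n W /\ (forall y, 0 <= W y),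
      forall j, intgL n (D j),
      forall j, intgL n (K j) /\ (forall y, 0 <= K j y),
      forall j y, D j y ^+ 2 <= 4 * W y * K j y &
      forall j, partial_derivative W j (D j)].

Lemma partial_derivative_cons n (W : 'rV[R]_n.+1 -> R) (j : 'I_n) (D : 'rV[R]_n.+1 -> R) :
  partial_derivative W (lift ord0 j) D ->
  {ae lam, forall t, partial_derivative (fun v => W (rV_cons (t, v))) j
                       (fun v => D (rV_cons (t, v)))}.
Proof.
move=> /ae_rVS /ae_prod [H _]; apply: (ae_imp H) => t Ht.
apply: (ae_imp Ht) => v ->; rewrite rV_consS/=; congr (prim _ _).
by apply/funext => r; rewrite upd_consS.
Qed.

Lemma partial_derivative_cons0 n (W D : 'rV[R]_n.+1 -> R) :
  partial_derivative W ord0 D ->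
  {ae (lam \x L n)%E, forall p, W (rV_cons p) = prim (fun r => D (rV_cons (r, p.2))) p.1}.
Proof.
move=> /ae_rVS H; apply: (ae_imp H) => -[t v] ->; rewrite rV_cons0/=.
by congr (prim _ _); apply/funext => r; rewrite upd_cons0.
Qed.

Lemma intg_cons n (f : 'rV[R]_n.+1 -> R) : intgL n.+1 f ->
  (lam \x L n)%E.-integrable setT (EFin \o (fun p => f (rV_cons p))).
Proof. by move=> fi; have := (integrable_rVS (measurable_int _ fi)).1 fi. Qed.

Lemma cons_intg n (f : 'rV[R]_n.+1 -> R) : measurable_fun setT f ->
  (lam \x L n)%E.-integrable setT (EFin \o (fun p => f (rV_cons p))) -> intgL n.+1 f.
Proof.
move=> mf fi; have h : measurable_fun setT (EFin \o f) by exact/measurable_EFinP.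
exact: (integrable_rVS h).2 fi.
Qed.

Lemma Rintegral_cons n (f : 'rV[R]_n.+1 -> R) : intgL n.+1 f ->
  \int[L n.+1]_y f y = \int[(lam \x L n)%E]_p f (rV_cons p).
Proof. by move=> fi; rewrite /Rintegral integral_rVS. Qed.

Lemma sobolev_density_cons n (W : 'rV[R]_n.+1 -> R) (D K : 'I_n.+1 -> 'rV[R]_n.+1 -> R) :
  sobolev_density W D K ->
  {ae lam, forall t, sobolev_density (fun v => W (rV_cons (t, v)))
     (fun j v => D (lift ord0 j) (rV_cons (t, v)))
     (fun j v => K (lift ord0 j) (rV_cons (t, v)))}.
Proof.
move=> [[Wi W0] Di Ki DWK AC].
have aW := ae_slice_intg (intg_cons Wi).
have aD : {ae lam, forall t, forall j : 'I_n, intgL n (fun v => D (lift ord0 j) (rV_cons (t, v)))}.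
  by apply: filter_forall => j; exact: ae_slice_intg (intg_cons (Di _)).
have aK : {ae lam, forall t, forall j : 'I_n, intgL n (fun v => K (lift ord0 j) (rV_cons (t, v)))}.
  by apply: filter_forall => j; exact: ae_slice_intg (intg_cons (Ki _).1).
have aAC : {ae lam, forall t, forall j : 'I_n,
    partial_derivative (fun v => W (rV_cons (t, v))) j (fun v => D (lift ord0 j) (rV_cons (t, v)))}.
  by apply: filter_forall => j; exact: partial_derivative_cons (AC _).
apply: (ae_imp2 (ae_imp2 aW aD (fun _ => pair)) (ae_imp2 aK aAC (fun _ => pair))).
move=> t [Wt Dt] [Kt ACt]; split => //.
by move=> j; split => // v; exact: (Ki _).2.
Qed.

(** Induction on [n]: the first coordinate is treated by the one-dimensional inequality and the
    slices by the induction hypothesis, all at scale [l], so that powers of [l] multiply and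
    constants add up. The scale is a parameter because the weighted inequality lets it vary with the
    slice. *)
Lemma log_sobolev_rV n (W : 'rV[R]_n -> R) (D K : 'I_n -> 'rV[R]_n -> R) (l a : R) :
  sobolev_density W D K -> 0 < l -> 0 < a ->
  let m := \int[L n]_y W y in let kap := \sum_j \int[L n]_y K j y in
  let f := fun y => W y * ln (l ^+ n * W y / m) in
  [/\ intgL n (fun y => Num.max (f y) 0),
      \int[L n]_y Num.max (f y) 0 <= n%:R * m + l ^+ 2 * kap &
      intgL n f -> \int[L n]_y f y <=
        a * l ^+ 2 * kap - n%:R * m * (1 + ln (pi * a) / 2)].
Proof.
move=> + l0 a0; elim: n W D K => [|n ih] W D K.
  move=> [[Wi W0] _ _ _ _] m kap f.
  have f0 : f = cst 0.
    (* [L 0] is the Dirac mass at the only point, so [m = W y]; either [W y = 0] or the logarithm is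
       [ln 1]. *)
    apply/funext => y; have mE : m = W y.
      rewrite /m /Rintegral [X in fine X]integral_dirac//=; last exact: measurable_int Wi.
      by rewrite indicE in_setT mul1r; congr W; apply/rowP => -[].
    rewrite /f expr0 mul1r mE; have [->|Wy] := eqVneq (W y) 0; first by rewrite mul0r.
    by rewrite divff// ln1 mulr0.
  have mf0 : (fun y => Num.max (f y) 0) = cst 0 by apply/funext => y; rewrite f0 maxxx.
  rewrite mf0 f0 /kap big_ord0 !mulr0 !mul0r subr0 addr0 /Rintegral integral0/=.
  by split => [|//|//]; exact: integrable0.
move=> WDK m kap f; have [[Wi W0] Di Ki DWK AC] := WDK.
have WP := intg_cons Wi.
pose g (t : R) := \int[L n]_v W (rV_cons (t, v)).
pose kt (t : R) := \sum_(j < n) \int[L n]_v K (lift ord0 j) (rV_cons (t, v)).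
have gi : lam.-integrable setT (EFin \o g) by exact: (@integrable_Rintegral1 _ _ _ _ _ lam (L n) _ WP).
have kji (j : 'I_n) : lam.-integrable setT
    (EFin \o (fun t => \int[L n]_v K (lift ord0 j) (rV_cons (t, v)))).
  exact: (@integrable_Rintegral1 _ _ _ _ _ lam (L n) _ (intg_cons (Ki (lift ord0 j)).1)).
have kti : lam.-integrable setT (EFin \o kt) by exact: intg_sum.
have ktE : \int[lam]_t kt t = \sum_(j < n) \int[L n.+1]_y K (lift ord0 j) y.
  rewrite Rintegral_sum//; apply: eq_bigr => j _.
  have KP := intg_cons (Ki (lift ord0 j)).1.
  rewrite Rintegral_cons//; last exact: (Ki _).1.
  by rewrite (@Rfubini1 _ _ _ _ _ lam (L n) _ KP).
have mE : m = \int[(lam \x L n)%E]_p W (rV_cons p) by exact: Rintegral_cons.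
have gE : \int[lam]_t g t = m by rewrite mE Rfubini1.
have base := log_sobolev_marginal WP (intg_cons (Di ord0)) (intg_cons (Ki ord0).1)
  (fun p => W0 _) (fun p => (Ki ord0).2 _) (fun p => DWK ord0 _)
  (partial_derivative_cons0 (AC ord0)) l0 a0.
have ln0' (t : R) : 0 < l ^+ n by rewrite exprn_gt0.
pose mP := \int[(lam \x L n)%E]_p W (rV_cons p).
pose k0 := \int[(lam \x L n)%E]_p K ord0 (rV_cons p).
have [|||F1 F2 F3] := @chain_step R _ _ (L n) (fun p => W (rV_cons p)) (fun=> l ^+ n)
  (fun t => n%:R * g t + l ^+ 2 * kt t)
  (fun t => a * l ^+ 2 * kt t - n%:R * g t * (1 + ln (pi * a) / 2)) l
  (mP + l ^+ 2 * k0) (a * l ^+ 2 * k0 - mP * (1 + ln (pi * a) / 2))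
  WP (fun p => W0 _) (measurable_cst _) ln0' l0 _ _ _ base.
- by apply: (ae_imp (sobolev_density_cons WDK)) => t; exact: ih.
- by apply: intgD; exact: intgZ.
- apply: intgB; first exact: intgZ.
  by under eq_fun do rewrite mulrAC; exact: intgZ.
have fE p : f (rV_cons p) = W (rV_cons p) * ln (l * l ^+ n * W (rV_cons p) /
    \int[(lam \x L n)%E]_p W (rV_cons p)).
  by rewrite /f exprS -mE.
have mW := integrable_measurable Wi.
have mf : measurable_fun setT f.
  apply: measurable_funM => //; apply: measurableT_comp => //.
  by apply: measurable_funM => //; exact: measurable_funM.
have mfm : measurable_fun setT (fun y => Num.max (f y) 0).
  by apply: measurable_maxr => //; exact: measurable_cst.
have F1' : intgL n.+1 (fun y => Num.max (f y) 0).
  apply: cons_intg => //.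
  by rewrite (_ : (fun p => _) = (fun p => Num.max (W (rV_cons p) * ln (l * l ^+ n * W (rV_cons p) /
    \int[(lam \x L n)%E]_p W (rV_cons p))) 0))//; apply/funext => p; rewrite fE.
have kapE : kap = \int[(lam \x L n)%E]_p K ord0 (rV_cons p) + \int[lam]_t kt t.
  by rewrite ktE /kap big_ord_recl Rintegral_cons//; exact: (Ki _).1.
split => //.
- rewrite Rintegral_cons//; under eq_Rintegral do rewrite fE.
  apply: (le_trans F2); rewrite RintegralD//; [|exact: intgZ..].
  rewrite !RintegralZ// gE /mP -mE kapE -/k0 -[n.+1]addn1 natrD.
  by rewrite le_eqVlt; apply/orP; left; apply/eqP; ring.
- move=> fi; have FP := intg_cons fi; rewrite Rintegral_cons//.
  under eq_Rintegral do rewrite fE.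
  apply: (le_trans (F3 _)).
    rewrite (_ : (fun p => _) = (fun p => f (rV_cons p)))//.
    by apply/funext => p; rewrite fE.
  rewrite RintegralB//; first last.
  + by under eq_fun do rewrite mulrAC; exact: intgZ.
  + exact: intgZ.
  under [X in _ - X + _ <= _]eq_Rintegral do rewrite mulrAC.
  rewrite !RintegralZ// gE /mP -mE kapE -/k0 -[n.+1]addn1 natrD.
  by rewrite le_eqVlt; apply/orP; left; apply/eqP; ring.
Qed.

End log_sobolev_rV.

(** * Smooth test functions *)

Section CkOn.
Context (R : realType) (V : normedModType R) (I : Type) (e : I -> V).
Implicit Types (f g : V -> R) (A B : set V).

(** A directional derivative is a derivative along a line, which makes the one-variable chain rule
    available on [V]. *)
Lemma is_derive_lineP f (x v : V) (df : R) :
  is_derive x v f df <-> is_derive (0 : R) 1 (fun h => f (h *: v + x)) df.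
Proof.
have E : 'D_v f x = 'D_1 (fun h : R => f (h *: v + x)) 0.
  rewrite /derive; set g1 := fun h => h^-1 *: _; set g2 := fun h => h^-1 *: _.
  suff -> : g1 = g2 by [].
  by rewrite funeqE /g1 /g2 => h /=; rewrite addr0 scale0r add0r [_%:A]mulr1.
split => -[d1 d2]; split; [exact: (derivable1P f x v).1 d1|by rewrite -E| |by rewrite E].
exact: (derivable1P f x v).2 d1.
Qed.

Lemma is_derive_comp1 (th : R -> R) f (x v : V) (df dth : R) :
  is_derive x v f df -> is_derive (f x) 1 th dth ->
  is_derive x v (fun y => th (f y)) (dth * df).
Proof.
move=> /is_derive_lineP hf hth; apply/is_derive_lineP.
have hth' : is_derive (f (0 *: v + x)) 1 th dth by rewrite scale0r add0r.
have [d1 d2] := @is_derive1_comp _ th (fun h : R => f (h *: v + x)) 0 _ _ hth' hf.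
by split.
Qed.

(** Derivatives are total functions taken in [V], so regularity is recorded at the points of [A]
    without restricting [f]. The family [e] covers both [Ck] on row vectors and, with the single
    direction [1], the real line. *)
Fixpoint CkOn A (k : nat) f : Prop :=
  if k is k'.+1 then
    [/\ forall x, A x -> {for x, continuous f},
        forall i x, A x -> derivable f x (e i) &
        forall i, CkOn A k' (fun x => 'D_(e i) f x)]
  else forall x, A x -> {for x, continuous f}.

Lemma CkOn_continuous A k f x : CkOn A k f -> A x -> {for x, continuous f}.
Proof. by case: k => [|k] /=; [move=> h; exact: h|move=> [h _ _]; exact: h]. Qed.

Lemma CkOnW A k f : CkOn A k.+1 f -> CkOn A k f.
Proof.
elim: k f => [|k ih] f; first by move=> [].
by move=> [h1 h2 h3]; split => // i; exact: ih.
Qed.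

Lemma CkOn_subset A B k f : B `<=` A -> CkOn A k f -> CkOn B k f.
Proof.
move=> BA; elim: k f => [|k ih] f /=; first by move=> h x /BA; exact: h.
move=> [h1 h2 h3]; split.
- by move=> x /BA; exact: h1.
- by move=> i x /BA; exact: h2.
- by move=> i; exact: ih.
Qed.

(** Since derivatives are taken in [V], regularity can be checked piece by piece; this glues a
    function on the ball with its extension by 0. *)
Lemma CkOn_setU A B k f : CkOn A k f -> CkOn B k f -> CkOn (A `|` B) k f.
Proof.
elim: k f => [|k ih] f /=; first by move=> hA hB x [/hA|/hB].
move=> [a1 a2 a3] [b1 b2 b3]; split.
- by move=> x [/a1|/b1].
- by move=> i x [/a2|/b2].
- by move=> i; exact: ih.
Qed.

Lemma CkOn_eq A k f g : open A -> (forall x, A x -> f x = g x) ->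
  CkOn A k f -> CkOn A k g.
Proof.
move=> oA; elim: k f g => [|k ih] f g fg.
  move=> /= h x Ax; have fgx : \near x, f x = g x.
    by near=> y; apply: fg; near: y; exact: open_nbhs_nbhs.
  rewrite /prop_for /continuous_at -fg//.
  apply: cvg_trans (h x Ax); apply: near_eq_cvg.
  by apply: filterS fgx => y ->.
have fgx x : A x -> \near x, f x = g x.
  by move=> Ax; near=> y; apply: fg; near: y; exact: open_nbhs_nbhs.
move=> [h1 h2 h3]; split.
- move=> x Ax; rewrite /prop_for /continuous_at -fg//.
  apply: cvg_trans (h1 x Ax); apply: near_eq_cvg; have := fgx x Ax.
  by apply: filterS => y ->.
- by move=> i x Ax; apply: near_eq_derivable (h2 i x Ax); exact: fgx.
- move=> i; apply: (ih _ _ _ (h3 i)) => x Ax.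
  by apply: near_eq_derive; exact: fgx.
Unshelve. all: by end_near. Qed.

Lemma CkOn_derive A k f (df : I -> V -> R) : open A ->
  (forall i x, A x -> is_derive x (e i) f (df i x)) ->
  (forall x, A x -> {for x, continuous f}) ->
  (forall i, CkOn A k (df i)) -> CkOn A k.+1 f.
Proof.
move=> oA fdf cf dfk; split => //.
- by move=> i x Ax; exact: (@ex_derive _ _ _ _ _ _ _ (fdf i x Ax)).
- move=> i; apply: CkOn_eq (dfk i) => // x Ax.
  by rewrite (@derive_val _ _ _ _ _ _ _ (fdf i x Ax)).
Qed.

Lemma CkOn_is_derive A k f i x : CkOn A k.+1 f -> A x ->
  is_derive x (e i) f ('D_(e i) f x).
Proof. by move=> [_ h _] Ax; apply: derivableP; exact: h. Qed.

Lemma CkOn_cst A k (c : R) : open A -> CkOn A k (fun=> c).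
Proof.
move=> oA; elim: k c => [|k ih] c; first by move=> x _; exact: cvg_cst.
have H1 (i : I) x : A x -> is_derive x (e i) (fun=> c) 0 by move=> _; exact: is_derive_cst.
have H2 x : A x -> {for x, continuous (fun=> c : R)} by move=> _; exact: cvg_cst.
exact: (CkOn_derive oA H1 H2 (fun i => ih 0)).
Qed.

Lemma CkOnD A k f g : open A -> CkOn A k f -> CkOn A k g ->
  CkOn A k (fun x => f x + g x).
Proof.
move=> oA; elim: k f g => [|k ih] f g hf hg.
  by move=> x Ax; apply: (@cvgD _ R^o); [exact: hf|exact: hg].
apply: (@CkOn_derive _ _ _ (fun i x => 'D_(e i) f x + 'D_(e i) g x)) => //.
- move=> i x Ax; have := CkOn_is_derive i hf Ax; have := CkOn_is_derive i hg Ax.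
  by move=> h1 h2; exact: is_deriveD.
- move=> x Ax; apply: (@cvgD _ R^o); [exact: (CkOn_continuous hf)|exact: (CkOn_continuous hg)].
- by move=> i; case: hf => _ _ hf; case: hg => _ _ hg; exact: ih (hf i) (hg i).
Qed.

Lemma CkOnM A k f g : open A -> CkOn A k f -> CkOn A k g ->
  CkOn A k (fun x => f x * g x).
Proof.
move=> oA; elim: k f g => [|k ih] f g hf hg.
  by move=> x Ax; apply: (@cvgM R); [exact: hf|exact: hg].
apply: (@CkOn_derive _ _ _ (fun i x => f x * 'D_(e i) g x + g x * 'D_(e i) f x)) => //.
- move=> i x Ax; have := CkOn_is_derive i hf Ax; have := CkOn_is_derive i hg Ax.
  by move=> h1 h2; exact: is_deriveM.
- move=> x Ax; apply: (@cvgM R); [exact: (CkOn_continuous hf)|exact: (CkOn_continuous hg)].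
- move=> i; have hfW := CkOnW hf; have hgW := CkOnW hg.
  case: hf => _ _ hf; case: hg => _ _ hg; apply: CkOnD => //; first exact: ih hfW (hg i).
  exact: ih hgW (hf i).
Qed.

Lemma CkOnZ A k (c : R) f : open A -> CkOn A k f -> CkOn A k (fun x => c * f x).
Proof. by move=> oA hf; apply: CkOnM => //; exact: CkOn_cst. Qed.

Lemma CkOnB A k f g : open A -> CkOn A k f -> CkOn A k g ->
  CkOn A k (fun x => f x - g x).
Proof.
move=> oA hf hg; apply: (@CkOn_eq _ _ (fun x => f x + -1 * g x)) => //.
  by move=> x _; rewrite mulN1r.
by apply: CkOnD => //; exact: CkOnZ.
Qed.

Lemma CkOn_sum A k (J : Type) (s : seq J) (f : J -> V -> R) : open A ->
  (forall j, CkOn A k (f j)) -> CkOn A k (fun x => \sum_(j <- s) f j x).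
Proof.
move=> oA hf; elim: s => [|j s ih].
  by under eq_fun do rewrite big_nil; exact: CkOn_cst.
by under eq_fun do rewrite big_cons; exact: CkOnD.
Qed.

Lemma CkOn_prod A k (J : Type) (s : seq J) (f : J -> V -> R) : open A ->
  (forall j, CkOn A k (f j)) -> CkOn A k (fun x => \prod_(j <- s) f j x).
Proof.
move=> oA hf; elim: s => [|j s ih].
  by under eq_fun do rewrite big_nil; exact: CkOn_cst.
by under eq_fun do rewrite big_cons; exact: CkOnM.
Qed.

Lemma CkOnX A k (n : nat) f : open A -> CkOn A k f -> CkOn A k (fun x => f x ^+ n).
Proof.
move=> oA hf; elim: n => [|n ih].
  by under eq_fun do rewrite expr0; exact: CkOn_cst.
by under eq_fun do rewrite exprS; exact: CkOnM.
Qed.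

End CkOn.

Section smooth_line.
Context (R : realType).
Local Notation Ck1 := (@CkOn R R unit (fun=> 1)).
Implicit Types (f th : R -> R) (A B : set R).

Lemma CkOn_comp (V : normedModType R) (I : Type) (e : I -> V) (A : set V) B k th (f : V -> R) :
  open A -> (forall x, A x -> B (f x)) -> Ck1 B k th -> CkOn e A k f ->
  CkOn e A k (fun x => th (f x)).
Proof.
move=> oA AB; elim: k th => [|k ih] th hth hf.
  by move=> x Ax; apply: (@continuous_comp _ _ _ f th); [exact: hf|exact/hth/AB].
have H1 i x : A x -> is_derive x (e i) (fun x => th (f x)) ('D_1 th (f x) * 'D_(e i) f x).
  move=> Ax; have h1 := CkOn_is_derive i hf Ax.
  have h2 := CkOn_is_derive tt hth (AB _ Ax).
  by have := is_derive_comp1 h1 h2.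
have H2 x : A x -> {for x, continuous (fun x => th (f x))}.
  move=> Ax; apply: (@continuous_comp _ _ _ f th); first exact: (CkOn_continuous hf Ax).
  exact: (CkOn_continuous hth (AB _ Ax)).
apply: (CkOn_derive oA H1 H2) => i.
have hfW := CkOnW hf; case: hf => _ _ hf; case: hth => _ _ /(_ tt) hth.
by apply: CkOnM => //; [have := ih _ hth hfW|exact: hf].
Qed.

Lemma Ck1_id A k : open A -> Ck1 A k id.
Proof.
move=> oA; case: k => [|k]; first by move=> x _; exact: cvg_id.
have H1 (i : unit) (x : R) : A x -> is_derive x 1 id 1 by move=> _; exact: is_derive_id.
have H2 (x : R) : A x -> {for x, continuous (@id R)} by move=> _; exact: cvg_id.
by apply: (CkOn_derive oA H1 H2) => _; exact: CkOn_cst.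
Qed.

Lemma open_neq0 : open [set x : R | x != 0].
Proof.
rewrite (_ : [set _ | _] = ~` [set 0]); last first.
  by apply/seteqP; split => x /= /eqP.
by apply: closed_openC; exact: closed_eq.
Qed.

Lemma Ck1_inv k : Ck1 [set x | x != 0] k (fun x => x^-1).
Proof.
elim: k => [|k ih]; first by move=> x x0; exact: inv_continuous.
have oA := open_neq0.
have H1 (i : unit) (x : R) : x != 0 -> is_derive x 1 (fun x => x^-1) (- 1 * (x^-1 * x^-1)).
  move=> x0; have := @is_deriveV _ id x 1 1 x0 (is_derive_id _ _).
  by rewrite /GRing.scale/= mulr1 expr2 invfM mulN1r.
have H2 (x : R) : x != 0 -> {for x, continuous (fun x : R => x^-1)}.
  by move=> x0; exact: inv_continuous.
by apply: (CkOn_derive oA H1 H2) => _; apply: CkOnZ => //; exact: CkOnM.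
Qed.

Lemma Ck1_ln k : Ck1 [set x | 0 < x] k (@ln R).
Proof.
have oA : open [set x : R | 0 < x] by exact: open_gt.
case: k => [|k]; first by move=> x x0; exact: continuous_ln.
have H1 (i : unit) (x : R) : 0 < x -> is_derive x 1 (@ln R) x^-1.
  by move=> x0; exact: is_derive1_ln.
have H2 (x : R) : 0 < x -> {for x, continuous (@ln R)} by move=> x0; exact: continuous_ln.
apply: (CkOn_derive oA H1 H2) => _; apply: (CkOn_subset _ (Ck1_inv k)) => x /=.
by move=> x0; rewrite gt_eqF.
Qed.

Lemma Ck1_expR k : Ck1 setT k (@expR R).
Proof.
have oT := @openT R.
elim: k => [|k ih]; first by move=> x _; exact: continuous_expR.
have H1 (i : unit) (x : R) : setT x -> is_derive x 1 (@expR R) (expR x).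
  by move=> _; exact: is_derive_expR.
have H2 (x : R) : setT x -> {for x, continuous (@expR R)} by move=> _; exact: continuous_expR.
exact: (CkOn_derive oT H1 H2).
Qed.

(* The derivatives of the smooth function exp(-1/t), extended by 0 for t <= 0,
   are combinations of the functions of this family. *)
Definition flat (m : nat) (t : R) : R :=
  if 0 < t then t^-1 ^+ m * expR (- t^-1) else 0.

Lemma flat_ge0 m t : 0 <= flat m t.
Proof.
by rewrite /flat; case: ifPn => // t0; rewrite mulr_ge0 ?expR_ge0// exprn_ge0// invr_ge0 ltW.
Qed.

(** From [exp y >= y^(m+2) / (m+2)!] at [y = 1 / t]. The factor [t^2] makes the difference quotient
    at 0 tend to 0. *)
Lemma flat_le m t : 0 < t -> flat m t <= (m.+2)`!%:R * t ^+ 2.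
Proof.
move=> t0; rewrite /flat t0 expRN ler_pdivrMr ?expR_gt0//.
have t10 : 0 <= t^-1 by rewrite invr_ge0 ltW.
apply: (@le_trans _ _ ((m.+2)`!%:R * t ^+ 2 * (1 + t^-1 ^+ m.+2 / (m.+2)`!%:R))); last first.
  by rewrite ler_wpM2l ?expR_ge1Dxn// mulr_ge0// sqr_ge0.
rewrite mulrDr mulr1.
have -> : (m.+2)`!%:R * t ^+ 2 * (t^-1 ^+ m.+2 / (m.+2)`!%:R) = t^-1 ^+ m.
  have : (m.+2)`!%:R != 0 :> R by rewrite pnatr_eq0 -lt0n fact_gt0.
  rewrite !exprS; move: (m.+2)`!%:R (t^-1 ^+ m) => c z c0.
  by field; rewrite c0 gt_eqF.
by rewrite lerDr mulr_ge0// sqr_ge0.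
Qed.

Lemma is_derive_flat m (t : R) : is_derive t 1 (flat m) (flat m.+2 t - m%:R * flat m.+1 t).
Proof.
have [t0|t0|t0] := ltgtP 0 t.
- have E : \near t, t^-1 ^+ m * expR (- t^-1) = flat m t.
    have : \forall y \near t, 0 < y by exact: lt_nbhsr.
    by apply: filterS => y y0; rewrite /flat y0.
  have tN : t != 0 by rewrite gt_eqF.
  have h1 := @is_deriveV _ id t 1 1 tN (is_derive_id _ _).
  have h2 := @is_deriveX _ _ (fun t : R => t^-1) m t 1 _ h1.
  have h3 := @is_deriveN _ _ _ (fun t : R => t^-1) t 1 _ h1.
  have h4 := @is_derive1_comp _ (@expR R) (fun t : R => - t^-1) t _ _ (is_derive_expR _) h3.
  have h5 := is_deriveM h2 h4.
  rewrite (_ : _ * _ = (fun t => t^-1 ^+ m * expR (- t^-1))) in h5; last first.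
    by apply/funext => y; rewrite !fctE.
  have [d1 d2] := near_eq_is_derive E h5.
  split => //; rewrite [LHS]d2 exprfctE /GRing.scale/= /flat t0 !mulr1.
  have -> : t ^- 2 = t^-1 * t^-1 by rewrite expr2 invfM.
  case: m {E h2 h5 d1 d2} => [|m]; rewrite /= !exprS; first by rewrite !mul0r; ring.
  ring.
- have E : \near t, cst 0 t = flat m t.
    have : \forall y \near t, y < 0 by exact: lt_nbhsl.
    by apply: filterS => y y0; rewrite /flat ltNge (ltW y0).
  have : is_derive t 1 (flat m) 0 by have := near_eq_is_derive E (is_derive_cst (0 : R) t 1).
  by rewrite /flat !(ltNge 0 t) (ltW t0)/= mulr0 subr0.
- rewrite -t0.
  have fl k : flat k 0 = 0 by rewrite /flat ltxx.
  rewrite !fl mulr0 subr0.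
  have c : (fun h => h^-1 *: ((flat m \o shift 0) (h *: 1) - flat m 0)) @ 0^' --> (0 : R).
    apply/cvgr0Pnorm_lt => eps eps0.
    have C0 : 0 < (m.+2)`!%:R :> R by rewrite ltr0n fact_gt0.
    near=> h; rewrite /= addr0 [h *: 1]mulr1 fl subr0 /GRing.scale/= normrM.
    have [h0|h0] := leP h 0; first by rewrite /flat (ltNge 0 h) h0/= normr0 mulr0.
    rewrite normfV (gtr0_norm h0) (ger0_norm (flat_ge0 _ _)).
    apply: (@le_lt_trans _ _ (h^-1 * ((m.+2)`!%:R * h ^+ 2))).
      by rewrite ler_wpM2l ?invr_ge0 ?(ltW h0)// flat_le.
    rewrite expr2 mulrCA mulKf ?gt_eqF// mulrC -ltr_pdivlMr//.
    by rewrite (le_lt_trans (ler_norm h))//; near: h; apply: dnbhs0_lt; rewrite divr_gt0.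
  split; first by apply/cvg_ex; exists 0.
  by apply/cvg_lim => //; exact: Rhausdorff.
Unshelve. all: by end_near. Qed.

Lemma Ck1_flat k m : Ck1 setT k (flat m).
Proof.
have oT := @openT R.
elim: k m => [|k ih] m.
  by move=> x _; exact: is_derive_continuous (is_derive_flat m x).
have H1 (i : unit) (x : R) : setT x ->
    is_derive x 1 (flat m) (flat m.+2 x - m%:R * flat m.+1 x).
  by move=> _; exact: is_derive_flat.
have H2 (x : R) : setT x -> {for x, continuous (flat m)}.
  by move=> _; exact: is_derive_continuous (is_derive_flat m x).
by apply: (CkOn_derive oT H1 H2) => _; apply: CkOnB => //; exact: CkOnZ.
Qed.

End smooth_line.

Section smooth_compact.
Context (R : realType).
Local Notation lam := (@lebesgue_measure R).
Local Notation intg f := (lam.-integrable setT (EFin \o f)).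
Local Notation smooth f := (forall k, CkOn (fun _ : unit => 1 : R) setT k f).
Implicit Types (f g : R -> R).

Definition smooth_compact f := smooth f /\ exists M : R, forall t, M <= `|t| -> f t = 0.

Lemma smooth_compactM f g : smooth_compact f -> smooth g ->
  smooth_compact (fun t => f t * g t).
Proof.
move=> [sf [M fM]] sg; split; last by exists M => t /fM ->; rewrite mul0r.
by move=> k; apply: CkOnM; [exact: openT|exact: sf|exact: sg].
Qed.

Lemma smooth_is_derive f : smooth f -> forall t : R, is_derive t 1 f ('D_1 f t).
Proof. by move=> sf t; have := CkOn_is_derive tt (sf 1%N) (I : setT t). Qed.

Lemma smooth_derive f : smooth f -> smooth (fun t => 'D_1 f t).
Proof. by move=> sf k; have [_ _ /(_ tt)] := sf k.+1. Qed.

Lemma smooth_continuous f : smooth f -> continuous f.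
Proof. by move=> sf t; exact: (sf 0%N t I). Qed.

Lemma smooth_compact_derive f : smooth_compact f -> smooth_compact (fun t => 'D_1 f t).
Proof.
move=> [sf [M fM]]; split; first exact: smooth_derive.
exists (Num.max M 0 + 1) => t Mt.
have E : \near t, cst 0 t = f t.
  near=> s; rewrite fM//=.
  have st : `|s - t| < 1 by near: s; apply: cvgr_distC_lt => //; exact: cvg_id.
  have := ler_normD s (t - s); rewrite addrC subrK [`|t - s|]distrC => h.
  have : M <= Num.max M 0 by rewrite le_max lexx.
  by lra.
have <- : 'D_1 (cst 0 : R -> R) t = 'D_1 f t by exact: near_eq_derive E.
exact: (@derive_val _ _ _ _ _ _ _ (is_derive_cst (0 : R) t 1)).
Unshelve. all: by end_near. Qed.

Lemma smooth_compact_intg f : smooth_compact f -> intg f.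
Proof.
move=> [sf [M fM]].
rewrite (_ : f = f \_ `[- `|M|, `|M|]).
  by apply: intg_itv => x _; exact: smooth_continuous.
apply/funext => t; rewrite patchE mem_setE in_itv/= -ler_norml; case: ifPn => //.
rewrite -ltNge => h; apply: fM; exact: le_trans (ler_norm _) (ltW h).
Qed.

Lemma smooth_compact_bounded f : smooth_compact f -> exists C : R, forall t, `|f t| <= C.
Proof.
move=> [sf [M fM]].
have cf : {within `[- `|M|, `|M|], continuous f}.
  by apply: continuous_subspaceT; exact: smooth_continuous.
have [C [_ HC]] := compact_bounded (continuous_compact cf (@segment_compact R _ _)).
exists (Num.max (C + 1) 0) => t.
have [h|h] := leP `|t| `|M|.
  rewrite le_max; apply/orP; left; apply: (HC (C + 1)); first by rewrite ltrDl.
  by exists t => //=; rewrite in_itv/= -ler_norml.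
rewrite fM ?normr0 ?le_max ?lexx ?orbT//.
exact: le_trans (ler_norm _) (ltW h).
Qed.

(** Positive exactly on []a, b[]; the factor [n + 1] makes the sequence increase to the indicator of
    that interval. *)
Definition bump (a b : R) (n : nat) (t : R) : R := flat 0 (n.+1%:R * ((t - a) * (b - t))).

Lemma smooth_affine (a b : R) : smooth (fun t => a * t + b).
Proof.
move=> k; apply: CkOnD; [exact: openT| |exact: CkOn_cst openT].
by apply: CkOnZ; [exact: openT|exact: Ck1_id openT].
Qed.

Lemma smooth_comp f g : smooth f -> smooth g -> smooth (fun t => f (g t)).
Proof.
by move=> sf sg k; apply: (@CkOn_comp _ _ _ _ _ setT) => //; exact: openT.
Qed.

Lemma smooth_bump a b n : smooth (bump a b n).
Proof.
have sq : smooth (fun t => n.+1%:R * ((1 * t + - a) * (- 1 * t + b))).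
  move=> k; apply: CkOnZ; first exact: openT.
  by apply: CkOnM; [exact: openT|exact: smooth_affine..].
have := smooth_comp (fun k => @Ck1_flat R k 0) sq.
by rewrite (_ : (fun t => _) = bump a b n)//; apply/funext => t; rewrite /bump !mul1r mulN1r [b - t]addrC.
Qed.

Lemma bump_out a b n t : a < b -> ~~ (a < t < b) -> bump a b n t = 0.
Proof.
move=> ab h; rewrite /bump /flat ifN// -leNgt pmulr_rle0//.
move: h; rewrite negb_and -!leNgt => /orP[ta|bt].
  by rewrite mulr_le0_ge0// ?subr_le0// subr_ge0 (le_trans ta)// ltW.
by rewrite mulr_ge0_le0// ?subr_le0// subr_ge0 (le_trans _ bt)// ltW.
Qed.

Lemma bump_smooth_compact a b n : a < b -> smooth_compact (bump a b n).
Proof.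
move=> ab; split; first exact: smooth_bump.
exists (`|a| + `|b|) => t h; apply: bump_out => //; apply/negP => /andP[ta tb].
have := ler_norm b; have := ler_norm (- a); rewrite normrN => h1 h2.
have [t0|t0] := leP 0 t.
  by move: h; rewrite (ger0_norm t0); have := normr_ge0 a; lra.
by move: h; rewrite (ltr0_norm t0); have := normr_ge0 b; lra.
Qed.

Lemma bump_cvg a b t : a < b ->
  bump a b n t @[n --> \oo] --> ((a < t < b)%R%:R : R).
Proof.
move=> ab; have [/andP[ta tb]|h] := boolP (a < t < b); last first.
  by under eq_fun do rewrite bump_out//; exact: cvg_cst.
set c := (t - a) * (b - t).
have c0 : 0 < c by rewrite mulr_gt0// subr_gt0.
have -> : (fun n => bump a b n t) = (fun n => expR (- (c^-1 * harmonic n))).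
  apply/funext => n; rewrite /bump -/c /flat mulr_gt0// expr0 mul1r invfM.
  by rewrite mulrC.
rewrite -expR0; apply: continuous_cvg; first exact: continuous_expR.
rewrite -oppr0; apply: (@cvgN _ R^o); rewrite -(mulr0 c^-1).
by apply: (@cvgM R); [exact: cvg_cst|exact: cvg_harmonic].
Qed.

(** The factor [expR 1] normalises the value at 0 to 1; dilating by [n + 1] makes the sequence tend
    to 1 everywhere, with derivatives of order [1 / (n + 1)]. *)
Definition cut (n : nat) (t : R) : R := expR 1 * bump (-1) 1 0 (n.+1%:R^-1 * t).

Let m11 : (-1 : R) < 1. Proof. by lra. Qed.

Lemma cut_smooth_compact n : smooth_compact (cut n).
Proof.
split.
  have := smooth_comp (smooth_bump (-1) 1 0) (@smooth_affine n.+1%:R^-1 0).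
  rewrite (_ : (fun t => _) = fun t => bump (-1) 1 0 (n.+1%:R^-1 * t)); last first.
    by apply/funext => t; rewrite addr0.
  by move=> h k; apply: CkOnZ; [exact: openT|exact: h].
exists n.+1%:R => t h; rewrite /cut bump_out ?mulr0//.
have e : `|n.+1%:R^-1 * t| = `|t| / n.+1%:R.
  by rewrite normrM normfV [`|n.+1%:R|]ger0_norm// mulrC.
by rewrite -ltr_norml e ltr_pdivrMr// mul1r -leNgt.
Qed.

Lemma cut01 n t : 0 <= cut n t <= 1.
Proof.
rewrite /cut mulr_ge0 ?expR_ge0 ?flat_ge0//=; move: (_ * t) => s.
have [/andP[s1 s2]|h] := boolP (-1 < s < 1); last by rewrite bump_out// mulr0.
have c0 : 0 < (s - -1) * (1 - s) by rewrite mulr_gt0// subr_gt0.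
rewrite /bump /flat mul1r c0 expr0 mul1r -expRD -[leRHS]expR0 ler_expR subr_le0.
by rewrite -[leLHS]invr1 lef_pV2 ?posrE//; have := sqr_ge0 s; rewrite expr2; nra.
Qed.

Lemma cut_cvg t : cut n t @[n --> \oo] --> (1 : R).
Proof.
have -> : 1 = expR 1 * bump (-1) 1 0 (0 * t).
  rewrite /bump /flat mul0r !sub0r opprK subr0 !mulr1 ltr01 expr0 mul1r invr1.
  by rewrite -expRD subrr expR0.
apply: (@cvgM R); first exact: cvg_cst.
apply: continuous_cvg; first by apply: smooth_continuous; exact: smooth_bump.
apply: (@cvgM R); last exact: cvg_cst.
exact: cvg_harmonic.
Qed.

Lemma cut_derive : exists C : R, [/\ 0 <= C, forall n t, `|'D_1 (cut n) t| <= C &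
  forall t, 'D_1 (cut n) t @[n --> \oo] --> (0 : R)].
Proof.
have [C HC] := smooth_compact_bounded (smooth_compact_derive (bump_smooth_compact 0 m11)).
have C0 : 0 <= C by exact: le_trans (normr_ge0 _) (HC 0).
have E n (t : R) : 'D_1 (cut n) t = expR 1 * ('D_1 (bump (-1) 1 0) (n.+1%:R^-1 * t) * n.+1%:R^-1).
  have h1 := smooth_is_derive (smooth_bump (-1) 1 0) (n.+1%:R^-1 * t).
  have h2 : is_derive t 1 (fun t => n.+1%:R^-1 * t) n.+1%:R^-1.
    by apply: is_derive_eq; rewrite /GRing.scale/= mulr1.
  have h3 := @is_derive1_comp _ (bump (-1) 1 0) (fun t => n.+1%:R^-1 * t) t _ _ h1 h2.
  exact: (@derive_val _ _ _ _ _ _ _ (is_deriveZ (expR 1) h3)).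
have B n t : `|'D_1 (cut n) t| <= expR 1 * C * n.+1%:R^-1.
  rewrite E !normrM (ger0_norm (expR_ge0 _)) -mulrA ler_wpM2l ?expR_ge0//.
  by rewrite [`|n.+1%:R^-1|]ger0_norm ?invr_ge0// ler_wpM2r// invr_ge0.
exists (expR 1 * C); split.
- by rewrite mulr_ge0 ?expR_ge0.
- move=> n t; apply: (le_trans (B n t)); rewrite ler_piMr ?mulr_ge0 ?expR_ge0//.
  by rewrite invf_le1// ler1n.
- move=> t; apply/norm_cvg0P; apply: (@squeeze_cvgr _ _ _ _ (cst 0) (fun n => expR 1 * C * n.+1%:R^-1)).
  + by apply: nearW => n; rewrite normr_ge0 B.
  + exact: cvg_cst.
  + by rewrite -(mulr0 (expR 1 * C)); apply: (@cvgM R); [exact: cvg_cst|exact: cvg_harmonic].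
Qed.

Lemma smooth_prim f : smooth_compact f -> smooth (prim f).
Proof.
move=> sc; have fi := smooth_compact_intg sc; case: sc => sf _ k.
have H2 (x : R) : setT x -> {for x, continuous (prim f)} by move=> _; exact: continuous_prim.
case: k => [//|k]; have H1 (i : unit) (x : R) : setT x -> is_derive x 1 (prim f) (f x).
  by move=> _; apply: is_derive_prim => //; exact: smooth_continuous.
by apply: (CkOn_derive openT H1 H2) => _; exact: sf.
Qed.

End smooth_compact.

(** * Measures with a density, and product test functions *)

Section density.
Context d (T : measurableType d) (R : realType) (mu : {measure set T -> \bar R}).
Context (rho : T -> R) (mrho : measurable_fun setT rho) (rho0 : forall x, 0 <= rho x).

Definition density (mrho : measurable_fun setT rho) (rho0 : forall x, 0 <= rho x)
  (A : set T) : \bar R := (\int[mu]_(x in A) (rho x)%:E)%E.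

Let dens0 : density mrho rho0 set0 = 0%E.
Proof. by rewrite /density integral_set0. Qed.

Let dens_ge0 A : (0 <= density mrho rho0 A)%E.
Proof. by apply: integral_ge0 => x _; rewrite lee_fin. Qed.

Let dens_sigma_additive : semi_sigma_additive (density mrho rho0).
Proof.
apply: semi_sigma_additive_nng_induced; first exact/measurable_EFinP.
by move=> x; rewrite lee_fin.
Qed.

HB.instance Definition _ := isMeasure.Build _ _ _ (density mrho rho0)
  dens0 dens_ge0 dens_sigma_additive.

End density.

Section integral_density.
Context d (T : measurableType d) (R : realType) (mu nu : {measure set T -> \bar R}).
Context (rho : T -> R) (mrho : measurable_fun setT rho) (rho0 : forall x, 0 <= rho x).
Hypothesis nuE : forall A, measurable A -> nu A = (\int[mu]_(x in A) (rho x)%:E)%E.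
Import HBNNSimple.

Lemma ge0_integral_density (f : T -> \bar R) : measurable_fun setT f ->
  (forall x, (0 <= f x)%E) ->
  (\int[nu]_x f x = \int[mu]_x (f x * (rho x)%:E))%E.
Proof.
move=> mf f0; pose f_ := nnsfun_approx measurableT mf.
have fT x : (EFin \o f_ ^~ x) n @[n --> \oo] --> f x.
  by apply: cvg_nnsfun_approx.
have -> : (\int[nu]_x f x = \int[nu]_x limn (fun n => (f_ n x)%:E))%E.
  by apply: eq_integral => x _; apply/esym/cvg_lim => //; exact: fT.
rewrite monotone_convergence//; first last.
- by move=> x _ m n mn; rewrite lee_fin; exact/lefP/nd_nnsfun_approx.
- by move=> n x _; rewrite lee_fin.
- by move=> n; exact/measurable_EFinP.
have -> : (\int[mu]_x (f x * (rho x)%:E) = \int[mu]_x limn (fun n => ((f_ n x)%:E * (rho x)%:E)))%E.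
  apply: eq_integral => x _; apply/esym/cvg_lim => //.
  by apply: cvgeZr => //; exact: fT.
rewrite [RHS]monotone_convergence//; first last.
- move=> x _ m n mn; apply: lee_wpmul2r; rewrite lee_fin//.
  exact/lefP/nd_nnsfun_approx.
- by move=> n x _; rewrite -EFinM lee_fin mulr_ge0.
- by move=> n; apply/measurable_EFinP; exact: measurable_funM.
congr (limn _); apply/funext => n.
under eq_integral do rewrite fimfunE -fsumEFin//.
rewrite [LHS]ge0_integral_fsum//; last 2 first.
- by move=> r; exact/measurable_EFinP/measurableT_comp.
- by move=> k x _; rewrite EFinM nnfun_muleindic_ge0.
under [RHS]eq_integral.
  move=> x xD; rewrite fimfunE -fsumEFin// ge0_mule_fsuml; last first.
    by move=> r; rewrite EFinM nnfun_muleindic_ge0.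
  over.
rewrite [RHS]ge0_integral_fsum//; last 2 first.
- by move=> r; apply/measurable_EFinP; apply: measurable_funM => //; do 2 apply/measurableT_comp => //.
- move=> k x _; apply: mule_ge0; last by rewrite lee_fin.
  by rewrite EFinM nnfun_muleindic_ge0.
apply: eq_fsbigr => r _.
rewrite integralZl_indic_nnsfun//= integral_indic//= setIT nuE//.
rewrite integral_mkcond.
have [r0|r0] := leP 0 r.
  rewrite -ge0_integralZl//.
  - apply: eq_integral => x _; rewrite patchE indicE.
    by case: ifPn => xr; rewrite ?mulr1 ?mulr0 ?mule0 ?mul0e.
  - by apply/(measurable_restrictT _ _).1 => //; apply: measurable_funTS; exact/measurable_EFinP.
  - by move=> x _; rewrite patchE; case: ifPn => // _; rewrite lee_fin.
rewrite preimage_nnfun0// integral0_eq; last by move=> x _; rewrite patchE in_set0.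
by rewrite mule0 integral0_eq// => x _; rewrite indic0 mulr0 mul0e.
Qed.

Lemma integral_density (f : T -> R) : measurable_fun setT f ->
  (\int[nu]_x (f x)%:E = \int[mu]_x (f x * rho x)%:E)%E.
Proof.
move=> mf; rewrite integralE [RHS]integralE.
have mE : measurable_fun setT (EFin \o f) by exact/measurable_EFinP.
congr (_ - _)%E; rewrite ge0_integral_density//.
- apply: eq_integral => x _; rewrite !funeposE -!EFin_max -EFinM.
  by rewrite maxr_pMl// mul0r.
- exact: measurable_funepos.
- apply: eq_integral => x _; rewrite !funenegE -!EFinN -!EFin_max -EFinM.
  by rewrite maxr_pMl// mul0r mulNr.
- exact: measurable_funeneg.
Qed.

Lemma integrable_density (f : T -> R) : measurable_fun setT f ->
  nu.-integrable setT (EFin \o f) <-> mu.-integrable setT (fun x => (f x * rho x)%:E).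
Proof.
move=> mf; have mE : measurable_fun setT (EFin \o f) by exact/measurable_EFinP.
have E : (\int[nu]_x `|(f x)%:E| = \int[mu]_x `|(f x * rho x)%:E|)%E.
  rewrite ge0_integral_density//; last exact: measurableT_comp.
  by apply: eq_integral => x _; rewrite /= -EFinM normrM (ger0_norm (rho0 x)).
split=> /integrableP[_ h]; apply/integrableP; split => //.
- by apply/measurable_EFinP; exact: measurable_funM.
- by rewrite -E.
- by rewrite E.
Qed.

End integral_density.

Section product_tests.
Context (R : realType) (n : nat).
Local Notation L := (@lebesgue_rV R n).
Implicit Types (phi : 'I_n -> R -> R).

Lemma measurable_prod_coord phi : (forall k, measurable_fun setT (phi k)) ->
  measurable_fun setT (fun y : 'rV[R]_n => \prod_k phi k (y ord0 k)).
Proof.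
move=> mphi; apply: measurable_prod => k _.
exact: (measurableT_comp (mphi k) (measurable_coord k)).
Qed.

Lemma smooth_measurable (f : R -> R) :
  (forall k, CkOn (fun _ : unit => 1 : R) setT k f) -> measurable_fun setT f.
Proof. by move=> sf; apply: continuous_measurable_fun; exact: smooth_continuous. Qed.

Lemma bump_ge0 (a b : R) m t : 0 <= bump a b m t.
Proof. by rewrite /bump /flat; case: ifPn => // _; rewrite expr0 mul1r expR_ge0. Qed.

Lemma bump_ndecr (a b t : R) : a < b -> {homo (fun m => bump a b m t) : m k / (m <= k)%N >-> m <= k}.
Proof.
move=> ab m k mk; have [/andP[ta tb]|h] := boolP (a < t < b); last first.
  by rewrite !bump_out.
have c0 : 0 < (t - a) * (b - t) by rewrite mulr_gt0// subr_gt0.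
have E i : bump a b i t = expR (- (i.+1%:R * ((t - a) * (b - t)))^-1).
  by rewrite /bump /flat mulr_gt0// expr0 mul1r.
rewrite !E ler_expR lerN2.
have p i : (0 : R) < i.+1%:R * ((t - a) * (b - t)) by rewrite mulr_gt0.
by rewrite lef_pV2 ?posrE ?p// ler_wpM2r ?(ltW c0)// ler_nat ltnS.
Qed.

Lemma box_prodE (a b : 'I_n -> R) y :
  \1_(box a b) y = \prod_k ((a k < y ord0 k < b k)%R%:R : R).
Proof.
rewrite indicE; case: (boolP (y \in box a b)) => yb.
  by rewrite big1// => k _; move: yb; rewrite inE => /(_ k) ->.
have /existsNP[k /negP/negbTE kE] : ~ box a b y by move=> h; move: yb; rewrite mem_set.
by rewrite (bigD1 k)//= kE mul0r.
Qed.

(** Products of bumps increase to the indicator of a box, so by monotone convergence nonnegative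
    product tests determine its measure. *)
Lemma box_measure_tests (m1 m2 : {measure set 'rV[R]_n -> \bar R}) :
  (forall phi, (forall k, smooth_compact (phi k)) -> (forall k t, 0 <= phi k t) ->
    (\int[m1]_y (\prod_k phi k (y ord0 k))%:E = \int[m2]_y (\prod_k phi k (y ord0 k))%:E)%E) ->
  forall a b, m1 (box a b) = m2 (box a b).
Proof.
move=> H a b.
have [/forallP ab|] := boolP [forall k, a k < b k]; last first.
  rewrite negb_forall => /existsP[k abk].
  suff -> : box a b = set0 by rewrite !measure0.
  rewrite -subset0 => y /(_ k) /andP[h1 h2].
  by move: abk; rewrite (lt_trans h1 h2).
pose F i (y : 'rV[R]_n) := (\prod_k bump (a k) (b k) i (y ord0 k))%:E.
have E (m : {measure set 'rV[R]_n -> \bar R}) :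
    m (box a b) = limn (fun i => \int[m]_y F i y)%E.
  rewrite -[in LHS](setIT (box a b)) -integral_indic//; last exact: measurable_box.
  rewrite -monotone_convergence//.
  - apply: eq_integral => y _; apply/esym/cvg_lim => //.
    rewrite box_prodE /F; apply: cvg_EFin; first exact: nearW.
    by apply: cvg_big => [|k _]; [exact: mul_continuous|exact: bump_cvg].
  - move=> i; apply/measurable_EFinP; apply: (@measurable_prod_coord (fun k => bump (a k) (b k) i)) => k.
    by apply: smooth_measurable; exact: smooth_bump.
  - by move=> i y _; rewrite lee_fin prodr_ge0// => k _; exact: bump_ge0.
  - move=> y _ i j ij; rewrite lee_fin ler_prod// => k _.
    by rewrite bump_ge0 bump_ndecr.
rewrite !E; congr (limn _); apply/funext => i; apply: (H (fun k => bump (a k) (b k) i)) => k.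
  exact: bump_smooth_compact.
exact: bump_ge0.
Qed.

Lemma prod_test_bounded phi : (forall k, smooth_compact (phi k)) ->
  exists C : R, forall y : 'rV[R]_n, `|\prod_k phi k (y ord0 k)| <= C.
Proof.
move=> sc; have /choice[C CE] k := smooth_compact_bounded (sc k).
exists (\prod_k C k) => y; rewrite normr_prod ler_prod// => k _.
by rewrite normr_ge0 CE.
Qed.

Lemma prod_test_measurable phi : (forall k, smooth_compact (phi k)) ->
  measurable_fun setT (fun y : 'rV[R]_n => \prod_k phi k (y ord0 k)).
Proof.
by move=> sc; apply: measurable_prod_coord => k; apply: smooth_measurable; have [] := sc k.
Qed.

Lemma intg_bounded (f g : 'rV[R]_n -> R) (C : R) : L.-integrable setT (EFin \o f) ->
  measurable_fun setT g -> (forall y, `|g y| <= C) ->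
  L.-integrable setT (EFin \o (fun y => f y * g y)).
Proof.
move=> If mg gC; have mf := integrable_measurable If.
apply: (@le_integrable _ _ _ L setT _ _ (fun y => (C * `|f y|)%:E)) => //.
- by apply/measurable_EFinP; exact: measurable_funM.
- move=> y _ /=; rewrite lee_fin normrM (ger0_norm (mulr_ge0 _ _))//.
    by rewrite mulrC ler_wpM2r.
  exact: le_trans (normr_ge0 (g y)) _.
- by under eq_fun do rewrite EFinM; apply: integrableZl => //; exact: (integrable_abse If).
Qed.

(** Fundamental lemma of the calculus of variations: the finite measures with densities [fp] and
    [fn] agree on product tests, hence on boxes, hence on all measurable sets, so the two densities
    coincide. *)
Lemma prod_tests_ae0 (f : 'rV[R]_n -> R) : L.-integrable setT (EFin \o f) ->
  (forall phi, (forall k, smooth_compact (phi k)) ->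
    \int[L]_y (f y * \prod_k phi k (y ord0 k)) = 0) ->
  {ae L, forall y, f y = 0}.
Proof.
move=> If H; have mf := integrable_measurable If.
pose fp y := Num.max (f y) 0; pose fn y := Num.max (- f y) 0.
have mfp : measurable_fun setT fp by apply: measurable_maxr.
have mfn : measurable_fun setT fn by apply: measurable_maxr => //; exact: measurableT_comp.
have fp0 y : 0 <= fp y by rewrite le_max lexx orbT.
have fn0 y : 0 <= fn y by rewrite le_max lexx orbT.
have fE y : f y = fp y - fn y.
  by rewrite /fp /fn; case: (leP 0 (f y)) => h; rewrite ?(max_l h); [rewrite max_r ?subr0// oppr_le0|rewrite max_l ?sub0r ?opprK// oppr_ge0 ltW].
have fle y : fp y <= `|f y| /\ fn y <= `|f y|.
  by rewrite !ge_max normr_ge0 ler_norm -normrN ler_norm.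
have Ip : L.-integrable setT (EFin \o fp).
  apply: (@le_integrable _ _ _ L setT _ _ (EFin \o f)) => //; first exact/measurable_EFinP.
  by move=> y _ /=; rewrite lee_fin (ger0_norm (fp0 y)); have [] := fle y.
have In : L.-integrable setT (EFin \o fn).
  apply: (@le_integrable _ _ _ L setT _ _ (EFin \o f)) => //; first exact/measurable_EFinP.
  by move=> y _ /=; rewrite lee_fin (ger0_norm (fn0 y)); have [] := fle y.
pose mp : {measure set _ -> \bar R} := density L mfp fp0.
pose mn : {measure set _ -> \bar R} := density L mfn fn0.
have boxE a b : mp (box a b) = mn (box a b).
  apply: box_measure_tests => phi sc phi0.
  have mphi := prod_test_measurable sc.
  have [C phiC] := prod_test_bounded sc.
  rewrite (@integral_density _ _ _ L mp fp mfp)// (@integral_density _ _ _ L mn fn mfn)//.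
  have Jp := intg_bounded Ip mphi phiC; have Jn := intg_bounded In mphi phiC.
  under eq_integral do rewrite mulrC.
  under [RHS]eq_integral do rewrite mulrC.
  rewrite -(EFin_Rintegral Jp) -(EFin_Rintegral Jn); congr EFin.
  apply/eqP; rewrite -subr_eq0 -RintegralB//; apply/eqP.
  rewrite -(H phi sc); congr (Rintegral _ _ _); apply/funext => y.
  by rewrite fE mulrBl.
have finp a b : (mp (box a b) < +oo)%E.
  apply: (@le_lt_trans _ _ (\int[L]_y (fp y)%:E)%E).
    by apply: ge0_subset_integral => //; [exact: measurable_box|exact/measurable_EFinP|move=> y _; rewrite lee_fin].
  by rewrite -(EFin_Rintegral Ip) ltry.
have mE := measure_box_unique boxE finp.
have : ae_eq L setT (EFin \o fp) (EFin \o fn).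
  by apply: integral_ae_eq => // [|A _ mA]; [exact/measurable_EFinP|exact: mE].
apply: filterS => y /(_ I) [h]; by rewrite fE h subrr.
Qed.

End product_tests.

(** * Weak partial derivatives *)

Section swap.
Context (R : realType) (n : nat).
Local Notation lam := (@lebesgue_measure R).
Local Notation L := (@lebesgue_rV R).
Local Notation intgL f := ((L n.+1).-integrable setT (EFin \o f)).

Lemma pushforward_measure d d' (T1 : measurableType d) (T2 : measurableType d')
    (m : {measure set T1 -> \bar R}) (f : T1 -> T2) : measurable_fun setT f ->
  exists m' : {measure set T2 -> \bar R}, forall A, m' A = m (f @^-1` A).
Proof.
move=> mf.
by exists (measure_function_pushforward__canonical__measure_function_Measure m mf).
Qed.

(** The construction of [L] as an iterated product singles out the first coordinate; exchanging
    coordinates [0] and [j], which preserves [L], reduces every direction to that one. *)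
Definition swapc (j : 'I_n.+1) (y : 'rV[R]_n.+1) : 'rV[R]_n.+1 :=
  \row_k y ord0 (tperm ord0 j k).

Lemma swapcK j : involutive (swapc j).
Proof. by move=> y; apply/rowP => k; rewrite !mxE tpermK. Qed.

Lemma measurable_swapc j : measurable_fun setT (swapc j).
Proof.
apply: measurable_fun_rVP => k.
by under eq_fun do rewrite mxE; exact: measurable_coord.
Qed.

Lemma swapc_box j (a b : 'I_n.+1 -> R) :
  swapc j @^-1` box a b = box (a \o tperm ord0 j) (b \o tperm ord0 j).
Proof.
apply/seteqP; split => y h k; have := h (tperm ord0 j k).
  by rewrite mxE tpermK.
by rewrite /= tpermK mxE.
Qed.

Lemma lebesgue_rV_swapc j A : measurable A -> L n.+1 (swapc j @^-1` A) = L n.+1 A.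
Proof.
have [m' m'E] := pushforward_measure (L n.+1) (measurable_swapc j).
move=> mA; rewrite -m'E; apply: measure_box_unique => // [a b|a b]; last first.
  by rewrite m'E swapc_box; exact: lebesgue_rV_box_fin.
rewrite m'E swapc_box.
apply: etrans (lebesgue_rV_box _ _) _; rewrite [RHS](lebesgue_rV_box a b).
by rewrite [in RHS](reindex_inj (@perm_inj _ (tperm ord0 j))).
Qed.

Lemma ge0_integral_swapc j (f : 'rV[R]_n.+1 -> \bar R) : measurable_fun setT f ->
  (forall y, 0 <= f y)%E -> (\int[L n.+1]_y f (swapc j y) = \int[L n.+1]_y f y)%E.
Proof.
move=> mf f0.
have := @ge0_integral_pushforward _ _ _ _ R _ (measurable_swapc j) (L n.+1) setT f
  measurableT mf (fun y _ => f0 y).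
rewrite preimage_setT => <-.
apply: eq_measure_integral; first exact: measurable_swapc.
by move=> ? A mA _; exact: lebesgue_rV_swapc.
Qed.

Lemma intg_swapc j (f : 'rV[R]_n.+1 -> R) : intgL f -> intgL (fun y => f (swapc j y)).
Proof.
move=> fi; have mf := integrable_measurable fi.
apply/integrableP; split.
  by apply/measurable_EFinP; exact: (measurableT_comp mf (measurable_swapc j)).
rewrite (@ge0_integral_swapc j (fun y => `|(f y)%:E|)%E)//.
  by have /integrableP[] := fi.
by apply: measurableT_comp => //; exact/measurable_EFinP.
Qed.

Lemma Rintegral_swapc j (f : 'rV[R]_n.+1 -> R) : measurable_fun setT f ->
  \int[L n.+1]_y f (swapc j y) = \int[L n.+1]_y f y.
Proof.
move=> mf; have mE : measurable_fun setT (EFin \o f) by exact/measurable_EFinP.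
rewrite /Rintegral integralE [in RHS]integralE; congr (fine (_ - _)%E).
  rewrite -(@ge0_integral_swapc j _ (measurable_funepos mE))//.
  by apply: eq_integral => y _; rewrite !funeposE.
rewrite -(@ge0_integral_swapc j _ (measurable_funeneg mE))//.
by apply: eq_integral => y _; rewrite !funenegE.
Qed.

Lemma ae_swapc j (P : 'rV[R]_n.+1 -> Prop) :
  {ae L n.+1, forall y, P y} -> {ae L n.+1, forall y, P (swapc j y)}.
Proof.
move=> [A [mA A0 PA]]; exists (swapc j @^-1` A); split.
- by rewrite -[X in measurable X]setTI; exact: measurable_swapc.
- by rewrite -[RHS]A0; exact: lebesgue_rV_swapc.
- by move=> y /= nP; exact: PA.
Qed.

Lemma swapc_upd j (y : 'rV[R]_n.+1) t : swapc j (upd y ord0 t) = upd (swapc j y) j t.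
Proof.
apply/rowP => k; rewrite !mxE; congr (if _ then _ else _).
by rewrite -[X in _ == X](tpermR ord0 j) (inj_eq perm_inj).
Qed.

Lemma partial_derivative_swapc j (W D : 'rV[R]_n.+1 -> R) :
  partial_derivative (fun y => W (swapc j y)) ord0 (fun y => D (swapc j y)) ->
  partial_derivative W j D.
Proof.
move=> H; apply: (ae_imp (ae_swapc j H)) => y.
rewrite swapcK => ->; rewrite mxE tpermL; congr (prim _ _).
by apply/funext => t; rewrite swapc_upd swapcK.
Qed.

End swap.

Section weak_partial.
Context (R : realType) (n : nat).
Local Notation L := (@lebesgue_rV R).
Implicit Types (phi : 'I_n -> R -> R) (u v : 'rV[R]_n -> R).

Definition prodf phi (y : 'rV[R]_n) := \prod_k phi k (y ord0 k).

Definition der_at (j : 'I_n) phi : 'I_n -> R -> R :=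
  fun k => if k == j then (fun t => 'D_1 (phi k) t) else phi k.

(** Products of one-variable functions suffice as tests: they determine an integrable function
    almost everywhere by [prod_tests_ae0], and differentiation touches a single factor. *)
Definition weak_partial u j v := forall phi, (forall k, smooth_compact (phi k)) ->
  \int[L n]_y (u y * prodf (der_at j phi) y) = - \int[L n]_y (v y * prodf phi y).

Lemma der_at_smooth_compact j phi : (forall k, smooth_compact (phi k)) ->
  forall k, smooth_compact (der_at j phi k).
Proof. by move=> sc k; rewrite /der_at; case: ifP => _ //; exact: smooth_compact_derive. Qed.

End weak_partial.

Section weak_swap.
Context (R : realType) (n : nat).
Local Notation L := (@lebesgue_rV R).

Lemma prodf_swapc j (phi : 'I_n.+1 -> R -> R) y :
  prodf phi (swapc j y) = prodf (fun k => phi (tperm ord0 j k)) y.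
Proof.
rewrite /prodf (reindex_inj (@perm_inj _ (tperm ord0 j))).
by apply: eq_bigr => k _; rewrite mxE tpermK.
Qed.

Lemma weak_partial_swapc j (u v : 'rV[R]_n.+1 -> R) :
  measurable_fun setT u -> measurable_fun setT v ->
  weak_partial u j v ->
  weak_partial (fun y => u (swapc j y)) ord0 (fun y => v (swapc j y)).
Proof.
move=> mu mv H phi sc.
pose psi k := phi (tperm ord0 j k).
have spsi k : smooth_compact (psi k) by exact: sc.
have E (f : 'I_n.+1 -> R -> R) y : prodf f y = prodf (fun k => f (tperm ord0 j k)) (swapc j y).
  by rewrite -[in LHS](swapcK j y) prodf_swapc.
under eq_Rintegral do rewrite E.
under [in RHS]eq_Rintegral do rewrite E.
rewrite (@Rintegral_swapc _ _ j (fun y => u y * prodf _ y)); last first.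
  apply: measurable_funM => //; apply: prod_test_measurable => k.
  exact: der_at_smooth_compact.
rewrite (@Rintegral_swapc _ _ j (fun y => v y * prodf _ y)); last first.
  by apply: measurable_funM => //; exact: prod_test_measurable.
rewrite -(H _ spsi); congr Rintegral; apply/funext => y; congr (_ * prodf _ _).
apply/funext => k; rewrite /der_at -[X in _ == X](tpermR ord0 j) (inj_eq perm_inj).
by case: eqP => [->|]//; rewrite /psi tpermR.
Qed.

End weak_swap.

Section weak_lines.
Context (R : realType).
Local Notation lam := (@lebesgue_measure R).
Local Notation L := (@lebesgue_rV R).
Local Notation intg f := (lam.-integrable setT (EFin \o f)).
Local Notation intgL n f := ((L n).-integrable setT (EFin \o f)).

Lemma prim_bounded (f : R -> R) x : intg f -> `|prim f x| <= \int[lam]_r `|f r|.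
Proof.
move=> fi; rewrite primE.
apply: le_trans (le_normr_Rintegral _ _) _ => //; first exact: integrable_prim.
apply: le_Rintegral => //.
- exact: (integrable_norm (integrable_prim x fi)).
- exact: (integrable_norm fi).
by move=> t _; rewrite /cutl; case: (t <= x); rewrite ?mul1r// mul0r normr0.
Qed.

Lemma Rintegral_ge_cst (f : R -> R) (r : R) : intg f ->
  \int[lam]_t (f t * (r <= t)%R%:R) = \int[lam]_t f t - prim f r.
Proof.
move=> fi; have Pi := integrable_prim r fi.
rewrite primE -RintegralB//; apply: ae_eq_Rintegral.
- apply: measurable_funM; first exact: integrable_measurable fi.
  by apply: measurable_ler_ind => //; exact: measurable_cst.
- by apply: measurable_funB; [exact: integrable_measurable fi|exact: integrable_measurable Pi].
apply: (ae_imp (ae_neq r)) => t tr; rewrite /cutl.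
case: (ltgtP t r) tr => // tr _.
  by rewrite mul1r subrr mulr0.
by rewrite mul0r subr0 mulr1.
Qed.

Lemma intg_mul_prim (f g : R -> R) : intg f -> intg g -> intg (fun r => g r * prim f r).
Proof.
move=> fi gi.
apply: (@le_intg _ _ _ lam _ (fun r => (\int[lam]_r `|f r|) * `|g r|)).
- apply: measurable_funM; first exact: integrable_measurable gi.
  by apply: continuous_measurable_fun; exact: continuous_prim.
- by move=> r; rewrite normrM mulrC ler_wpM2r// prim_bounded.
- by apply: intgZ; exact: (integrable_norm gi).
Qed.

(** The diagonal cuts the square []-oo, x]^2] into two triangles on which [f(r) f(t)] has the same
    integral; [prim_swap] exchanges the order on one of them. *)
Lemma sqr_prim (f : R -> R) x : intg f ->
  prim f x ^+ 2 = prim (fun r => 2 * f r * prim f r) x.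
Proof.
move=> fi; have Ei : intg (cutl f x) by exact: integrable_prim.
have Ii := intg_mul_prim fi Ei.
have H := prim_swap fi Ei.
have E1 : prim (fun r => 2 * f r * prim f r) x = 2 * \int[lam]_r (cutl f x r * prim f r).
  by rewrite primE -RintegralZ//; apply: eq_Rintegral => r _; rewrite /cutl; ring.
have E2 : \int[lam]_r (f r * \int[lam]_t (cutl f x t * (r <= t)%R%:R)) =
    prim f x * prim f x - \int[lam]_r (cutl f x r * prim f r).
  rewrite [X in X * _]primE mulrC -RintegralZ// -RintegralB//; last exact: intgZ.
  apply: eq_Rintegral => r _; rewrite Rintegral_ge_cst// -primE.
  have [rx|xr] := leP r x.
    have -> : prim (cutl f x) r = prim f r.
      rewrite !primE; apply: eq_Rintegral => t _; rewrite /cutl.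
      by case: (leP t r) => [tr|]; rewrite ?mul0r// (le_trans tr rx) !mul1r.
    by rewrite /cutl rx !mul1r mulrBr [prim f x * _]mulrC.
  have -> : prim (cutl f x) r = prim f x.
    rewrite !primE; apply: eq_Rintegral => t _; rewrite /cutl.
    case: (leP t x) => [tx|]; rewrite ?mul0r ?mulr0// (le_trans tx (ltW xr)) !mul1r//.
  by rewrite /cutl leNgt xr !mul0r mulr0 !subrr mulr0.
rewrite E1 expr2; lra.
Qed.

End weak_lines.

Lemma ae_snd d1 d2 (T1 : measurableType d1) (T2 : measurableType d2) (R : realType)
    (m1 : {sigma_finite_measure set T1 -> \bar R})
    (m2 : {sigma_finite_measure set T2 -> \bar R}) (P : T2 -> Prop) :
  {ae m2, forall y, P y} -> {ae (m1 \x m2)%E, forall p, P p.2}.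
Proof.
move=> [A [mA A0 PA]]; exists (setT `*` A); split.
- exact: measurableX.
- by rewrite product_measure1E// A0 mule0.
- by move=> p /= nP; split => //; exact: PA.
Qed.

Section weak_first.
Context (R : realType) (n : nat).
Local Notation lam := (@lebesgue_measure R).
Local Notation L := (@lebesgue_rV R).
Local Notation intg f := (lam.-integrable setT (EFin \o f)).
Local Notation intgL n f := ((L n).-integrable setT (EFin \o f)).
Implicit Types (theta f : R -> R) (phi : 'I_n -> R -> R).

Definition fcons theta phi (k : 'I_n.+1) : R -> R :=
  if unlift ord0 k is Some i then phi i else theta.

Definition prod_tail phi (y : 'rV[R]_n.+1) := \prod_k phi k (y ord0 (lift ord0 k)).

Lemma prodf_fcons theta phi y :
  prodf (fcons theta phi) y = theta (y ord0 ord0) * prod_tail phi y.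
Proof.
rewrite /prodf big_ord_recl /fcons unlift_none; congr (_ * _).
by apply: eq_bigr => k _; rewrite liftK.
Qed.

Lemma der_at_fcons theta phi :
  der_at ord0 (fcons theta phi) = fcons (fun t => 'D_1 theta t) phi.
Proof.
apply/funext => k; rewrite /der_at /fcons; case: unliftP => [i ->|->].
  by rewrite eq_sym (negbTE (neq_lift _ _)).
by rewrite eqxx.
Qed.

Lemma fcons_eta (psi : 'I_n.+1 -> R -> R) : psi = fcons (psi ord0) (fun k => psi (lift ord0 k)).
Proof. by apply/funext => k; rewrite /fcons; case: unliftP => [i ->|->]. Qed.

Lemma fcons_smooth_compact theta phi : smooth_compact theta ->
  (forall k, smooth_compact (phi k)) -> forall k, smooth_compact (fcons theta phi k).
Proof. by move=> st sp k; rewrite /fcons; case: unliftP. Qed.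

Lemma prod_tail_cons phi p : prod_tail phi (rV_cons p) = prodf phi p.2.
Proof. by apply: eq_bigr => k _; rewrite rV_consS. Qed.

Lemma measurable_prod_tail phi : (forall k, smooth_compact (phi k)) ->
  measurable_fun setT (prod_tail phi).
Proof.
move=> sp; apply: measurable_prod => k _.
apply: (measurableT_comp (smooth_measurable (sp k).1)).
exact: measurable_coord.
Qed.

Lemma prod_tail_bounded phi : (forall k, smooth_compact (phi k)) ->
  exists C, forall y, `|prod_tail phi y| <= C.
Proof.
move=> sp; have [C HC] := prod_test_bounded sp; exists C => y.
by rewrite -(rV_unconsK y) prod_tail_cons; exact: HC.
Qed.

Lemma measurable_fst_coord theta : measurable_fun setT theta ->
  measurable_fun setT (fun y : 'rV[R]_n.+1 => theta (y ord0 ord0)).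
Proof. by move=> mt; apply: (measurableT_comp mt); exact: measurable_coord. Qed.

Section primitive_in_first.
Context (v : 'rV[R]_n.+1 -> R).
Hypothesis vi : intgL n.+1 v.

Definition prim0 (y : 'rV[R]_n.+1) := prim (fun r => v (upd y ord0 r)) (y ord0 ord0).

Lemma prim0_cons t y : prim0 (rV_cons (t, y)) = prim (fun r => v (rV_cons (r, y))) t.
Proof.
rewrite /prim0 rV_cons0; congr (prim _ _).
by apply/funext => r; rewrite upd_cons0.
Qed.

Lemma measurable_upd (j : 'I_n.+1) :
  measurable_fun setT (fun p : 'rV[R]_n.+1 * measurableTypeR R => upd p.1 j p.2).
Proof.
apply: measurable_fun_rVP => k; under eq_fun do rewrite mxE.
case: (k == j); first exact: measurable_snd.
by apply: (measurableT_comp (measurable_coord k)); exact: measurable_fst.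
Qed.

Lemma measurable_prim0 : measurable_fun setT prim0.
Proof.
have -> : prim0 = fun y => \int[lam]_r ((r <= y ord0 ord0)%R%:R * v (upd y ord0 r)).
  by apply/funext => y; rewrite /prim0 primE.
apply: (@measurable_Rintegral1 _ _ 'rV[R]_n.+1 (measurableTypeR R) R lam
  (fun p => (p.2 <= p.1 ord0 ord0)%R%:R * v (upd p.1 ord0 p.2))).
apply: measurable_funM.
  apply: measurable_ler_ind; first exact: measurable_snd.
  by apply: (measurableT_comp (measurable_coord ord0)); exact: measurable_fst.
apply: (measurableT_comp (integrable_measurable vi)); exact: measurable_upd.
Qed.

Let g y := \int[lam]_r `|v (rV_cons (r, y))|.

Let gi : intgL n g.
Proof.
have H := integrable_norm (intg_cons vi).
exact: (@integrable_Rintegral2 _ _ _ _ _ lam (L n) _ H).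
Qed.

Lemma ae_line : {ae L n, forall y, intg (fun r => v (rV_cons (r, y)))}.
Proof. exact: (@ae_integrable2 _ _ _ _ _ lam (L n) _ (intg_cons vi)). Qed.

Lemma prim0_intg theta : measurable_fun setT theta -> intg theta ->
  intgL n.+1 (fun y => prim0 y * theta (y ord0 ord0)).
Proof.
move=> mt ti.
have mpt : measurable_fun setT (fun y => prim0 y * theta (y ord0 ord0)).
  by apply: measurable_funM; [exact: measurable_prim0|exact: measurable_fst_coord].
apply: cons_intg => //.
apply: (@ae_le_intg _ _ _ (lam \x L n)%E _ (fun p => `|theta p.1| * g p.2)).
- exact: measurable_rV_comp mpt.
- apply: (ae_imp (@ae_snd _ _ _ _ _ lam (L n) _ ae_line)) => -[t y] /= H.
  by rewrite prim0_cons rV_cons0 normrM mulrC ler_wpM2l// prim_bounded.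
- apply: (@integrable_prodM _ _ _ _ _ lam (L n) (fun t => `|theta t|) g _ gi).
  exact: (integrable_norm ti).
Qed.

(** Integration by parts in the first variable, [alpha r] being the integral of [theta] over [[r,
    +oo[]. The weak derivative yields the same right-hand side for [u], so [u] and [prim0 v] have
    equal integrals against tests. *)
Lemma Rintegral_prim0 theta phi : smooth_compact theta -> (forall k, smooth_compact (phi k)) ->
  let alpha r := \int[lam]_t (theta t * (r <= t)%R%:R) in
  \int[L n.+1]_y (prim0 y * (theta (y ord0 ord0) * prod_tail phi y)) =
  \int[L n.+1]_y (v y * (alpha (y ord0 ord0) * prod_tail phi y)).
Proof.
move=> st sp alpha; have ti := smooth_compact_intg st.
have mt := integrable_measurable ti.
have [C HC] := prod_tail_bounded sp.
have mtail := measurable_prod_tail sp.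
have I1 : intgL n.+1 (fun y => prim0 y * (theta (y ord0 ord0) * prod_tail phi y)).
  under [X in EFin \o X]eq_fun do rewrite mulrA.
  by apply: (@intg_bounded _ _ _ _ C) => //; exact: prim0_intg.
have aE r : alpha r = \int[lam]_t theta t - prim theta r by exact: Rintegral_ge_cst.
have I2 : intgL n.+1 (fun y => v y * (alpha (y ord0 ord0) * prod_tail phi y)).
  apply: (@intg_bounded _ _ _ _ ((`|\int[lam]_t theta t| + \int[lam]_t `|theta t|) * C)) => //.
    apply: measurable_funM => //; apply: measurable_fst_coord.
    apply: continuous_measurable_fun; rewrite (funext aE) => t.
    by apply: (@cvgB _ R^o); [exact: cvg_cst|exact: continuous_prim].
  move=> y; rewrite normrM ler_pM// aE (le_trans (ler_normB _ _))// lerD2l.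
  exact: prim_bounded.
rewrite !Rintegral_cons//.
rewrite (@Rfubini2 _ _ _ _ _ lam (L n) _ (intg_cons I1)).
rewrite (@Rfubini2 _ _ _ _ _ lam (L n) _ (intg_cons I2)).
apply: ae_eq_Rintegral.
- apply: (@measurable_Rintegral2 _ _ _ _ _ lam (fun p => _)).
  exact: integrable_measurable (intg_cons I1).
- apply: (@measurable_Rintegral2 _ _ _ _ _ lam (fun p => _)).
  exact: integrable_measurable (intg_cons I2).
apply: (ae_imp ae_line) => y H.
have Pi := intg_mul_prim H ti.
under eq_Rintegral do rewrite prim0_cons rV_cons0 prod_tail_cons mulrA mulrC [prim _ _ * _]mulrC /=.
under [RHS]eq_Rintegral do rewrite rV_cons0 prod_tail_cons mulrA mulrC /=.
rewrite !RintegralZ//; first by congr (_ * _); exact: prim_swap.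
under [X in EFin \o X]eq_fun do rewrite aE mulrBr [_ * prim _ _]mulrC.
apply: intgB; first by under [X in EFin \o X]eq_fun do rewrite mulrC; exact: intgZ.
by under [X in EFin \o X]eq_fun do rewrite mulrC; exact: intg_mul_prim.
Qed.

End primitive_in_first.

(* Tested against cut_m(y_0) alpha(y_0), where alpha is the primitive of theta
   vanishing at +oo, the weak identity reads as follows when m tends to oo. *)
Lemma weak_partial_prim0 (u v : 'rV[R]_n.+1 -> R) theta phi :
  intgL n.+1 u -> intgL n.+1 v -> weak_partial u ord0 v ->
  smooth_compact theta -> (forall k, smooth_compact (phi k)) ->
  let alpha r := \int[lam]_t (theta t * (r <= t)%R%:R) in
  \int[L n.+1]_y (u y * (theta (y ord0 ord0) * prod_tail phi y)) =
  \int[L n.+1]_y (v y * (alpha (y ord0 ord0) * prod_tail phi y)).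
Proof.
move=> ui vi H st sp alpha; have ti := smooth_compact_intg st.
have mu := integrable_measurable ui; have mv := integrable_measurable vi.
have mNt : measurable_fun setT (fun t => - theta t).
  under eq_fun do rewrite -mulN1r; apply: measurable_funM => //; exact: integrable_measurable ti.
have [C HC] := prod_tail_bounded sp.
have C0 : 0 <= C by exact: le_trans (normr_ge0 _) (HC 0).
have [T HT] := smooth_compact_bounded st.
have [c [c0 dcC dc0]] := cut_derive R.
have mtail := measurable_prod_tail sp.
have aE : alpha = fun r => \int[lam]_t theta t - prim theta r.
  by apply/funext => r; exact: Rintegral_ge_cst.
have salpha : forall k, CkOn (fun _ : unit => 1 : R) setT k alpha.
  move=> k; rewrite aE; apply: CkOnB; [exact: openT|exact: CkOn_cst openT|exact: smooth_prim].
pose A := `|\int[lam]_t theta t| + \int[lam]_t `|theta t|.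
have alphaA r : `|alpha r| <= A.
  by rewrite aE (le_trans (ler_normB _ _))// lerD2l prim_bounded.
have A0 : 0 <= A by exact: le_trans (normr_ge0 _) (alphaA 0).
have dalpha (r : R) : 'D_1 alpha r = - theta r.
  have d1 : is_derive r 1 (prim theta) (theta r).
    by apply: is_derive_prim => //; exact: (smooth_continuous st.1).
  rewrite aE; have d2 : is_derive r 1 (fun r => \int[lam]_t theta t - prim theta r) (0 - theta r).
    by apply: is_deriveB.
  by rewrite (@derive_val _ _ _ _ _ _ _ d2) sub0r.
pose f m t := cut m t * alpha t.
have sf m : smooth_compact (f m) by apply: smooth_compactM => //; exact: (cut_smooth_compact R m).
have df m t : 'D_1 (f m) t = 'D_1 (cut m) t * alpha t - cut m t * theta t.
  have d1 : is_derive t 1 (cut m) ('D_1 (cut m) t).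
    exact: smooth_is_derive (cut_smooth_compact R m).1 _.
  have d2 := smooth_is_derive salpha t.
  have d3 := is_deriveM d1 d2.
  rewrite (@derive_val _ _ _ _ _ _ _ d3) dalpha /GRing.scale/=; ring.
have Hm m : \int[L n.+1]_y (u y * ('D_1 (f m) (y ord0 ord0) * prod_tail phi y)) =
    - \int[L n.+1]_y (v y * (f m (y ord0 ord0) * prod_tail phi y)).
  have := H _ (fcons_smooth_compact (sf m) sp).
  under eq_Rintegral do rewrite der_at_fcons prodf_fcons.
  by under [in RHS]eq_Rintegral do rewrite prodf_fcons.
have l1 : \int[L n.+1]_y (u y * ('D_1 (f m) (y ord0 ord0) * prod_tail phi y)) @[m --> \oo] -->
    \int[L n.+1]_y (u y * (- theta (y ord0 ord0) * prod_tail phi y)).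
  apply: (@dominated_Rintegral _ _ _ (L n.+1) _ _ (fun y => ((c * A + T) * C) * `|u y|)).
  - move=> m; apply: measurable_funM => //; apply: measurable_funM => //.
    apply: (@measurable_fst_coord (fun t => 'D_1 (f m) t)); apply: smooth_measurable; exact: smooth_derive (sf m).1.
  - apply: measurable_funM => //; apply: measurable_funM => //.
    apply: (@measurable_fst_coord (fun t => - theta t)); exact: mNt.
  - apply: aeW => y; apply: (@cvgM R); first exact: cvg_cst.
    apply: (@cvgM R); last exact: cvg_cst.
    rewrite (_ : - theta (y ord0 ord0) = 0 * alpha (y ord0 ord0) - 1 * theta (y ord0 ord0)); last by ring.
    under eq_fun do rewrite df.
    apply: (@cvgB _ R^o); first by apply: (@cvgM R); [exact: dc0|exact: cvg_cst].
    by apply: (@cvgM R); [exact: cut_cvg|exact: cvg_cst].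
  - by apply: intgZ; exact: (integrable_norm ui).
  - move=> m y; rewrite normrM mulrC ler_wpM2r// normrM; apply: ler_pM => //.
    rewrite df (le_trans (ler_normB _ _))// lerD// normrM; first by rewrite ler_pM.
    have /andP[h0 h1] := cut01 m (y ord0 ord0).
    by rewrite (ger0_norm h0) -[leRHS]mul1r ler_pM.
have l2 : \int[L n.+1]_y (v y * (f m (y ord0 ord0) * prod_tail phi y)) @[m --> \oo] -->
    \int[L n.+1]_y (v y * (alpha (y ord0 ord0) * prod_tail phi y)).
  apply: (@dominated_Rintegral _ _ _ (L n.+1) _ _ (fun y => (A * C) * `|v y|)).
  - move=> m; apply: measurable_funM => //; apply: measurable_funM => //.
    apply: (@measurable_fst_coord (f m)); exact: smooth_measurable (sf m).1.
  - apply: measurable_funM => //; apply: measurable_funM => //.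
    apply: (@measurable_fst_coord alpha); exact: smooth_measurable.
  - apply: aeW => y; apply: (@cvgM R); first exact: cvg_cst.
    apply: (@cvgM R); last exact: cvg_cst.
    rewrite -(mul1r (alpha (y ord0 ord0))).
    by apply: (@cvgM R); [exact: cut_cvg|exact: cvg_cst].
  - by apply: intgZ; exact: (integrable_norm vi).
  - move=> m y; rewrite normrM mulrC ler_wpM2r// normrM ler_pM// normrM.
    have /andP[h0 h1] := cut01 m (y ord0 ord0).
    by rewrite (ger0_norm h0) -[leRHS]mul1r ler_pM.
have E : - (\int[L n.+1]_y (u y * (- theta (y ord0 ord0) * prod_tail phi y))) =
    \int[L n.+1]_y (v y * (alpha (y ord0 ord0) * prod_tail phi y)).
  apply: (cvg_unique (@norm_hausdorff _ R^o) (@cvgN _ R^o _ _ _ _ _ l1)).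
  apply: cvg_trans l2; apply: near_eq_cvg; apply: nearW => m.
  by rewrite /= fctE Hm opprK.
rewrite -E -mulN1r -RintegralZ; first by apply: eq_Rintegral => y _; ring.
apply: (@intg_bounded _ _ _ _ (T * C)) => //.
  apply: measurable_funM => //; apply: (@measurable_fst_coord (fun t => - theta t)); exact: mNt.
by move=> y; rewrite normrM normrN ler_pM.
Qed.

(** [u] and [prim0 v] agree against tests, but along the first axis [prim0 v] is merely bounded and
    may fail to be integrable. Multiplying by [cut m] of the first coordinate restores
    integrability, and this factor is positive for some [m]. *)
Lemma weak_partial_ae0 (u v : 'rV[R]_n.+1 -> R) :
  intgL n.+1 u -> intgL n.+1 v -> weak_partial u ord0 v -> partial_derivative u ord0 v.
Proof.
move=> ui vi H.
have mu := integrable_measurable ui.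
have ci m : intg (cut m) by exact: smooth_compact_intg (cut_smooth_compact R m).
have mc m : measurable_fun setT (cut m : R -> R) by exact: integrable_measurable (ci m).
have cut_le1 m t : `|cut m t| <= 1 :> R.
  by have /andP[h0 h1] := cut01 m t; rewrite ger0_norm.
have I1 m : intgL n.+1 (fun y => u y * cut m (y ord0 ord0)).
  by apply: (@intg_bounded _ _ _ _ 1) => //; exact: measurable_fst_coord.
have I2 m : intgL n.+1 (fun y => prim0 v y * cut m (y ord0 ord0)) by exact: prim0_intg.
have Z m : {ae L n.+1, forall y, u y * cut m (y ord0 ord0) - prim0 v y * cut m (y ord0 ord0) = 0}.
  apply: prod_tests_ae0; first exact: intgB.
  move=> psi spsi; rewrite (fcons_eta psi).
  set phi := fun k => psi (lift ord0 k); pose theta t := cut m t * psi ord0 t.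
  have sp k : smooth_compact (phi k) by exact: spsi.
  have st : smooth_compact theta.
    by apply: smooth_compactM; [exact: cut_smooth_compact|exact: (spsi ord0).1].
  have [C HC] := prod_test_bounded spsi; have mpsi := prod_test_measurable spsi.
  have E (w : 'rV[R]_n.+1 -> R) (y : 'rV[R]_n.+1) : w y * cut m (y ord0 ord0) * prodf (fcons (psi ord0) phi) y =
      w y * (theta (y ord0 ord0) * prod_tail phi y).
    by rewrite prodf_fcons /theta; ring.
  under eq_Rintegral do rewrite mulrBl -/(prodf _ _) !E.
  rewrite RintegralB//; last 2 first.
  - under [X in EFin \o X]eq_fun do rewrite -E.
    by rewrite -fcons_eta; apply: (@intg_bounded _ _ _ _ C).
  - under [X in EFin \o X]eq_fun do rewrite -E.
    by rewrite -fcons_eta; apply: (@intg_bounded _ _ _ _ C).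
  by rewrite (weak_partial_prim0 ui vi H st sp) (Rintegral_prim0 vi st sp) subrr.
have Z' : {ae L n.+1, forall y, forall m, u y * cut m (y ord0 ord0) - prim0 v y * cut m (y ord0 ord0) = 0}.
  by apply: ae_foralln.
apply: (ae_imp Z') => y Hy; have h := @cut_cvg R (y ord0 ord0).
have [m hm] : exists m, 0 < cut m (y ord0 ord0).
  have /cvgr_gt /(_ 0 ltr01) h' := h.
  by have [m _ /(_ m (leqnn m))] := h'; exists m.
move: (Hy m) => /eqP; rewrite -mulrBl mulf_eq0 (gt_eqF hm) orbF subr_eq0 => /eqP ->.
by [].
Qed.

End weak_first.

Section line_square.
Context (R : realType).
Local Notation lam := (@lebesgue_measure R).
Local Notation intg f := (lam.-integrable setT (EFin \o f)).

Lemma normM_le_sqr (a b : R) : `|a * b| <= a ^+ 2 + b ^+ 2.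
Proof.
rewrite normrM -(real_normK (num_real a)) -(real_normK (num_real b)).
by have := sqr_ge0 (`|a| - `|b|); have := sqr_ge0 (`|a|); have := sqr_ge0 (`|b|); nra.
Qed.

(** [w] and [w0] are only square integrable, so [prim w0] may be meaningless. The truncations
    [w c_m] are primitives of the integrable [f m], their squares obey [sqr_prim], and dominated
    convergence removes the cutoffs because [2 w w0] is integrable. *)
Lemma line_square (w w0 : R -> R) (c dc : nat -> R -> R) (C x : R) :
  measurable_fun setT w -> measurable_fun setT w0 ->
  (forall m, measurable_fun setT (c m)) -> (forall m, measurable_fun setT (dc m)) ->
  intg (fun t => w t ^+ 2) -> intg (fun t => w0 t ^+ 2) ->
  (forall m t, 0 <= c m t <= 1) -> 0 <= C -> (forall m t, `|dc m t| <= C) ->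
  (forall t, c m t @[m --> \oo] --> (1 : R)) -> (forall t, dc m t @[m --> \oo] --> (0 : R)) ->
  let f m t := w0 t * c m t + w t * dc m t in
  (forall m, intg (f m)) -> (forall m, {ae lam, forall t, w t * c m t = prim (f m) t}) ->
  (forall m, w x * c m x = prim (f m) x) ->
  w x ^+ 2 = prim (fun t => 2 * w t * w0 t) x.
Proof.
move=> mw mw0 mc mdc wi w0i c01 C0 dcC c1 dc0 f fi ae_f fx.
have mf m : measurable_fun setT (f m) by exact: integrable_measurable (fi m).
have mcut (h : R -> R) : measurable_fun setT h -> measurable_fun setT (cutl h x).
  by move=> mh; apply: measurable_funM => //; exact: measurable_le_cst.
have E m : (w x * c m x) ^+ 2 = \int[lam]_t cutl (fun t => 2 * f m t * (w t * c m t)) x t.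
  rewrite fx sqr_prim// primE; apply: ae_eq_Rintegral.
  - apply: mcut; apply: measurable_funM; first exact: measurable_funM.
    by apply: continuous_measurable_fun; exact: continuous_prim.
  - by apply: mcut; apply: measurable_funM; exact: measurable_funM.
  - by apply: (ae_imp (ae_f m)) => t ht; rewrite /cutl ht.
have l1 : (w x * c m x) ^+ 2 @[m --> \oo] --> w x ^+ 2.
  rewrite -[X in X ^+ 2]mulr1; under eq_fun do rewrite expr2; rewrite expr2.
  by apply: (@cvgM R); apply: (@cvgM R) => //; exact: cvg_cst.
have l2 : \int[lam]_t cutl (fun t => 2 * f m t * (w t * c m t)) x t @[m --> \oo] -->
    \int[lam]_t cutl (fun t => 2 * w t * w0 t) x t.
  apply: (@dominated_Rintegral _ _ _ lam _ _ (fun t => 2 * ((1 + C) * w t ^+ 2 + w0 t ^+ 2))).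
  - by move=> m; apply: mcut; apply: measurable_funM; exact: measurable_funM.
  - by apply: mcut; apply: measurable_funM => //; exact: measurable_funM.
  - apply: aeW => t; apply: (@cvgM R); first exact: cvg_cst.
    rewrite (_ : 2 * w t * w0 t = 2 * (w0 t * 1 + w t * 0) * (w t * 1)); last by ring.
    apply: (@cvgM R); last by apply: (@cvgM R) => //; exact: cvg_cst.
    apply: (@cvgM R); first exact: cvg_cst.
    by apply: (@cvgD _ R^o); apply: (@cvgM R) => //; exact: cvg_cst.
  - by apply: intgZ; apply: intgD => //; exact: intgZ.
  - move=> m t; apply: (@le_trans _ _ `|2 * f m t * (w t * c m t)|).
      by rewrite /cutl; case: (t <= x); rewrite ?mul1r// mul0r normr0.
    rewrite -mulrA normrM (ger0_norm (ler0n _ 2)) ler_pM2l//.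
    have /andP[h0 h1] := c01 m t.
    have -> : f m t * (w t * c m t) = (w t * w0 t) * (c m t * c m t) + (w t ^+ 2) * (dc m t * c m t).
      by rewrite /f; ring.
    apply: le_trans (ler_normD _ _) _.
    have cc : `|c m t * c m t| <= 1 by rewrite ger0_norm ?mulr_ge0// mulr_ile1.
    have dcc : `|dc m t * c m t| <= C.
      by rewrite normrM (ger0_norm h0) -[leRHS]mulr1 ler_pM.
    have h2 : `|w t * w0 t * (c m t * c m t)| <= w t ^+ 2 + w0 t ^+ 2.
      by rewrite normrM -[leRHS]mulr1 ler_pM// normM_le_sqr.
    have h3 : `|w t ^+ 2 * (dc m t * c m t)| <= w t ^+ 2 * C.
      by rewrite normrM (ger0_norm (sqr_ge0 _)) ler_wpM2l// sqr_ge0.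
    by move: h2 h3; lra.
rewrite primE; apply: (cvg_unique (@norm_hausdorff _ R^o) l1).
by apply: cvg_trans l2; apply: near_eq_cvg; apply: nearW => m; rewrite E.
Qed.

End line_square.

Section weak_square.
Context (R : realType).
Local Notation lam := (@lebesgue_measure R).
Local Notation L := (@lebesgue_rV R).
Local Notation intg f := (lam.-integrable setT (EFin \o f)).
Local Notation intgL n f := ((L n).-integrable setT (EFin \o f)).

Lemma prodf_intg n (phi : 'I_n -> R -> R) : (forall k, smooth_compact (phi k)) ->
  intgL n (prodf phi).
Proof.
elim: n phi => [|n ih] phi sp.
  have -> : prodf phi = cst 1 by apply/funext => y; rewrite /prodf big_ord0.
  apply/integrableP; split; first exact/measurable_EFinP.
  rewrite /= integral_dirac// diracT mul1e normr1 ltry//.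
apply: cons_intg; first exact: prod_test_measurable.
rewrite (fcons_eta phi).
under [X in EFin \o X]eq_fun do rewrite prodf_fcons rV_cons0 prod_tail_cons.
apply: (@integrable_prodM _ _ _ _ _ lam (L n)); first exact: smooth_compact_intg.
exact: ih.
Qed.

Lemma intg_L2_test n (w : 'rV[R]_n -> R) (phi : 'I_n -> R -> R) :
  measurable_fun setT w -> intgL n (fun y => w y ^+ 2) ->
  (forall k, smooth_compact (phi k)) -> intgL n (fun y => w y * prodf phi y).
Proof.
move=> mw wi sp.
have ii : intgL n (prodf (fun k t => phi k t * phi k t)).
  by apply: prodf_intg => k; apply: smooth_compactM => //; exact: (sp k).1.
apply: (le_intg _ _ (intgD wi ii)).
  by apply: measurable_funM => //; exact: prod_test_measurable.
move=> y; apply: le_trans (normM_le_sqr _ _) _; rewrite lerD2l.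
by rewrite /prodf expr2 -big_split.
Qed.

Lemma prodf_sc_intg n (f : 'rV[R]_n -> R) (phi : 'I_n -> R -> R) : intgL n f ->
  (forall k, smooth_compact (phi k)) -> intgL n (fun y => f y * prodf phi y).
Proof.
move=> fi sp; have [C HC] := prod_test_bounded sp.
by apply: (@intg_bounded _ _ _ _ C) => //; exact: prod_test_measurable.
Qed.

(** Cutting off in all coordinates makes [w] and its weak derivative integrable, so that
    [weak_partial_ae0] applies to [a m]; the cutoffs are then removed from the square, line by
    line. *)
Lemma weak_partial_sqr0 n (w w0 : 'rV[R]_n.+1 -> R) :
  measurable_fun setT w -> measurable_fun setT w0 ->
  intgL n.+1 (fun y => w y ^+ 2) -> intgL n.+1 (fun y => w0 y ^+ 2) ->
  weak_partial w ord0 w0 ->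
  partial_derivative (fun y => w y ^+ 2) ord0 (fun y => 2 * w y * w0 y).
Proof.
move=> mw mw0 wi w0i H.
pose cuts m : 'I_n.+1 -> R -> R := fun _ => cut m.
have scuts m k : smooth_compact (cuts m k) by exact: cut_smooth_compact.
have sdcuts m k : smooth_compact (der_at ord0 (cuts m) k) by exact: der_at_smooth_compact.
pose a m y := w y * prodf (cuts m) y.
pose b m y := w0 y * prodf (cuts m) y + w y * prodf (der_at ord0 (cuts m)) y.
have ai m : intgL n.+1 (a m) by exact: intg_L2_test.
have b1 m : intgL n.+1 (fun y => w0 y * prodf (cuts m) y) by exact: intg_L2_test.
have b2 m : intgL n.+1 (fun y => w y * prodf (der_at ord0 (cuts m)) y) by exact: intg_L2_test.
have bi m : intgL n.+1 (b m) by exact: intgD.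
(* Leibniz rule for weak derivatives: the cutoffs are absorbed into the test functions,
   [psi = cut * phi] in each coordinate. *)
have weak m : weak_partial (a m) ord0 (b m).
  move=> phi sp; pose psi k t := cut m t * phi k t.
  have spsi k : smooth_compact (psi k).
    by apply: smooth_compactM; [exact: cut_smooth_compact|exact: (sp k).1].
  have E1 y : prodf psi y = prodf (cuts m) y * prodf phi y by rewrite /prodf -big_split.
  have E2 y : prodf (der_at ord0 psi) y = prodf (cuts m) y * prodf (der_at ord0 phi) y +
      prodf (der_at ord0 (cuts m)) y * prodf phi y.
    have := smooth_is_derive (cut_smooth_compact R m).1 (y ord0 ord0).
    have := smooth_is_derive (sp ord0).1 (y ord0 ord0) => d2 d1.
    have d3 := @derive_val _ _ _ _ _ _ _ (is_deriveM d1 d2).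
    rewrite (fcons_eta psi) (fcons_eta phi) (fcons_eta (cuts m)) !der_at_fcons !prodf_fcons.
    rewrite /psi /cuts d3 /GRing.scale/=.
    rewrite (_ : prod_tail _ y = prod_tail (fun=> cut m) y * prod_tail (fun k => phi (lift ord0 k)) y).
      ring.
    by rewrite /prod_tail -big_split.
  have dsp := der_at_smooth_compact ord0 sp.
  have := H _ spsi.
  under eq_Rintegral do rewrite E2.
  under [in RHS]eq_Rintegral do rewrite E1 mulrA.
  under eq_Rintegral do rewrite mulrDr !mulrA.
  rewrite RintegralD//; last 2 first.
  - exact: prodf_sc_intg (ai m) dsp.
  - exact: prodf_sc_intg (b2 m) sp.
  move=> HE; under [in RHS]eq_Rintegral do rewrite mulrDl.
  rewrite RintegralD//; last 2 first.
  - exact: prodf_sc_intg (b1 m) sp.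
  - exact: prodf_sc_intg (b2 m) sp.
  by move: HE; rewrite /a; lra.
have P m := partial_derivative_cons0 (weak_partial_ae0 (ai m) (bi m) (weak m)).
have P' : {ae (lam \x L n)%E, forall p, forall m,
    a m (rV_cons p) = prim (fun r => b m (rV_cons (r, p.2))) p.1}.
  by apply/ae_foralln.
have lines : {ae L n, forall v, forall m, {ae lam, forall t,
    a m (rV_cons (t, v)) = prim (fun r => b m (rV_cons (r, v))) t}}.
  by apply/ae_foralln => m; have [_] := ae_prod (P m).
have linesb : {ae L n, forall v, forall m, intg (fun r => b m (rV_cons (r, v)))}.
  by apply/ae_foralln => m; exact: ae_line (bi m).
have l1 := ae_line wi; have l2 := ae_line w0i.
have all4 := ae_imp2 (ae_imp2 l1 l2 (fun _ => pair)) (ae_imp2 lines linesb (fun _ => pair)) (fun _ => pair).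
apply: rVS_ae; apply: (ae_imp2 P' (@ae_snd _ _ _ _ _ lam (L n) _ all4)) => -[t v] /= Ha [[wv w0v] [lv bv]].
rewrite rV_cons0 /=.
under [X in prim X _]eq_fun do rewrite upd_cons0.
have [C [C0 dcC dc0]] := cut_derive R.
have sec (h : 'rV[R]_n.+1 -> R) : measurable_fun setT h -> measurable_fun setT (fun r => h (rV_cons (r, v))).
  move=> mh; apply: (@measurable_fun_pair1 _ _ _ _ _ _ (fun p => h (rV_cons p))) => //.
  exact: measurable_rV_comp.
have cE m r : prodf (cuts m) (rV_cons (r, v)) = cut m r * prodf (fun=> cut m) v.
  by rewrite (fcons_eta (cuts m)) prodf_fcons rV_cons0 prod_tail_cons.
have dcE m r : prodf (der_at ord0 (cuts m)) (rV_cons (r, v)) = 'D_1 (cut m) r * prodf (fun=> cut m) v.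
  by rewrite (fcons_eta (cuts m)) der_at_fcons prodf_fcons rV_cons0 prod_tail_cons.
have tau01 m : 0 <= prodf (fun _ : 'I_n => cut m) v <= 1.
  apply/andP; split; first by rewrite /prodf prodr_ge0// => k _; have /andP[] := cut01 m (v ord0 k).
  by rewrite /prodf prodr_ile1// => k _; exact: cut01.
have tau1 : prodf (fun _ : 'I_n => cut m) v @[m --> \oo] --> (1 : R).
  have -> : (1 : R) = \prod_(k < n) 1 by rewrite big1.
  by apply: cvg_big => [|k _]; [exact: mul_continuous|exact: cut_cvg].
apply: (@line_square _ (fun r => w (rV_cons (r, v))) (fun r => w0 (rV_cons (r, v)))
  (fun m r => prodf (cuts m) (rV_cons (r, v)))
  (fun m r => prodf (der_at ord0 (cuts m)) (rV_cons (r, v))) C) => //.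
- exact: sec.
- exact: sec.
- by move=> m; apply: sec; exact: prod_test_measurable.
- by move=> m; apply: sec; exact: prod_test_measurable.
- move=> m r; rewrite cE; have /andP[h0 h1] := cut01 m r; have /andP[h2 h3] := tau01 m.
  by rewrite mulr_ge0// mulr_ile1.
- move=> m r; rewrite dcE normrM -[leRHS]mulr1 ler_pM//.
  by have /andP[h2 h3] := tau01 m; rewrite ger0_norm.
- move=> r; under eq_fun do rewrite cE; rewrite -(mulr1 1).
  by apply: (@cvgM R) => //; exact: cut_cvg.
- move=> r; under eq_fun do rewrite dcE; rewrite -(mul0r 1).
  by apply: (@cvgM R) => //; exact: dc0.
Qed.

Lemma weak_partial_sqr n j (w w0 : 'rV[R]_n.+1 -> R) :
  measurable_fun setT w -> measurable_fun setT w0 ->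
  intgL n.+1 (fun y => w y ^+ 2) -> intgL n.+1 (fun y => w0 y ^+ 2) ->
  weak_partial w j w0 ->
  partial_derivative (fun y => w y ^+ 2) j (fun y => 2 * w y * w0 y).
Proof.
move=> mw mw0 wi w0i H; apply: partial_derivative_swapc.
have ms (h : 'rV[R]_n.+1 -> R) : measurable_fun setT h -> measurable_fun setT (fun y => h (swapc j y)).
  by move=> mh; exact: (measurableT_comp mh (measurable_swapc j)).
apply: (@weak_partial_sqr0 _ (fun y => w (swapc j y)) (fun y => w0 (swapc j y))).
- exact: ms.
- exact: ms.
- exact: (intg_swapc j wi).
- exact: (intg_swapc j w0i).
- exact: weak_partial_swapc.
Qed.

End weak_square.

(** * Horospherical coordinates *)

Section is_derive_rules.
Context (R : realType) (V : normedModType R).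
Implicit Types (f g : V -> R) (x v : V) (df dg d : R).

Lemma is_derive_eqr f x v df d : is_derive x v f df -> df = d -> is_derive x v f d.
Proof. by move=> h <-. Qed.

Lemma is_derive_subr f g x v df dg : is_derive x v f df -> is_derive x v g dg ->
  is_derive x v (fun y => f y - g y) (df - dg).
Proof. by move=> h1 h2; have := is_deriveB h1 h2. Qed.

Lemma is_derive_scale (c : R) f x v df : is_derive x v f df ->
  is_derive x v (fun y => c * f y) (c * df).
Proof. by move=> h; have := is_deriveZ c h. Qed.

Lemma is_derive_mulr f g x v df dg : is_derive x v f df -> is_derive x v g dg ->
  is_derive x v (fun y => f y * g y) (f x * dg + g x * df).
Proof. by move=> h1 h2; have := is_deriveM h1 h2. Qed.

Lemma is_derive_invr f x v df : f x != 0 -> is_derive x v f df ->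
  is_derive x v (fun y => (f y)^-1) (- (f x)^-1 ^+ 2 * df).
Proof.
move=> fx h; have hinv : is_derive (f x) 1 (fun y : R => y^-1) (- (f x)^-1 ^+ 2).
  have := @is_deriveV _ id (f x) 1 1 fx (is_derive_id _ _).
  by rewrite /GRing.scale/= mulr1 exprVn.
exact: is_derive_comp1 h hinv.
Qed.

Lemma is_derive_expr f x v df p : is_derive x v f df ->
  is_derive x v (fun y => f y ^+ p) (p%:R * f x ^+ p.-1 * df).
Proof.
move=> h; elim: p => [|p ih].
  by under eq_fun do rewrite expr0; rewrite !mul0r; exact: is_derive_cst.
under eq_fun do rewrite exprS.
apply: is_derive_eqr (is_derive_mulr h ih) _; rewrite -natr1.
by case: p {ih} => [|p] /=; rewrite ?expr0 ?exprS; ring.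
Qed.

End is_derive_rules.

Section horospherical.
Context (R : realType) (n : nat).
Local Notation E := 'rV[R]_n.+1.
Local Notation b := (@basis_rV R n.+1).
Local Notation hs := (@hspace R n.+1).
Implicit Types (x : E) (i j k m : 'I_n.+1).

(* x lies in the ball and zc = x - e_0, so that Qf x = |x - e_0|^2 and
   Df x = 1 - |x|^2.  The functions gf k are coordinates of the upper half-space:
   exp(gf 0) = D / Q is the height, and gf k, k > 0, are the horizontal
   coordinates.  The columns Rf j of the reflection Q - 2 z z^T are, up to the
   factors ef j below, the coordinate fields d/dg_j.  Jf is the Jacobian
   determinant dg/dx, and cf j Rf j = Jf d/dg_j is divergence free. *)
Definition zc m x : R := x ord0 m - (m == ord0)%:R.
Definition Qf x : R := \sum_m zc m x * zc m x.
Definition Df x : R := 1 - dotp x x.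
Definition Rf j i x : R := Qf x * (i == j)%:R - 2 * zc j x * zc i x.
Definition gf k x : R := if k == ord0 then ln (Df x) - ln (Qf x) else 2 * (x ord0 k * (Qf x)^-1).
Definition Jf x : R := 2 ^+ n.+1 * ((Df x)^-1 * (Qf x)^-1 ^+ n).
Definition cf j x : R :=
  if j == ord0 then - 2 ^+ n * (Qf x)^-1 ^+ n.+1 else 2 ^+ n * ((Df x)^-1 * (Qf x)^-1 ^+ n).

Lemma DfE x : Df x = - Qf x - 2 * zc ord0 x.
Proof.
rewrite /Df /Qf /dotp /zc !big_ord_recl eqxx /=.
under [in RHS]eq_bigr do rewrite !subr0.
by rewrite mulr1n; ring.
Qed.

(** The gradients of [gf k] and [cf j] all have the shape [a z + c e_m], and the reflection maps [z]
    to [- Q z]. *)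
Lemma sum_Rf j x (a c : R) m :
  \sum_i Rf j i x * (a * zc i x + c * (i == m)%:R) = - a * Qf x * zc j x + c * Rf j m x.
Proof.
under eq_bigr do rewrite mulrDr.
rewrite big_split; congr (_ + _) => /=.
  rewrite (_ : - a * Qf x * zc j x = a * Qf x * zc j x - 2 * a * zc j x * Qf x); last by ring.
  rewrite [X in _ - _ * X]/Qf.
  under eq_bigr do rewrite /Rf mulrBl.
  rewrite big_split/= sumrN; congr (_ - _); last first.
    by rewrite mulr_sumr; apply: eq_bigr => i _; ring.
  rewrite (bigD1 j)//= eqxx big1 ?addr0; first by rewrite mulr1; ring.
  by move=> i /negbTE ->; rewrite mulr0 mul0r.
rewrite (bigD1 m)//= eqxx big1 ?addr0; first by rewrite mulr1 mulrC.
by move=> i /negbTE ->; rewrite !mulr0.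
Qed.

Lemma hspace_pos x : hs x -> 0 < Df x /\ 0 < Qf x.
Proof.
rewrite /hspace /Df /= subr_gt0 => x1; split => //.
have x0 : x ord0 ord0 < 1.
  rewrite ltNge; apply/negP => h; move: x1; rewrite ltNge => /negP; apply.
  rewrite /dotp (bigD1 ord0)//= -[leLHS]addr0 lerD//.
    by rewrite -[leLHS]mulr1 ler_pM.
  by apply: sumr_ge0 => i _; rewrite -expr2 sqr_ge0.
rewrite /Qf (bigD1 ord0)//= ltr_pwDl//.
  by rewrite -expr2 exprn_even_gt0//= /zc eqxx subr_eq0 (lt_eqF x0).
by apply: sumr_ge0 => i _; rewrite -expr2 sqr_ge0.
Qed.

Lemma is_derive_coord x i m : is_derive x (b i) (fun y : E => y ord0 m) (i == m)%:R.
Proof.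
apply/is_derive_lineP.
under eq_fun do rewrite !mxE eqxx /= [m == i]eq_sym.
apply: is_derive_eq; rewrite /GRing.scale/=; ring.
Qed.

Lemma is_derive_zc x i m : is_derive x (b i) (zc m) (i == m)%:R.
Proof.
have h := is_derive_coord x i m.
by have := is_derive_subr h (is_derive_cst ((m == ord0)%:R : R) x (b i)); rewrite subr0.
Qed.

Lemma is_derive_Qf x i : is_derive x (b i) Qf (2 * zc i x).
Proof.
have h m : is_derive x (b i) (fun y => zc m y * zc m y) (2 * (zc m x * (i == m)%:R)).
  have hz := is_derive_zc x i m.
  by apply: is_derive_eqr (is_derive_mulr hz hz) _; ring.
have := is_derive_sum h.
rewrite (_ : \sum_(m < n.+1) (fun y => zc m y * zc m y) = Qf); last first.
  by apply/funext => y; rewrite fct_sumE.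
move=> h'; apply: is_derive_eqr h' _; rewrite -mulr_sumr (bigD1 i)//= eqxx big1 ?addr0 ?mulr1//.
by move=> m /negbTE; rewrite eq_sym => ->; rewrite mulr0.
Qed.

Lemma is_derive_Df x i : is_derive x (b i) Df (- 2 * zc i x - 2 * (i == ord0)%:R).
Proof.
have -> : Df = (fun y => - 1 * Qf y - 2 * zc ord0 y).
  by apply/funext => y; rewrite DfE mulN1r.
have h1 := is_derive_scale (- 1) (is_derive_Qf x i).
have h2 := is_derive_scale 2 (is_derive_zc x i ord0).
by apply: is_derive_eqr (is_derive_subr h1 h2) _; ring.
Qed.

Lemma is_derive_gf x i k : hs x ->
  is_derive x (b i) (gf k) (if k == ord0 then
      (- 2 * ((Df x)^-1 + (Qf x)^-1)) * zc i x + (- 2 * (Df x)^-1) * (i == ord0)%:R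
    else (- 4 * zc k x * (Qf x)^-1 ^+ 2) * zc i x + (2 * (Qf x)^-1) * (i == k)%:R).
Proof.
move=> /hspace_pos[D0 Q0]; have [->|k0] := eqVneq k ord0.
  rewrite /gf eqxx.
  have h1 := is_derive_comp1 (is_derive_Df x i) (is_derive1_ln D0).
  have h2 := is_derive_comp1 (is_derive_Qf x i) (is_derive1_ln Q0).
  by apply: is_derive_eqr (is_derive_subr h1 h2) _; ring.
rewrite /gf (negbTE k0).
have h1 := is_derive_invr (lt0r_neq0 Q0) (is_derive_Qf x i).
apply: is_derive_eqr (is_derive_scale 2 (is_derive_mulr (is_derive_coord x i k) h1)) _; rewrite /zc (negbTE k0) subr0; ring.
Qed.

(** The field [Rf j] differentiates only the coordinate [gf j]; the factor left on the diagonal is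
    the inverse of [ef j]. *)
Lemma sum_Rf_dgf x j k : hs x ->
  \sum_i Rf j i x * 'D_(b i) (gf k) x =
  (j == k)%:R * (if k == ord0 then - 2 * Qf x / Df x else 2).
Proof.
move=> hx; have [D0 Q0] := hspace_pos hx.
have D1 : Df x != 0 by rewrite gt_eqF.
have Q1 : Qf x != 0 by rewrite gt_eqF.
under eq_bigr do rewrite (@derive_val _ _ _ _ _ _ _ (is_derive_gf _ _ hx)).
have DE := DfE x.
have [->|k0] := eqVneq k ord0.
  rewrite sum_Rf /Rf [ord0 == j]eq_sym.
  case: eqP => [->|_]; rewrite ?mulr1n ?mulr0n.
    by move: D1; rewrite DE => D1; field; rewrite D1.
  by move: D1; rewrite DE => D1; field; rewrite D1.
rewrite sum_Rf /Rf [k == j]eq_sym.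
by case: eqP => [->|_]; rewrite ?mulr1n ?mulr0n; field.
Qed.

Lemma is_derive_Rf x i j : is_derive x (b i) (Rf j i) (- 2 * zc j x).
Proof.
have hz m := is_derive_zc x i m.
have h1 := is_derive_mulr (is_derive_Qf x i) (is_derive_cst ((i == j)%:R : R) x (b i)).
have h2 := is_derive_mulr (is_derive_scale 2 (hz j)) (hz i).
apply: is_derive_eqr (is_derive_subr h1 h2) _; rewrite eqxx.
case: eqP => [->|_]; rewrite /= ?mulr1n ?mulr0n; ring.
Qed.

Lemma is_derive_cf x i j : hs x ->
  is_derive x (b i) (cf j) (if j == ord0 then
     (2 * n.+1%:R * 2 ^+ n * (Qf x)^-1 ^+ n.+2) * zc i x + 0 * (i == ord0)%:R
   else (2 ^+ n * (Df x)^-1 * (Qf x)^-1 ^+ n * (2 * (Df x)^-1 - 2 * n%:R * (Qf x)^-1)) * zc i x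
     + (2 ^+ n * 2 * (Df x)^-1 ^+ 2 * (Qf x)^-1 ^+ n) * (i == ord0)%:R).
Proof.
move=> /hspace_pos[D0 Q0].
have hQ := is_derive_invr (lt0r_neq0 Q0) (is_derive_Qf x i).
have hD := is_derive_invr (lt0r_neq0 D0) (is_derive_Df x i).
have [->|k0] := eqVneq j ord0.
  rewrite /cf eqxx; apply: is_derive_eqr (is_derive_scale (- 2 ^+ n) (is_derive_expr n.+1 hQ)) _; rewrite !exprS; ring.
rewrite /cf (negbTE k0).
apply: is_derive_eqr (is_derive_scale (2 ^+ n) (is_derive_mulr hD (is_derive_expr n hQ))) _.
have e (q : R) : n%:R * q ^+ n.-1 * q = n%:R * q ^+ n.
  by case: (n) => [|p]; rewrite ?mul0r//= exprSr mulrA.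
rewrite (_ : _ * (- _ ^+ 2 * (2 * zc i x)) = - (n%:R * (Qf x)^-1 ^+ n * (Qf x)^-1 * (2 * zc i x))).
  by ring.
by rewrite -e; ring.
Qed.

(** Piola identity for the coordinates [g]: thanks to it the weak gradient on the ball turns into
    weak derivatives in [g] with no zero-order term. *)
Lemma div_cfRf x j : hs x ->
  \sum_i (cf j x * 'D_(b i) (Rf j i) x + Rf j i x * 'D_(b i) (cf j) x) = 0.
Proof.
move=> hx; have [D0 Q0] := hspace_pos hx.
have D1 : Df x != 0 by rewrite gt_eqF.
have Q1 : Qf x != 0 by rewrite gt_eqF.
rewrite big_split/=.
under eq_bigr do rewrite (@derive_val _ _ _ _ _ _ _ (is_derive_Rf _ _ _)).
under [X in _ + X]eq_bigr do rewrite (@derive_val _ _ _ _ _ _ _ (is_derive_cf _ _ hx)).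
rewrite sumr_const card_ord.
have DE := DfE x.
have [->|k0] := eqVneq j ord0.
  rewrite sum_Rf /cf eqxx -[_ *+ n.+1]mulr_natr !exprS; field; exact: Q1.
rewrite sum_Rf /cf (negbTE k0) /Rf [ord0 == j]eq_sym (negbTE k0) mulr0n -[_ *+ n.+1]mulr_natr.
rewrite -natr1 !exprS expr0; move: D1; rewrite DE => D1; field; by rewrite ?D1 ?Q1.
Qed.

End horospherical.

Section test_functions.
Context (R : realType) (n : nat).
Local Notation E := 'rV[R]_n.+1.
Local Notation b := (@basis_rV R n.+1).
Local Notation hs := (@hspace R n.+1).
Local Notation Ck0 := (CkOn (@basis_rV R n.+1)).
Implicit Types (x : E) (i j m : 'I_n.+1) (phi : 'I_n.+1 -> R -> R).

Lemma is_derive_prodr (p : nat) (F : 'I_p -> E -> R) (dF : 'I_p -> R) x (v : E) :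
  (forall k : 'I_p, is_derive x v (F k) (dF k)) ->
  is_derive x v (fun y => \prod_(k < p) F k y)
    (\sum_(k < p) \prod_(l < p) (if l == k then dF k else F l x)).
Proof.
elim: p F dF => [|p ih] F dF h.
  under eq_fun do rewrite big_ord0; rewrite big_ord0; exact: is_derive_cst.
under eq_fun do rewrite big_ord_recl.
have := is_derive_mulr (h ord0) (ih _ _ (fun k => h (lift ord0 k))).
move=> h'; apply: is_derive_eqr h' _.
rewrite big_ord_recl addrC mulr_sumr; congr (_ + _).
  by rewrite big_ord_recl eqxx mulrC.
by apply: eq_bigr => k _; rewrite big_ord_recl (negbTE (neq_lift _ _)); congr (_ * _).
Qed.

Definition gmap x : E := \row_k gf k x.

Lemma is_derive_prodf_gmap phi x i : hs x -> (forall k, smooth_compact (phi k)) ->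
  is_derive x (b i) (fun y => prodf phi (gmap y))
    (\sum_k 'D_(b i) (gf k) x * prodf (der_at k phi) (gmap x)).
Proof.
move=> hx sp.
have -> : (fun y => prodf phi (gmap y)) = (fun y => \prod_k phi k (gf k y)).
  by apply/funext => y; apply: eq_bigr => k _; rewrite mxE.
have hF k : is_derive x (b i) (fun y => phi k (gf k y)) ('D_1 (phi k) (gf k x) * 'D_(b i) (gf k) x).
  have h0 := is_derive_gf i k hx.
  have h1 : is_derive x (b i) (gf k) ('D_(b i) (gf k) x).
    by rewrite (@derive_val _ _ _ _ _ _ _ h0).
  exact: is_derive_comp1 h1 (smooth_is_derive (sp k).1 _).
apply: is_derive_eqr (is_derive_prodr hF) _; apply: eq_bigr => k _.
rewrite /prodf (bigD1 k)//= eqxx [in RHS](bigD1 k)//= mulrA; congr (_ * _).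
  by rewrite /der_at eqxx mxE mulrC.
by apply: eq_bigr => l /negbTE lk; rewrite /der_at lk mxE.
Qed.

Lemma CkOn_coord k m : Ck0 setT k (fun x => x ord0 m).
Proof.
case: k => [|k]; first by move=> x _; exact: coord_continuous.
apply: (@CkOn_derive _ _ _ _ _ _ _ (fun i _ => (i == m)%:R)).
- exact: openT.
- by move=> i x _; exact: is_derive_coord.
- by move=> x _; exact: coord_continuous.
- by move=> i; apply: CkOn_cst; exact: openT.
Qed.

Lemma CkOn_zc k m : Ck0 setT k (zc m).
Proof. by apply: CkOnB; [exact: openT|exact: CkOn_coord|apply: CkOn_cst; exact: openT]. Qed.

Lemma CkOn_Qf k : Ck0 setT k (@Qf R n).
Proof. by apply: CkOn_sum => [|m]; [exact: openT|apply: CkOnM; [exact: openT|exact: CkOn_zc..]]. Qed.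

Lemma CkOn_Df k : Ck0 setT k (@Df R n).
Proof.
apply: CkOnB; [exact: openT|apply: CkOn_cst; exact: openT|].
by apply: CkOn_sum => [|m]; [exact: openT|apply: CkOnM; [exact: openT|exact: CkOn_coord..]].
Qed.

Lemma continuous_Df : continuous (@Df R n).
Proof. by move=> x; exact: (CkOn_Df 0). Qed.

Lemma hspaceE : hs = [set x | 0 < Df x].
Proof. by apply/seteqP; split => x; rewrite /hspace /Df /= subr_gt0. Qed.

Lemma open_hspace : open hs.
Proof.
rewrite hspaceE (_ : [set _ | _] = @Df R n @^-1` [set t | 0 < t])//.
by apply: open_comp => [x _|]; [exact: continuous_Df|exact: open_gt].
Qed.

Lemma CkOn_hs k (f : E -> R) : Ck0 setT k f -> Ck0 hs k f.
Proof. exact: CkOn_subset. Qed.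

Lemma CkOn_invQ k : Ck0 hs k (fun x => (Qf x)^-1).
Proof.
apply: (CkOn_comp open_hspace _ (Ck1_inv R k) (CkOn_hs (CkOn_Qf k))).
by move=> x /hspace_pos[_ Q0] /=; rewrite gt_eqF.
Qed.

Lemma CkOn_invD k : Ck0 hs k (fun x => (Df x)^-1).
Proof.
apply: (CkOn_comp open_hspace _ (Ck1_inv R k) (CkOn_hs (CkOn_Df k))).
by move=> x /hspace_pos[D0 _] /=; rewrite gt_eqF.
Qed.

Lemma CkOn_gf k m : Ck0 hs k (gf m).
Proof.
have oh := open_hspace; rewrite /gf; case: (m == ord0).
  apply: CkOnB => //.
    apply: (CkOn_comp oh _ (Ck1_ln R k) (CkOn_hs (CkOn_Df k))).
    by move=> x /hspace_pos[].
  apply: (CkOn_comp oh _ (Ck1_ln R k) (CkOn_hs (CkOn_Qf k))).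
  by move=> x /hspace_pos[].
by apply: CkOnZ => //; apply: CkOnM => //; [exact/CkOn_hs/CkOn_coord|exact: CkOn_invQ].
Qed.

Lemma CkOn_cfRf k i j : Ck0 hs k (fun x => cf j x * Rf j i x).
Proof.
have oh := open_hspace; apply: CkOnM => //.
  rewrite /cf; case: (j == ord0).
    by apply: CkOnZ => //; apply: CkOnX => //; exact: CkOn_invQ.
  apply: CkOnZ => //; apply: CkOnM => //; first exact: CkOn_invD.
  by apply: CkOnX => //; exact: CkOn_invQ.
apply: CkOnB => //; apply: CkOnM => //; first exact/CkOn_hs/CkOn_Qf.
- exact: CkOn_cst.
- by apply: CkOnZ => //; exact/CkOn_hs/CkOn_zc.
- exact/CkOn_hs/CkOn_zc.
Qed.

(* Fed to the weak gradient of u for each component i, the field J phi(g) d/dg_j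
   yields the weak partial derivative of u along the coordinate g_j. *)
Definition eta phi j i := (fun x => prodf phi (gmap x) * (cf j x * Rf j i x)) \_ hs.

Lemma etaE phi j i x : hs x -> eta phi j i x = prodf phi (gmap x) * (cf j x * Rf j i x).
Proof. by move=> hx; rewrite /eta patchE mem_set. Qed.

Lemma CkOn_eta k phi j i : (forall k, smooth_compact (phi k)) -> Ck0 hs k (eta phi j i).
Proof.
move=> sp; apply: (@CkOn_eq _ _ _ _ _ _ (fun x => prodf phi (gmap x) * (cf j x * Rf j i x))).
- exact: open_hspace.
- by move=> x hx; rewrite etaE.
apply: CkOnM; [exact: open_hspace| |exact: CkOn_cfRf].
apply: CkOn_prod => [|m]; first exact: open_hspace.
under eq_fun do rewrite mxE.
apply: (CkOn_comp open_hspace _ ((sp m).1 k) (CkOn_gf k m)) => //.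
Qed.

Lemma div_eta phi j x : hs x -> (forall k, smooth_compact (phi k)) ->
  \sum_i 'D_(b i) (eta phi j i) x = Jf x * prodf (der_at j phi) (gmap x).
Proof.
move=> hx sp; have [D0 Q0] := hspace_pos hx.
have D1 : Df x != 0 by rewrite gt_eqF.
have Q1 : Qf x != 0 by rewrite gt_eqF.
have h i : 'D_(b i) (eta phi j i) x = prodf phi (gmap x) *
      (cf j x * 'D_(b i) (Rf j i) x + Rf j i x * 'D_(b i) (cf j) x) +
      cf j x * \sum_k prodf (der_at k phi) (gmap x) * (Rf j i x * 'D_(b i) (gf k) x).
  have h1 := is_derive_prodf_gmap i hx sp.
  have h2 : is_derive x (b i) (cf j) ('D_(b i) (cf j) x).
    by rewrite (@derive_val _ _ _ _ _ _ _ (is_derive_cf i j hx)); exact: is_derive_cf.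
  have h3 : is_derive x (b i) (Rf j i) ('D_(b i) (Rf j i) x).
    by rewrite (@derive_val _ _ _ _ _ _ _ (is_derive_Rf x i j)); exact: is_derive_Rf.
  have h4 := is_derive_mulr h1 (is_derive_mulr h2 h3).
  have near_eta : \near x, prodf phi (gmap x) * (cf j x * Rf j i x) = eta phi j i x.
    near=> y; rewrite etaE//.
    by near: y; apply: open_nbhs_nbhs; split => //; exact: open_hspace.
  have h5 := near_eq_is_derive near_eta h4.
  rewrite (@derive_val _ _ _ _ _ _ _ h5); congr (_ + _).
  rewrite !mulr_sumr; apply: eq_bigr => k _; ring.
under eq_bigr do rewrite h.
rewrite big_split/= -mulr_sumr div_cfRf// mulr0 add0r -mulr_sumr exchange_big/=.
under eq_bigr do rewrite -mulr_sumr sum_Rf_dgf//.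
rewrite (bigD1 j)//= eqxx big1 ?addr0; last first.
  by move=> k /negbTE kj; rewrite eq_sym kj mul0r mulr0.
rewrite /cf /Jf; case: ifPn => _; rewrite !exprS ?mulr1n; move: (2 ^+ n) ((Qf x)^-1 ^+ n) => a c; by field; rewrite ?D1 ?Q1.
Unshelve. all: by end_near. Qed.

Lemma expR_gf0 x : hs x -> expR (gf ord0 x) = Df x / Qf x.
Proof.
by move=> /hspace_pos[D0 Q0]; rewrite /gf eqxx -ln_div ?posrE// lnK ?posrE ?divr_gt0.
Qed.

(** In the half-space model the left side is the squared Euclidean distance from the point of height
    [h = D / Q] to the point at height [-1] over the origin, the centre of the inversion onto the
    ball. It recovers [Q], and then [D = h Q], from the coordinates. *)
Lemma sum_gf_sqr x : hs x ->
  (1 + Df x / Qf x) ^+ 2 + \sum_(k < n) gf (lift ord0 k) x ^+ 2 = 4 / Qf x.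
Proof.
move=> /hspace_pos[D0 Q0]; apply/esym.
under eq_bigr => k _.
  rewrite /gf eq_sym (negbTE (neq_lift _ _)) (_ : _ ^+ 2 = 4 / Qf x ^+ 2 * (x ord0 (lift ord0 k) ^+ 2)); last by field; rewrite gt_eqF.
  over.
rewrite -mulr_sumr.
have -> : \sum_(k < n) x ord0 (lift ord0 k) ^+ 2 = Qf x - zc ord0 x * zc ord0 x.
  rewrite /Qf big_ord_recl [_ + _ - _]addrC addrA addNr add0r.
  by apply: eq_bigr => k _; rewrite /zc subr0 expr2.
have := DfE x; move: (Df x) => D ->; field; by rewrite gt_eqF.
Qed.

(** Where the product does not vanish the coordinates are bounded, so [4 / Q] is bounded by
    [sum_gf_sqr], and [D = h Q] with [h >= exp (- M ord0)]. The pulled-back tests thus stay away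
    from the boundary of the ball. *)
Lemma prodf_gmap_support phi : (forall k, smooth_compact (phi k)) ->
  exists2 d : R, 0 < d &
    forall x, hs x -> prodf phi (gmap x) != 0 -> d <= Df x /\ d <= Qf x.
Proof.
move=> sp; have /choice[M HM] k : exists M : R, forall t, M <= `|t| -> phi k t = 0 by have [] := sp k.
pose A := (1 + expR (M ord0)) ^+ 2 + \sum_(k < n) (M (lift ord0 k)) ^+ 2.
have A0 : 0 < A by rewrite ltr_pwDl ?exprn_gt0 ?addr_gt0 ?expR_gt0// sumr_ge0// => k _; rewrite sqr_ge0.
exists (Num.min 1 (expR (- M ord0)) * (4 / A)).
  by rewrite mulr_gt0 ?lt_min ?ltr01 ?expR_gt0// divr_gt0.
move=> x hx; have [D0 Q0] := hspace_pos hx => p0.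
have gM k : `|gf k x| < M k.
  rewrite ltNge; apply/negP => /HM h; move: p0.
  by rewrite /prodf (bigD1 k)//= mxE h mul0r eqxx.
set h := Df x / Qf x.
have h0 : 0 < h by rewrite divr_gt0.
have /andP[hl hu] : expR (- M ord0) <= h <= expR (M ord0).
  have := gM ord0; rewrite ltr_norml /h -expR_gf0// !ler_expR => /andP[l1 l2].
  by rewrite !ltW.
have id4 := sum_gf_sqr hx.
have QA : 4 / A <= Qf x.
  rewrite ler_pdivrMr// mulrC -ler_pdivrMr// -id4 /A lerD//.
    by rewrite ler_sqr ?nnegrE ?lerD2l// addr_ge0 ?expR_ge0// ltW.
  apply: ler_sum => k _; have h1 := gM (lift ord0 k).
  rewrite -[leLHS]real_normK ?num_real// ler_sqr ?nnegrE ?(ltW h1)//.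
  exact: le_trans (normr_ge0 _) (ltW h1).
have A4 : 0 <= 4 / A by rewrite divr_ge0// ltW.
have m0 : 0 <= Num.min 1 (expR (- M ord0)) by rewrite le_min ler01 expR_ge0.
split; last first.
  by rewrite -[leRHS]mul1r ler_pM// ge_min lexx.
have -> : Df x = h * Qf x by rewrite /h divfK// gt_eqF.
by rewrite ler_pM// ge_min hl orbT.
Qed.

Lemma CkOn_Ck k (f : E -> R) : Ck0 setT k f -> Ck k f.
Proof.
elim: k f => [|k ih] f /=; first by move=> h x; exact: h.
move=> [h1 h2 h3]; split => [x|i x|i]; [exact: h1|exact: h2|exact/ih/h3].
Qed.

(** [eta] vanishes on the open set [Df < d], which together with the ball covers the whole space;
    [CkOn_setU] glues the two pieces. *)
Lemma eta_test phi j i : (forall k, smooth_compact (phi k)) -> test_function (eta phi j i).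
Proof.
move=> sp; have [d d0 Hd] := prodf_gmap_support sp.
have Z x : Df x < d -> eta phi j i x = 0.
  move=> xd; rewrite /eta patchE; case: ifPn => //; rewrite inE => hx.
  have [->|p0] := eqVneq (prodf phi (gmap x)) 0; first by rewrite mul0r.
  by have [+ _] := Hd _ hx p0; rewrite leNgt xd.
have oA : open [set x : E | Df x < d].
  rewrite (_ : [set _ | _] = @Df R n @^-1` [set t | t < d])//.
  by apply: open_comp => [x _|]; [exact: continuous_Df|exact: open_lt].
have CT k : Ck0 setT k (eta phi j i).
  have -> : setT = hs `|` [set x : E | Df x < d].
    apply/esym/seteqP; split => // x _; have [h|h] := ltP (Df x) d; [by right|left].
    by rewrite hspaceE /=; exact: lt_le_trans h.
  apply: CkOn_setU; first exact: CkOn_eta.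
  by apply: (@CkOn_eq _ _ _ _ _ _ (cst 0)) => //; [move=> x /Z ->|exact: CkOn_cst].
have sub : closure [set x | eta phi j i x != 0] `<=` [set x | d <= Df x].
  rewrite [X in _ `<=` X](_ : _ = closure [set x : E | d <= Df x]).
    apply: closure_subset => x /=; apply: contraR; rewrite -ltNge => /Z ->.
    by rewrite eqxx.
  rewrite -(closure_id _).1//.
  rewrite (_ : [set _ | _] = @Df R n @^-1` [set t | d <= t])//.
  by apply: closed_comp => [x _|]; [exact: continuous_Df|exact: closed_ge].
split; first by move=> k; exact/CkOn_Ck.
  apply: (@subclosed_compact _ _ [set v : E | forall i, `[(-1 : R), 1]%classic (v ord0 i)]).
  - exact: closed_closure.
  - by apply: (@rV_compact _ _ (fun=> `[(-1 : R), 1]%classic)) => _; exact: segment_compact.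
  - move=> x /sub /= dx m; rewrite /= in_itv/= -ler_norml.
    have : dotp x x < 1 by have := lt_le_trans d0 dx; rewrite /Df subr_gt0.
    rewrite /dotp (bigD1 m)//= => h.
    have h' : x ord0 m ^+ 2 < 1.
      apply: le_lt_trans h; rewrite expr2 lerDl; apply: sumr_ge0 => k _.
      by rewrite -expr2 sqr_ge0.
    by rewrite -(@ler_sqr R) ?nnegrE// real_normK ?num_real// expr1n ltW.
by move=> x /sub /= dx; rewrite hspaceE /=; exact: lt_le_trans dx.
Qed.

End test_functions.

Section open_measurable_rV.
Context (R : realType) (n : nat).

(** Links the topology with the sigma-algebra generated by the coordinates: an open set is the union
    of the rational boxes that it contains, of which there are countably many. *)
Lemma open_measurable_rV (U : set 'rV[R]_n) : open U -> measurable U.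
Proof.
move=> oU.
pose B (q : {ffun 'I_n -> rat * rat}) : set 'rV[R]_n :=
  box (fun i => ratr (q i).1) (fun i => ratr (q i).2).
rewrite (_ : U = \bigcup_q (if `[< B q `<=` U >] then B q else set0)).
  apply: countable_bigcupT_measurable; first exact: countableP.
  by move=> q; case: ifP => _ //; exact: measurable_box.
apply/seteqP; split => x; last by move=> [q _]; case: ifPn => // /asboolP; exact.
move=> Ux; have /nbhs_ballP[e /= e0 eU] : nbhs x U by exact: open_nbhs_nbhs.
have /choice[q1 H1] (i : 'I_n) : exists q : rat, x ord0 i - e < ratr q < x ord0 i.
  have /rat_in_itvoo[q] : x ord0 i - e < x ord0 i by rewrite gtrBl.
  by rewrite in_itv /=; exists q.
have /choice[q2 H2] (i : 'I_n) : exists q : rat, x ord0 i < ratr q < x ord0 i + e.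
  have /rat_in_itvoo[q] : x ord0 i < x ord0 i + e by rewrite ltrDl.
  by rewrite in_itv /=; exists q.
exists [ffun i => (q1 i, q2 i)] => //.
rewrite asboolT; first by move=> i; rewrite ffunE /=; have /andP[_ ->] := H1 i; have /andP[->] := H2 i.
move=> y By; apply: eU => /=; split => // i j; rewrite ord1.
have := By j; rewrite ffunE /= => /andP[h1 h2].
have /andP[h3 _] := H1 j; have /andP[_ h4] := H2 j.
rewrite /ball/= ltr_norml; apply/andP; split.
  by rewrite ltrBrDr addrC ltrBlDr (lt_trans h2)// addrC.
by rewrite ltrBlDr addrC -ltrBlDr (lt_trans h3).
Qed.

Lemma continuous_measurable_rV (f : 'rV[R]_n -> R) : continuous f -> measurable_fun setT f.
Proof.
move=> cf; apply: (@measurability _ _ _ _ _ _ (@RGenOInfty.G R)); first exact: RGenOInfty.measurableE.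
move=> _ [_ [x ->] <-]; rewrite setTI; apply: open_measurable_rV.
by apply: open_comp => [t _|]; [exact: cf|exact: interval_open].
Qed.

End open_measurable_rV.

Section integral_derivative.
Context (R : realType) (n : nat).
Local Notation lam := (@lebesgue_measure R).
Local Notation L := (@lebesgue_rV R).
Local Notation E := 'rV[R]_n.+1.
Local Notation b := (@basis_rV R n.+1).
Local Notation intgL n f := ((L n).-integrable setT (EFin \o f)).

Lemma is_derive_line (f : E -> R) (v w : E) (t df : R) : is_derive (t *: v + w) v f df ->
  is_derive t 1 (fun s : R => f (s *: v + w)) df.
Proof.
move=> /is_derive_lineP h; apply/is_derive_lineP; move: h.
by under eq_fun do rewrite addrA -scalerDl -[X in (X + _) *: _](mulr1 _).
Qed.

Lemma swapc_line i t (v : 'rV[R]_n) : swapc i (rV_cons (t, v)) = t *: b i + swapc i (rV_cons (0, v)).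
Proof.
apply/rowP => k; rewrite mxE [RHS]mxE [X in X + _]mxE [X in _ * X]mxE [X in _ + X]mxE eqxx /= -[k == i](inj_eq (@perm_inj _ (tperm ord0 i))) tpermR.
case: (unliftP ord0 (tperm ord0 i k)) => [l ->|->].
  by rewrite !rV_consS /= mulr0 add0r.
by rewrite !rV_cons0 eqxx mulr1 addr0.
Qed.

Lemma cube_hspace (x : E) i : hspace x -> `|x ord0 i| < 1.
Proof.
rewrite ltNge /hspace /= => hx; apply/negP => x1; move: hx; rewrite ltNge => /negP; apply.
rewrite /dotp (bigD1 i)//= -[leLHS]addr0 lerD//.
  by rewrite -expr2 -real_normK ?num_real// exprn_ege1.
by apply: sumr_ge0 => k _; rewrite -expr2 sqr_ge0.
Qed.

Lemma test_function_out (f : E -> R) (x : E) : test_function f -> ~ hspace x -> \near x, f x = 0.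
Proof.
move=> [_ _ sub] nhx; have nx : ~ closure [set x | f x != 0] x by move=> /sub.
have o : open (~` closure [set x | f x != 0]) by exact/closed_openC/closed_closure.
have : nbhs x (~` closure [set x | f x != 0]) by apply: open_nbhs_nbhs; split.
apply: filterS => y ny; apply/eqP; apply: contrapT => /negP h; apply: ny.
exact: subset_closure.
Qed.

Lemma test_function_derive (f : E -> R) i x : test_function f ->
  is_derive x (b i) f ('D_(b i) f x).
Proof. by move=> [/(_ 1%N) [_ h _] _ _]; apply/derivableP. Qed.

Lemma test_function_derive_out (f : E -> R) i (x : E) : test_function f ->
  ~ hspace x -> 'D_(b i) f x = 0.
Proof.
move=> tf /(test_function_out tf) h.
have h' : \near x, f x = cst 0 x by apply: filterS h.
by rewrite (near_eq_derive _ h') derive_cst.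
Qed.

Lemma indicator_cube_intg : intgL n.+1 \1_(box (fun _ : 'I_n.+1 => -1 : R) (fun=> 1)).
Proof.
have mb := measurable_box (fun _ : 'I_n.+1 => -1 : R) (fun=> 1).
apply/integrableP; split; first by apply/measurable_EFinP.
under eq_integral do rewrite /= ger0_norm//.
by rewrite integral_indic// setIT; exact: lebesgue_rV_box_fin.
Qed.

Lemma bounded_hspace_intg (f : E -> R) (C : R) : measurable_fun setT f ->
  (forall x, `|f x| <= C) -> (forall x, ~ hspace x -> f x = 0) -> intgL n.+1 f.
Proof.
move=> mf HC f0; apply: (le_intg mf _ (intgZ C indicator_cube_intg)) => x.
rewrite indicE; have [h|h] := boolP (x \in _); first by rewrite mulr1.
rewrite f0 ?normr0 ?mulr0// => hx; move: h; rewrite mem_set// => m.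
by rewrite -ltr_norml; exact: cube_hspace.
Qed.

Lemma continuous_hspace_bounded (f : E -> R) : continuous f ->
  (forall x, ~ hspace x -> f x = 0) -> exists C : R, forall x, `|f x| <= C.
Proof.
move=> cf f0.
have cK : compact [set v : E | forall i, `[(-1 : R), 1]%classic (v ord0 i)].
  by apply: (@rV_compact _ _ (fun=> `[(-1 : R), 1]%classic)) => _; exact: segment_compact.
have [C [_ HC]] := compact_bounded (continuous_compact (continuous_subspaceT cf) cK).
exists (Num.max (C + 1) 0) => x.
have [hx|nhx] := pselect (hspace x); last by rewrite f0// normr0 le_max lexx orbT.
rewrite le_max; apply/orP; left; apply: (HC (C + 1)); first by rewrite ltrDl.
exists x => //= m; rewrite in_itv/= -ler_norml ltW//; exact: cube_hspace.
Qed.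

Lemma test_function_derive_intg (f : E -> R) i : test_function f ->
  intgL n.+1 (fun x => 'D_(b i) f x).
Proof.
move=> tf; have cf : continuous (fun x => 'D_(b i) f x).
  by have [/(_ 1%N) [_ _ /(_ i) h] _ _] := tf; exact: h.
have out x : ~ hspace x -> 'D_(b i) f x = 0 by exact: test_function_derive_out.
have [C HC] := continuous_hspace_bounded cf out.
exact: (bounded_hspace_intg (continuous_measurable_rV cf) HC out).
Qed.

(** Fundamental theorem of calculus on each line in direction [i]: beyond parameters [-1] and [1]
    the line has left the ball, and [f] vanishes there. *)
Lemma test_function_derive_integral (f : E -> R) i : test_function f ->
  \int[L n.+1]_x 'D_(b i) f x = 0.
Proof.
move=> tf; have fi := test_function_derive_intg i tf.
rewrite -(Rintegral_swapc i (integrable_measurable fi)).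
have si := intg_swapc i fi.
rewrite Rintegral_cons// (@Rfubini2 _ _ _ _ _ lam (L n) _ (intg_cons si)).
rewrite -[RHS](_ : \int[L n]_v 0 = 0); last by rewrite /Rintegral integral0.
apply: eq_Rintegral => v _.
set w := swapc i (rV_cons (0, v)).
pose G (t : R) := f (t *: b i + w); pose g (t : R) := 'D_(b i) f (t *: b i + w).
have dG (t : R) : is_derive t 1 G (g t) by apply: is_derive_line; exact: test_function_derive.
have cg : continuous g.
  move=> t; apply: (@continuous_comp R E R (fun t : R => t *: b i + w) (fun x => 'D_(b i) f x)).
    apply: (@cvgD _ E); last exact: cvg_cst.
    by apply: cvgZr_tmp; exact: cvg_id.
  by have [/(_ 1%N) [_ _ /(_ i) h] _ _] := tf; exact: h.
have out (t : R) : 1 <= `|t| -> ~ hspace (t *: b i + w).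
  move=> t1 /(cube_hspace i); rewrite /w -swapc_line mxE tpermR rV_cons0 /= ltNge.
  by rewrite t1.
have g0 (t : R) : 1 <= `|t| -> g t = 0 by move=> /out; exact: test_function_derive_out.
have G0 (t : R) : 1 <= `|t| -> G t = 0.
  by move=> /out h; have /nbhs_singleton := test_function_out tf h.
under eq_Rintegral do rewrite swapc_line -/w -/(g _).
rewrite -[RHS](subrr 0) -[X in X - _](G0 1) ?normr1// -[X in _ - X](G0 (-1)) ?normrN1//.
have m11 : (-1 : R) <= 1 by lra.
rewrite -(FTC2_closed m11 (fun x _ => dG x) (fun x _ => cg x)).
rewrite [RHS]Rintegral_mkcond; apply: eq_Rintegral => t _.
rewrite patchE mem_setE in_itv/= -ler_norml; case: ifPn => //; rewrite -ltNge => h.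
by rewrite g0// ltW.
Qed.

End integral_derivative.

(** * The image of [J dx] under the half-space coordinates *)

Section pushforward_horospherical.
Context (R : realType) (n : nat).
Local Notation lam := (@lebesgue_measure R).
Local Notation L := (@lebesgue_rV R).
Local Notation E := 'rV[R]_n.+1.
Local Notation b := (@basis_rV R n.+1).
Local Notation hs := (@hspace R n.+1).
Local Notation intgL n f := ((L n).-integrable setT (EFin \o f)).
Implicit Types (phi : 'I_n.+1 -> R -> R) (F : E -> R).

Lemma Rintegral_prodf m (phi : 'I_m -> R -> R) : (forall k, smooth_compact (phi k)) ->
  \int[L m]_y prodf phi y = \prod_k \int[lam]_t phi k t.
Proof.
elim: m phi => [|m ih] phi sp.
  rewrite big_ord0 (_ : prodf phi = cst 1); last by apply/funext => y; rewrite /prodf big_ord0.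
  by rewrite /Rintegral /= integral_dirac// diracT mul1e.
rewrite Rintegral_cons; last exact: prodf_intg.
rewrite big_ord_recl -(ih (fun k => phi (lift ord0 k)))//.
have i1 := smooth_compact_intg (sp ord0).
have i2 : intgL m (prodf (fun k => phi (lift ord0 k))) by exact: prodf_intg.
rewrite [in LHS](fcons_eta phi).
under eq_Rintegral do rewrite prodf_fcons rV_cons0 prod_tail_cons.
rewrite (@Rfubini1 _ _ _ _ _ lam (L m) _ (@integrable_prodM _ _ _ _ _ lam (L m) _ _ i1 i2)) /=.
under eq_Rintegral do rewrite RintegralZ// mulrC.
by rewrite RintegralZ// mulrC.
Qed.

Lemma measurable_Qf : measurable_fun setT (@Qf R n).
Proof. by apply: continuous_measurable_rV => x; exact: (CkOn_Qf R n 0). Qed.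

Lemma measurable_Df : measurable_fun setT (@Df R n).
Proof. by apply: continuous_measurable_rV; exact: continuous_Df. Qed.

Lemma measurable_gf k : measurable_fun setT (@gf R n k).
Proof.
rewrite /gf; case: (k == ord0).
  apply: measurable_funB.
    by apply: (measurableT_comp (@measurable_ln R)); exact: measurable_Df.
  by apply: (measurableT_comp (@measurable_ln R)); exact: measurable_Qf.
apply: measurable_funM => //; apply: measurable_funM; first exact: measurable_coord.
by apply: measurable_invr; exact: measurable_Qf.
Qed.

Lemma measurable_gmap : measurable_fun setT (@gmap R n).
Proof. by apply: measurable_fun_rVP => k; under eq_fun do rewrite mxE; exact: measurable_gf. Qed.

Definition Jr : E -> R := @Jf R n \_ hs.

Lemma JrE x : hs x -> Jr x = Jf x.
Proof. by move=> hx; rewrite /Jr patchE mem_set. Qed.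

Lemma Jr_out x : ~ hs x -> Jr x = 0.
Proof. by move=> hx; rewrite /Jr patchE memNset. Qed.

Lemma measurable_Jr : measurable_fun setT Jr.
Proof.
apply/(measurable_restrictT (@Jf R n) (@measurable_hspace R n.+1)); apply: measurable_funTS.
apply: measurable_funM => //; apply: measurable_funM.
  by apply: measurable_invr; exact: measurable_Df.
by apply: measurable_funX; apply: measurable_invr; exact: measurable_Qf.
Qed.

Lemma Jr_ge0 x : 0 <= Jr x.
Proof.
have [hx|nx] := pselect (hs x); last by rewrite Jr_out.
have [D0 Q0] := hspace_pos hx; rewrite JrE// /Jf.
by rewrite mulr_ge0 ?exprn_ge0// mulr_ge0 ?exprn_ge0// invr_ge0 ltW.
Qed.

Let T phi := \int[L n.+1]_x (prodf phi (gmap x) * Jr x).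

Lemma measurable_prodf_gmap phi : (forall k, smooth_compact (phi k)) ->
  measurable_fun setT (fun x : E => prodf phi (gmap x)).
Proof. by move=> sp; apply: (measurableT_comp (prod_test_measurable sp)); exact: measurable_gmap. Qed.

Lemma prodf_gmap_bounded phi : (forall k, smooth_compact (phi k)) ->
  exists C : R, forall x, `|prodf phi (gmap x) * Jr x| <= C.
Proof.
move=> sp; have [C HC] := prod_test_bounded sp.
have [d d0 Hd] := prodf_gmap_support sp.
have C0 : 0 <= C by exact: le_trans (normr_ge0 _) (HC 0).
exists (C * (2 ^+ n.+1 * (d^-1 * d^-1 ^+ n))) => x.
have K0 : 0 <= C * (2 ^+ n.+1 * (d^-1 * d^-1 ^+ n)).
  by rewrite !mulr_ge0 ?exprn_ge0// ?invr_ge0 ltW.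
have [hx|nx] := pselect (hs x); last by rewrite Jr_out// mulr0 normr0.
have [->|p0] := eqVneq (prodf phi (gmap x)) 0; first by rewrite mul0r normr0.
have [dD dQ] := Hd x hx p0; have [D0 Q0] := hspace_pos hx.
rewrite normrM ler_pM//; first exact: HC.
rewrite ger0_norm ?Jr_ge0// JrE// /Jf ler_pM2l ?exprn_gt0//.
rewrite ler_pM ?exprn_ge0 ?invr_ge0 ?(ltW D0) ?(ltW Q0) ?lef_pV2 ?posrE//.
by rewrite lerXn2r ?nnegrE ?invr_ge0 ?(ltW d0) ?(ltW Q0)// lef_pV2 ?posrE.
Qed.

Lemma prodf_gmap_intg phi : (forall k, smooth_compact (phi k)) ->
  intgL n.+1 (fun x => prodf phi (gmap x) * Jr x).
Proof.
move=> sp; have [C HC] := prodf_gmap_bounded sp.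
apply: (bounded_hspace_intg _ HC) => [|x nx]; last by rewrite Jr_out// mulr0.
by apply: measurable_funM; [exact: measurable_prodf_gmap|exact: measurable_Jr].
Qed.

(** Divergence theorem: the integrand is the divergence of the field [eta phi j]. Since [T]
    annihilates derivatives in each variable, it only sees the integrals of the factors of [phi]. *)
Lemma Tder_at j phi : (forall k, smooth_compact (phi k)) -> T (der_at j phi) = 0.
Proof.
move=> sp; have tf i : test_function (eta phi j i) by exact: eta_test.
rewrite /T (_ : (fun x => _) = fun x => \sum_i 'D_(b i) (eta phi j i) x).
  rewrite Rintegral_sum; first by rewrite big1// => i _; exact: test_function_derive_integral.
  by move=> i; exact: test_function_derive_intg.
apply/funext => x; have [hx|nx] := pselect (hs x).
  by rewrite div_eta// JrE// mulrC.
by rewrite Jr_out// mulr0 big1// => i _; exact: test_function_derive_out.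
Qed.

Let updf phi j (f : R -> R) : 'I_n.+1 -> R -> R := fun k => if k == j then f else phi k.

Let updf_sc phi j f : (forall k, smooth_compact (phi k)) -> smooth_compact f ->
  forall k, smooth_compact (updf phi j f k).
Proof. by move=> sp sf k; rewrite /updf; case: ifP. Qed.

Let prodf_updf phi j f y :
  prodf (updf phi j f) y = f (y ord0 j) * \prod_(k | k != j) phi k (y ord0 k).
Proof.
rewrite /prodf (bigD1 j)//= /updf eqxx; congr (_ * _).
by apply: eq_bigr => k /negbTE ->.
Qed.

Lemma smooth_compact_prim (f : R -> R) : smooth_compact f -> \int[lam]_t f t = 0 ->
  smooth_compact (prim f).
Proof.
move=> sf f0; split; first exact: smooth_prim.
have [_ [M HM]] := sf; exists (Num.max M 0 + 1) => t tM.
have M1 : M <= Num.max M 0 by rewrite le_max lexx.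
have M2 : 0 <= Num.max M 0 by rewrite le_max lexx orbT.
have [t0|t0] := leP 0 t; rewrite primE.
  rewrite -[RHS]f0; apply: eq_Rintegral => r _; rewrite /cutl.
  case: (leP r t) => rt; rewrite ?mul1r// mul0r HM// ger0_norm ?(le_trans t0 (ltW rt))//.
  by move: tM; rewrite ger0_norm//; lra.
rewrite (_ : cutl f t = cst 0); first by rewrite Rintegral_cst// mul0r.
apply/funext => r; rewrite /cutl; case: (leP r t) => rt; rewrite ?mul1r ?mul0r//.
rewrite HM// ler0_norm; last by rewrite (le_trans rt)// ltW.
by move: tM; rewrite ltr0_norm//; lra.
Qed.

Variable omega : R -> R.
Hypotheses (so : smooth_compact omega) (omega0 : forall t, 0 <= omega t)
  (omega1 : \int[lam]_t omega t = 1).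

(** Subtracting [I * omega] from the [j]-th factor leaves a function of integral 0, that is, the
    derivative of the test function [prim f], which [Tder_at] kills. *)
Let T_updf j phi : (forall k, smooth_compact (phi k)) ->
  T phi = \int[lam]_t phi j t * T (updf phi j omega).
Proof.
move=> sp; set I := \int[lam]_t phi j t.
pose f t := phi j t - I * omega t.
have oi := smooth_compact_intg so; have pi := smooth_compact_intg (sp j).
have sf : smooth_compact f.
  split.
    by move=> k; apply: CkOnB; [exact: openT|exact: (sp j).1|apply: CkOnZ; [exact: openT|exact: so.1]].
  have [_ [M1 H1]] := sp j; have [_ [M2 H2]] := so; exists (Num.max M1 M2) => t.
  by rewrite ge_max => /andP[h1 h2]; rewrite /f H1// H2// mulr0 subr0.
have f0 : \int[lam]_t f t = 0.
  by rewrite RintegralB//; [rewrite RintegralZ// omega1 mulr1 subrr|exact: intgZ].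
have sa := smooth_compact_prim sf f0.
have := Tder_at j (updf_sc j sp sa).
have -> : der_at j (updf phi j (prim f)) = updf phi j f.
  apply/funext => k; rewrite /der_at /updf; case: eqP => // _; apply/funext => t.
  have h : is_derive t 1 (prim f) (f t).
    by apply: is_derive_prim; [exact: smooth_compact_intg|exact: (smooth_continuous sf.1)].
  exact: (@derive_val _ _ _ _ _ _ _ h).
have i1 := prodf_gmap_intg sp; have i2 := prodf_gmap_intg (updf_sc j sp so).
rewrite /T (_ : (fun x => _) = fun x => prodf phi (gmap x) * Jr x -
    I * (prodf (updf phi j omega) (gmap x) * Jr x)).
  rewrite RintegralB//; last exact: intgZ.
  by rewrite RintegralZ// => /eqP; rewrite subr_eq0 => /eqP.
apply/funext => x; rewrite !prodf_updf /f.
rewrite (_ : prodf phi (gmap x) = phi j (gmap x ord0 j) * \prod_(k | k != j) phi k (gmap x ord0 k)).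
  by ring.
by rewrite /prodf (bigD1 j).
Qed.

Let T_prod phi : (forall k, smooth_compact (phi k)) ->
  T phi = (\prod_k \int[lam]_t phi k t) * T (fun=> omega).
Proof.
move=> sp.
have H (s : seq 'I_n.+1) : uniq s -> T phi = (\prod_(k <- s) \int[lam]_t phi k t) *
    T (fun k => if k \in s then omega else phi k).
  elim: s => [_|j s ih /= /andP[js us]].
    by rewrite big_nil mul1r.
  rewrite (ih us) (@T_updf j); last by move=> k; case: ifP.
  rewrite (negbTE js) big_cons mulrA [X in X * _ = _]mulrC; congr (_ * T _).
  by apply/funext => k; rewrite /updf inE; case: (k == j).
have := H (enum 'I_n.+1) (enum_uniq _); rewrite big_enum => ->.
by congr (_ * T _); apply/funext => k; rewrite mem_enum.
Qed.

Let c := T (fun=> omega).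

Let c0 : 0 <= c.
Proof.
apply: Rintegral_ge0 => x _; rewrite mulr_ge0 ?Jr_ge0//.
by rewrite /prodf prodr_ge0.
Qed.

Let mu0 : {measure set E -> \bar R} := density (L n.+1) measurable_Jr Jr_ge0.
Let mc : {measure set E -> \bar R} := density (L n.+1) (measurable_cst c) (fun=> c0).

Let mcE A : measurable A -> mc A = (c%:E * L n.+1 A)%E.
Proof.
move=> mA; transitivity (\int[L n.+1]_(x in A) (cst c%:E x))%E; first by [].
by rewrite integral_cst.
Qed.

Let pushE A : measurable A -> mu0 (@gmap R n @^-1` A) = mc A.
Proof.
have [m' m'E] := pushforward_measure mu0 measurable_gmap.
have H : forall A, measurable A -> mc A = m' A.
  apply: measure_box_unique; last first.
    move=> a e; rewrite mcE; last exact: measurable_box.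
    have := lebesgue_rV_box_fin a e => h.
    by rewrite lte_mul_pinfty// lee_fin.
  apply: box_measure_tests => phi sp phi0.
  have mp : measurable_fun setT (fun y : E => (\prod_k phi k (y ord0 k))%:E).
    by apply/measurable_EFinP; exact: prod_test_measurable.
  have p0 (y : E) : (0 <= (\prod_k phi k (y ord0 k))%:E)%E by rewrite lee_fin prodr_ge0.
  rewrite (@ge0_integral_density _ _ _ (L n.+1) mc (cst c))//.
  have -> : (\int[m']_y (\prod_k phi k (y ord0 k))%:E =
      \int[mu0]_x (prodf phi (gmap x))%:E)%E.
    have := @ge0_integral_pushforward _ _ _ _ R _ measurable_gmap mu0 setT _ measurableT mp (fun y _ => p0 y).
    rewrite preimage_setT => <-.
    apply: eq_measure_integral; first exact: measurable_gmap.
    by move=> ? B mB _; rewrite m'E.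
  rewrite (@ge0_integral_density _ _ _ (L n.+1) mu0 Jr)//; [|exact: measurable_Jr|exact: Jr_ge0|..]; last 2 first.
  - by apply/measurable_EFinP; exact: measurable_prodf_gmap.
  - by move=> x; exact: p0.
  transitivity (T phi)%:E.
    transitivity (\int[L n.+1]_x (c * prodf phi x)%:E)%E.
      by apply: eq_integral => x _; rewrite -EFinM mulrC.
    rewrite -EFin_Rintegral; last by apply: intgZ; exact: prodf_intg.
    rewrite RintegralZ; last exact: prodf_intg.
    by rewrite Rintegral_prodf// (T_prod sp) mulrC.
  rewrite [LHS](EFin_Rintegral (prodf_gmap_intg sp)).
  by apply: eq_integral => x _; rewrite EFinM.
by move=> mA; rewrite H// m'E.
Qed.

(* In fact c = 1.  Only 1 <= c matters, and it follows from the volumes of small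
   cubes (pushforward_constant_ge1). *)
Lemma pushforward_horospherical0 : exists c : R, 0 <= c /\
  (forall A, measurable A -> (\int[L n.+1]_(x in @gmap R n @^-1` A) (Jr x)%:E)%E = (c%:E * L n.+1 A)%E) /\
  forall F, measurable_fun setT F ->
    (\int[L n.+1]_x (F (gmap x) * Jr x)%:E = \int[L n.+1]_y (F y * c)%:E)%E.
Proof.
exists c; split; first exact: c0; split.
  by move=> A mA; rewrite -mcE// -pushE.
move=> F mF.
have mE : measurable_fun setT (EFin \o F) by exact/measurable_EFinP.
have mFg : measurable_fun setT (fun x => F (gmap x)).
  by apply: (measurableT_comp mF); exact: measurable_gmap.
have ge0 G : measurable_fun setT G -> (forall y, 0 <= G y)%E ->
    (\int[mu0]_x G (gmap x) = \int[mc]_y G y)%E.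
  move=> mG G0.
  have := @ge0_integral_pushforward _ _ _ _ R _ measurable_gmap mu0 setT _ measurableT mG (fun y _ => G0 y).
  rewrite preimage_setT => <-.
  apply: eq_measure_integral; first exact: measurable_gmap.
  by move=> ? B mB _; exact: pushE.
rewrite -(@integral_density _ _ _ (L n.+1) mu0 Jr measurable_Jr Jr_ge0)//.
rewrite -(@integral_density _ _ _ (L n.+1) mc (cst c))//.
rewrite integralE [RHS]integralE; congr (_ - _)%E.
  rewrite -[RHS]ge0//; last exact: measurable_funepos.
  by apply: eq_integral => x _; rewrite !funeposE.
rewrite -[RHS]ge0//; last exact: measurable_funeneg.
by apply: eq_integral => x _; rewrite !funenegE.
Qed.

End pushforward_horospherical.

Section pushforward_constant.
Context (R : realType) (n : nat).
Local Notation lam := (@lebesgue_measure R).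
Local Notation L := (@lebesgue_rV R).
Local Notation E := 'rV[R]_n.+1.
Local Notation hs := (@hspace R n.+1).
Local Notation intgL n f := ((L n).-integrable setT (EFin \o f)).

Lemma exists_unit_test : exists omega : R -> R,
  [/\ smooth_compact omega, forall t, 0 <= omega t & \int[lam]_t omega t = 1].
Proof.
have m11 : (-1 : R) < 1 by lra.
pose f := bump (-1 : R) 1 0.
have sf : smooth_compact f by exact: bump_smooth_compact.
have f0 t : 0 <= f t by exact: bump_ge0.
have fi := smooth_compact_intg sf.
have If : 0 < \int[lam]_t f t.
  rewrite lt_def; apply/andP; split; last by apply: Rintegral_ge0.
  apply/eqP => I0.
  have p0 : prim f = cst 0.
    apply/funext => x; apply/eqP; rewrite eq_le prim_ge0// andbT.
    by rewrite (le_trans (prim_le x fi f0))// I0.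
  have h : is_derive (0 : R) 1 (prim f) (f 0).
    by apply: is_derive_prim => //; exact: (smooth_continuous sf.1).
  have := @derive_val _ _ _ _ _ _ _ h; rewrite p0 derive_cst => /esym.
  rewrite /f /bump (_ : _ * _ = 1); last by rewrite sub0r opprK subr0 !mulr1.
  rewrite /flat ltr01 expr0 mul1r => /eqP.
  by rewrite gt_eqF// expR_gt0.
exists (fun t => f t * (\int[lam]_t f t)^-1); split.
- by apply: smooth_compactM => // k; apply: CkOn_cst; exact: openT.
- by move=> t; rewrite mulr_ge0// invr_ge0 ltW.
- under eq_Rintegral do rewrite mulrC.
  by rewrite RintegralZ// mulVf// gt_eqF.
Qed.

(** On the cube of half-side [e < 1] one has [|x|^2 <= (n + 1) e^2], so [Df] and [Qf] differ from 1
    by at most [(n + 3) e = C e]. *)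
Let C : R := n.+1%:R + 2.

Let C0 : 0 < C. Proof. by rewrite /C addr_gt0. Qed.

(** Near 0 the coordinates are [2 x] to first order and [Jf] is close to [2^(n+1)]; this is the
    quantitative form on a cube. *)
Lemma gmap_small (x : E) (e : R) : 0 < e -> C * e < 1 ->
  (forall i, - e < x ord0 i < e) ->
  [/\ hs x, forall k, `|gf k x| < 2 * e * (1 + C * e) / (1 - C * e) &
      2 ^+ n.+1 * (1 + C * e)^-1 ^+ n <= Jf x].
Proof.
move=> e0 Ce xe.
have C2 : n.+1%:R = C - 2 by rewrite /C addrK.
have n0 : 1 <= n.+1%:R :> R by rewrite ler1n.
have e1 : e < 1 by move: Ce; rewrite /C; nra.
have S0 : 0 <= dotp x x by apply: sumr_ge0 => i _; rewrite -expr2 sqr_ge0.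
have S1 : dotp x x <= (C - 2) * e * e.
  rewrite -C2 /dotp -mulrA mulr_natl -[X in _ *+ X]card_ord -sumr_const.
  apply: ler_sum => i _; have /andP[h1 h2] := xe i; nra.
have D1 : Df x = 1 - dotp x x by [].
have Q1 : Qf x = 1 - 2 * x ord0 ord0 + dotp x x.
  have := DfE x; rewrite D1 /zc eqxx mulr1n => h; lra.
have /andP[x1 x2] := xe ord0.
have Se : dotp x x <= (C - 2) * e by apply: (le_trans S1); move: n0; rewrite C2; nra.
have Dl : 1 - C * e <= Df x by rewrite D1; nra.
have Ql : 1 - C * e <= Qf x by rewrite Q1; nra.
have Qu : Qf x <= 1 + C * e by rewrite Q1; nra.
have Du : Df x <= 1 by rewrite D1; lra.
have d0 : 0 < 1 - C * e by rewrite subr_gt0.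
have Dp : 0 < Df x by exact: lt_le_trans Dl.
have Qp : 0 < Qf x by exact: lt_le_trans Ql.
have p1 : 0 < 1 + C * e by nra.
split.
- by rewrite hspaceE.
- have B (a q : R) : 1 - C * e <= q -> a < 2 * e * (1 + C * e) -> a / q < 2 * e * (1 + C * e) / (1 - C * e).
    move=> hq ha; have q0 : 0 < q by exact: lt_le_trans hq.
    have [a0|a0] := leP a 0.
      apply: (@le_lt_trans _ _ 0); first by rewrite pmulr_lle0// invr_gt0.
      by rewrite divr_gt0// mulr_gt0// mulr_gt0.
    apply: (@lt_le_trans _ _ (2 * e * (1 + C * e) / q)); first by rewrite ltr_pM2r// invr_gt0.
    by rewrite ler_pM2l ?mulr_gt0// lef_pV2 ?posrE.
  move=> k; rewrite /gf; case: ifPn => k0; rewrite ltr_norml; apply/andP; split.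
  + rewrite ltrNl opprB -ln_div ?posrE//; apply: le_lt_trans (ln_le_sub1 _) _; first by rewrite divr_gt0.
    rewrite -[X in _ - X](@divff _ (Df x)) ?gt_eqF// -mulrBl; apply: B => //.
    by rewrite Q1 D1; move: n0; rewrite C2; nra.
  + rewrite -ln_div ?posrE//; apply: le_lt_trans (ln_le_sub1 _) _; first by rewrite divr_gt0.
    rewrite -[X in _ - X](@divff _ (Qf x)) ?gt_eqF// -mulrBl; apply: B => //.
    by rewrite Q1 D1; nra.
  + have /andP[h1 h2] := xe k; rewrite ltrNl mulrA -mulNr; apply: B => //; nra.
  + have /andP[h1 h2] := xe k; rewrite mulrA; apply: B => //; nra.
- rewrite /Jf ler_pM2l ?exprn_gt0// -[leLHS]mul1r ler_pM ?exprn_ge0 ?invr_ge0 ?(ltW p1)//.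
    by rewrite invf_ge1.
  by rewrite lerXn2r ?nnegrE ?invr_ge0 ?(ltW p1) ?(ltW Qp)// lef_pV2 ?posrE.
Qed.

(** A cube of half-side [e] has [J dx]-mass at least [K (2 e)^(n+1)] and lies in the preimage of a
    cube of half-side [r], whose mass is [c (2 r)^(n+1)]. By [gmap_small] the ratio of the two
    quantities tends to [c] as [e -> 0]. *)
Lemma pushforward_constant_ge1 (c : R) : 0 <= c ->
  (forall A, measurable A -> (\int[L n.+1]_(x in @gmap R n @^-1` A) (Jr x)%:E)%E = (c%:E * L n.+1 A)%E) ->
  1 <= c.
Proof.
move=> c0 H.
(* [h d] is the ratio of [(2 r)^(n+1)] to [K (2 e)^(n+1)] for [e = d / C]; it is continuous at [0]
   with value 1. *)
pose h (d : R) := ((1 + d) / (1 - d)) ^+ n.+1 * (1 + d) ^+ n.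
have hc (d : R) : 0 < d < 1 -> 1 <= c * h d.
  move=> /andP[d0 d1]; pose e := d / C; have e0 : 0 < e by rewrite divr_gt0.
  have Ce : C * e = d by rewrite /e mulrC divfK// gt_eqF.
  pose r := 2 * e * (1 + d) / (1 - d).
  have d2 : 0 < 1 + d by rewrite addr_gt0.
  have d3 : 0 < 1 - d by rewrite subr_gt0.
  have r0 : 0 < r by rewrite /r divr_gt0// mulr_gt0// mulr_gt0.
  pose K := 2 ^+ n.+1 * (1 + d)^-1 ^+ n.
  have small (x : E) : box (fun=> - e) (fun=> e) x ->
      [/\ hs x, forall k, `|gf k x| < r & K <= Jf x].
    by move=> xe; have := @gmap_small x e e0; rewrite Ce => /(_ d1 xe).
  have cube (a : R) : 0 < a -> L n.+1 (box (fun=> - a) (fun=> a)) = ((2 * a) ^+ n.+1)%:E.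
    move=> a0; apply: etrans (lebesgue_rV_box _ _) _; congr EFin.
    rewrite prodr_const card_ord; congr (_ ^+ _).
    by rewrite max_l; [ring|lra].
  have := H (box (fun=> - r) (fun=> r)) (measurable_box _ _); rewrite cube// => HE.
  have K0 : 0 <= K by rewrite mulr_ge0 ?exprn_ge0// invr_ge0 addr_ge0// ltW.
  have : ((K * (2 * e) ^+ n.+1)%:E <= (c * (2 * r) ^+ n.+1)%:E)%E.
    pose Be : set E := box (fun=> - e) (fun=> e); pose Br : set E := box (fun=> - r) (fun=> r).
    have X1 : (K%:E * L n.+1 Be <=
        \int[L n.+1]_(x in Be) (Jr x)%:E)%E.
      have mb : measurable Be by exact: measurable_box.
      rewrite -(integral_cst (L n.+1) mb).
      apply: ge0_le_integral => //.
      - by apply: measurable_funTS; apply/measurable_EFinP; exact: measurable_Jr.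
      - by move=> x /small[hx _ kJ]; rewrite lee_fin JrE.
    have X2 : (\int[L n.+1]_(x in Be) (Jr x)%:E <=
        \int[L n.+1]_(x in @gmap R n @^-1` Br) (Jr x)%:E)%E.
      apply: ge0_subset_integral => //.
      - exact: measurable_box.
      - rewrite -[X in measurable X]setTI; apply: measurable_gmap => //; exact: measurable_box.
      - by apply: measurable_funTS; apply/measurable_EFinP; exact: measurable_Jr.
      - by move=> x _; rewrite lee_fin Jr_ge0.
      - by move=> x /small[_ gr _] k /=; rewrite mxE -ltr_norml.
    by rewrite [leRHS]EFinM -HE EFinM -(cube e e0); exact: le_trans X1 X2.
  rewrite lee_fin => KK; rewrite -(@ler_pM2l _ (K * (2 * e) ^+ n.+1)); last first.
    have p2e : 0 < 2 * e by rewrite mulr_gt0.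
    have pd : 0 < (1 + d)^-1 by rewrite invr_gt0.
    by apply: mulr_gt0; [apply: mulr_gt0; exact: exprn_gt0|exact: exprn_gt0].
  rewrite mulr1; apply: le_trans KK _; rewrite le_eqVlt; apply/orP; left; apply/eqP.
  have E2r : 2 * r = 2 * e * (2 * ((1 + d) / (1 - d))) by rewrite /r; ring.
  rewrite E2r exprMn [X in c * (_ * X)]exprMn /K /h exprVn.
  have : (1 + d) ^+ n != 0 by rewrite expf_neq0// gt_eqF.
  move: ((1 + d) ^+ n) (((1 + d) / (1 - d)) ^+ n.+1) ((2 * e) ^+ n.+1) (2 ^+ n.+1) => q a1 a2 a3 q0.
  by field.
have lim : c * h (m.+2%:R^-1) @[m --> \oo] --> c * h 0.
  apply: (@cvgM R); first exact: cvg_cst.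
  have l0 : (m.+2%:R^-1 : R) @[m --> \oo] --> (0 : R).
    by have := @cvg_harmonic R; rewrite -(cvg_shiftS (@harmonic R)).
  have l1 : 1 + (m.+2%:R^-1 : R) @[m --> \oo] --> (1 + 0 : R).
    by apply: (@cvgD _ R^o) => //; exact: cvg_cst.
  have l2 : 1 - (m.+2%:R^-1 : R) @[m --> \oo] --> (1 - 0 : R).
    by apply: (@cvgB _ R^o) => //; exact: cvg_cst.
  apply: (@cvgM R); last exact: (continuous_cvg _ (@exprn_continuous _ _ _)).
  apply: (continuous_cvg _ (@exprn_continuous _ _ _)); apply: (@cvgM R) => //.
  by apply: (@cvgV R) => //; rewrite subr0 oner_eq0.
have <- : c * h 0 = c by rewrite /h !(addr0, subr0) divff ?oner_eq0// !expr1n !mulr1.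
apply: (cvgr_to_ge lim); apply: nearW => m; apply: hc.
by rewrite invr_gt0 ltr0n/= invf_lt1// ltr1n.
Qed.

Lemma pushforward_horospherical : exists c : R, 1 <= c /\
  forall F : E -> R, measurable_fun setT F ->
    (\int[L n.+1]_x (F (gmap x) * Jr x)%:E = \int[L n.+1]_y (F y * c)%:E)%E.
Proof.
have [omega [so o0 o1]] := exists_unit_test.
have [c [c0 [H1 H2]]] := @pushforward_horospherical0 R n omega so o0 o1.
by exists c; split => //; exact: pushforward_constant_ge1.
Qed.

End pushforward_constant.

(** * The weighted inequality *)

Section weighted_log_sobolev.
Context (R : realType) (n : nat).
Local Notation lam := (@lebesgue_measure R).
Local Notation L := (@lebesgue_rV R).
Local Notation E := 'rV[R]_n.+1.
Local Notation intg f := (lam.-integrable setT (EFin \o f)).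
Local Notation intgL n f := ((L n).-integrable setT (EFin \o f)).

Lemma ae_line_upd j (f : E -> R) : intgL n.+1 f ->
  {ae L n.+1, forall y, intg (fun t => f (upd y j t))}.
Proof.
move=> fi; have H := ae_line (intg_swapc j fi).
have H1 := @ae_snd _ _ _ _ _ lam (L n) _ H.
have H2 : {ae L n.+1, forall y, intg (fun t => f (swapc j (upd y ord0 t)))}.
  apply: rVS_ae; apply: (ae_imp H1) => -[s v] /=.
  by under [X in _ -> lam.-integrable _ (EFin \o X)]eq_fun do rewrite upd_cons0.
apply: (ae_imp (ae_swapc j H2)) => y.
rewrite (_ : (fun t => _) = (fun t => f (upd y j t)))//.
by apply/funext => t; rewrite swapc_upd swapcK.
Qed.

(* A weight that makes w and its horizontal derivatives square integrable, since
   sigm t ^ 2 <= min(1, exp(2 t)); it is constant along horizontal lines. *)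
Definition sigm (t : R) : R := (1 + expR (- t))^-1.

Lemma sigm_gt0 t : 0 < sigm t.
Proof. by rewrite invr_gt0 addr_gt0// expR_gt0. Qed.

Lemma sigm_le1 t : sigm t <= 1.
Proof. by rewrite invf_le1 ?addr_gt0 ?expR_gt0// lerDl expR_ge0. Qed.

Lemma sigm_le_expR t : sigm t <= expR t.
Proof.
rewrite -[leRHS]invrK -expRN lef_pV2 ?posrE ?addr_gt0 ?expR_gt0//.
by rewrite lerDr.
Qed.

Lemma smooth_sigm k : CkOn (fun _ : unit => 1 : R) setT k sigm.
Proof.
apply: (@CkOn_comp _ _ _ _ setT [set x | x != 0]).
- exact: openT.
- by move=> t _ /=; rewrite gt_eqF// addr_gt0// expR_gt0.
- exact: Ck1_inv.
- apply: CkOnD; [exact: openT|apply: CkOn_cst; exact: openT|].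
  apply: (@CkOn_comp _ _ _ _ setT setT) => //; [exact: openT|exact: Ck1_expR|].
  by rewrite (_ : -%R = fun t : R => -1 * t); [apply: CkOnZ; [exact: openT|apply: Ck1_id; exact: openT]|apply/funext => t; rewrite mulN1r].
Qed.

Lemma measurable_weight (h : R -> R) : continuous h ->
  measurable_fun setT (fun y : E => h (y ord0 ord0)).
Proof.
by move=> ch; apply: (@measurable_fst_coord R n h); exact: continuous_measurable_fun.
Qed.

(** A weight in the first coordinate can be moved onto the factor [phi ord0], which differentiation
    in another coordinate leaves alone. *)
Lemma weak_partial_weight (u v : E -> R) (k : 'I_n) (h : R -> R) :
  (forall m, CkOn (fun _ : unit => 1 : R) setT m h) ->
  weak_partial u (lift ord0 k) v ->
  weak_partial (fun y => h (y ord0 ord0) * u y) (lift ord0 k) (fun y => h (y ord0 ord0) * v y).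
Proof.
move=> sh H phi sp.
pose psi := fcons (fun t => phi ord0 t * h t) (fun i => phi (lift ord0 i)).
have spsi m : smooth_compact (psi m).
  by apply: fcons_smooth_compact => //; exact: smooth_compactM.
have E1 y : prodf psi y = h (y ord0 ord0) * prodf phi y.
  by rewrite [in RHS](fcons_eta phi) !prodf_fcons; ring.
have E2 y : prodf (der_at (lift ord0 k) psi) y = h (y ord0 ord0) * prodf (der_at (lift ord0 k) phi) y.
  rewrite (fcons_eta (der_at _ psi)) [in RHS](fcons_eta (der_at _ phi)) !prodf_fcons.
  rewrite [der_at _ psi ord0]/der_at [der_at _ phi ord0]/der_at /psi /fcons unlift_none.
  rewrite (negbTE (neq_lift _ _)) -!mulrA mulrCA; congr (_ * (_ * _)).
  apply: eq_bigr => i _; rewrite /der_at liftK.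
  by case: ifP.
have := H _ spsi.
under eq_Rintegral do rewrite E2 mulrCA mulrA.
by under [in RHS]eq_Rintegral do rewrite E1 mulrCA mulrA.
Qed.

Section theorem.
Variables (w : E -> R) (w_ : 'I_n.+1 -> E -> R).
Hypotheses (mw : measurable_fun setT w) (mw_ : forall j, measurable_fun setT (w_ j)).
Hypothesis wi : intgL n.+1 (fun y => w y ^+ 2).
Hypothesis w0i : intgL n.+1 (fun y => w_ ord0 y ^+ 2).
Hypothesis wki : forall k : 'I_n, intgL n.+1 (fun y : E => expR (y ord0 ord0) ^+ 2 * w_ (lift ord0 k) y ^+ 2).
Hypothesis weak : forall j, weak_partial w j (w_ j).

Let D j y := 2 * w y * w_ j y.

(** [w_ j] is known to be square integrable only with the weight [expR (y ord0 ord0)].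
    Multiplication by [sigm] puts both [w] and [w_ j] in the scope of [weak_partial_sqr], and this
    factor, constant along the [j]-th lines, divides out. *)
Lemma partial_derivative_sqr_lift (k : 'I_n) :
  partial_derivative (fun y => w y ^+ 2) (lift ord0 k) (D (lift ord0 k)).
Proof.
set j := lift ord0 k; pose rho (y : E) := sigm (y ord0 ord0).
have mrho : measurable_fun setT rho.
  by apply: measurable_weight; exact: (smooth_continuous smooth_sigm).
have ui : intgL n.+1 (fun y => (rho y * w y) ^+ 2).
  apply: (le_intg _ _ wi); first by apply: measurable_funX; exact: measurable_funM.
  move=> y; rewrite ger0_norm ?sqr_ge0// exprMn ler_piMl ?sqr_ge0//.
  by rewrite exprn_ile1 ?sigm_le1// ltW// sigm_gt0.
have vi : intgL n.+1 (fun y => (rho y * w_ j y) ^+ 2).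
  apply: (le_intg _ _ (wki k)); first by apply: measurable_funX; exact: measurable_funM.
  move=> y; rewrite ger0_norm ?sqr_ge0// exprMn ler_wpM2r ?sqr_ge0//.
  by rewrite lerXn2r ?nnegrE ?expR_ge0 ?sigm_le_expR// ltW// sigm_gt0.
have H := @weak_partial_sqr R n j (fun y => rho y * w y) (fun y => rho y * w_ j y)
   (measurable_funM mrho mw) (measurable_funM mrho (mw_ j)) ui vi (weak_partial_weight smooth_sigm (weak j)).
have uvi : intgL n.+1 (fun y => (rho y * w y) * (rho y * w_ j y)).
  apply: (le_intg _ _ (intgD ui vi)); last by move=> y; exact: normM_le_sqr.
  by apply: measurable_funM; exact: measurable_funM.
apply: (ae_imp2 H (ae_line_upd j uvi)) => y Hy ly.
have updE t : (upd y j t) ord0 ord0 = y ord0 ord0 by rewrite mxE (negbTE (neq_lift _ _)).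
pose r := rho y ^+ 2; have r0 : r != 0 by rewrite expf_neq0// gt_eqF// sigm_gt0.
have li : intg (fun t => w (upd y j t) * w_ j (upd y j t)).
  rewrite (_ : (fun t => _) = (fun t => r^-1 * ((rho (upd y j t) * w (upd y j t)) * (rho (upd y j t) * w_ j (upd y j t))))).
    exact: intgZ.
  by apply/funext => t; rewrite /rho updE -/(rho y); move: r0; rewrite /r => r0; field; move: r0; rewrite expf_eq0.
apply: (mulfI r0); rewrite -exprMn Hy !primE.
rewrite -RintegralZ; last first.
  apply: integrable_prim; rewrite /D; under [X in EFin \o X]eq_fun do rewrite -mulrA; exact: intgZ.
by apply: eq_Rintegral => t _; rewrite /cutl /D /rho updE -/(rho y) /r; ring.
Qed.

Lemma partial_derivative_sqr_ord0 : partial_derivative (fun y => w y ^+ 2) ord0 (D ord0).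
Proof. exact: weak_partial_sqr. Qed.

Let W (y : E) := w y ^+ 2.

Let slices : {ae lam, forall t, sobolev_density (fun v => W (rV_cons (t, v)))
     (fun j v => D (lift ord0 j) (rV_cons (t, v)))
     (fun j v => w_ (lift ord0 j) (rV_cons (t, v)) ^+ 2)}.
Proof.
have sec (h : E -> R) t : measurable_fun setT h -> measurable_fun setT (fun v : 'rV[R]_n => h (rV_cons (t, v))).
  move=> mh; apply: (@measurable_fun_pair2 _ _ _ (measurableTypeR R) _ _ (fun p => h (rV_cons p))) => //.
  exact: measurable_rV_comp.
have aW := ae_slice_intg (intg_cons wi).
have aK : {ae lam, forall t, forall j : 'I_n, intgL n (fun v => w_ (lift ord0 j) (rV_cons (t, v)) ^+ 2)}.
  apply: filter_forall => j; apply: (ae_imp (ae_slice_intg (intg_cons (wki j)))) => t.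
  under [X in EFin \o X]eq_fun do rewrite rV_cons0 /=.
  (* On the slice over [t] the weight is the nonzero constant [expR t ^+ 2]. *)
  move=> H; have := intgZ ((expR t ^+ 2)^-1) H.
  under [X in EFin \o X]eq_fun do rewrite mulKf ?expf_neq0 ?gt_eqF ?expR_gt0//.
  by [].
have aAC : {ae lam, forall t, forall j : 'I_n,
    partial_derivative (fun v => W (rV_cons (t, v))) j (fun v => D (lift ord0 j) (rV_cons (t, v)))}.
  by apply: filter_forall => j; apply: partial_derivative_cons; exact: partial_derivative_sqr_lift.
apply: (ae_imp2 aW (ae_imp2 aK aAC (fun _ => pair))) => t Wt [Kt ACt]; split => //.
- by split => // y; exact: sqr_ge0.
- move=> j; apply: (le_intg _ _ (intgD Wt (Kt j))).
    by apply: sec; apply: measurable_funM => //; exact: measurable_funM.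
  move=> v; rewrite /D /W -mulrA normrM (ger0_norm (ler0n _ 2)).
  set x := w _; set y := w_ _ _; rewrite normrM -(real_normK (num_real x)) -(real_normK (num_real y)).
  by have := sqr_ge0 (`|x| - `|y|); lra.
- by move=> j; split => // y; exact: sqr_ge0.
- by move=> j y; rewrite /D /W; rewrite le_eqVlt; apply/orP; left; apply/eqP; ring.
Qed.

Lemma weighted_log_sobolev (a : R) : 0 < a ->
  let m := \int[L n.+1]_y W y in
  let kap := \int[L n.+1]_y (w_ ord0 y ^+ 2) +
    \sum_(k < n) \int[L n.+1]_y (expR (y ord0 ord0) ^+ 2 * w_ (lift ord0 k) y ^+ 2) in
  let F y := W y * ln (expR (y ord0 ord0) ^+ n * W y / m) in
  intgL n.+1 (fun y => Num.max (F y) 0) /\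
  (intgL n.+1 F -> \int[L n.+1]_y F y <= a * kap - n.+1%:R * m * (1 + ln (pi * a) / 2)).
Proof.
move=> a0 m kap F.
have WP := intg_cons wi.
have Di0 : intgL n.+1 (D ord0).
  apply: (le_intg _ _ (intgZ 2 (intgD wi w0i))); first by apply: measurable_funM => //; exact: measurable_funM.
  move=> y; rewrite /D -mulrA normrM (ger0_norm (ler0n _ 2)) ler_pM2l//; exact: normM_le_sqr.
have W0 y : 0 <= W y by exact: sqr_ge0.
pose g (t : R) := \int[L n]_v W (rV_cons (t, v)).
pose kt (t : R) := \sum_(j < n) \int[L n]_v (expR (rV_cons (t, v) ord0 ord0) ^+ 2 * w_ (lift ord0 j) (rV_cons (t, v)) ^+ 2).
have gi : intg g by exact: (@integrable_Rintegral1 _ _ _ _ _ lam (L n) _ WP).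
have kji (j : 'I_n) : intg (fun t => \int[L n]_v (expR (rV_cons (t, v) ord0 ord0) ^+ 2 * w_ (lift ord0 j) (rV_cons (t, v)) ^+ 2)).
  exact: (@integrable_Rintegral1 _ _ _ _ _ lam (L n) _ (intg_cons (wki j))).
have kti : intg kt by exact: intg_sum.
have ktE : \int[lam]_t kt t = \sum_(k < n) \int[L n.+1]_y (expR (y ord0 ord0) ^+ 2 * w_ (lift ord0 k) y ^+ 2).
  rewrite Rintegral_sum//; apply: eq_bigr => j _.
  rewrite Rintegral_cons//.
  by rewrite (@Rfubini1 _ _ _ _ _ lam (L n) _ (intg_cons (wki j))).
have mE : m = \int[(lam \x L n)%E]_p W (rV_cons p) by exact: Rintegral_cons.
have gE : \int[lam]_t g t = m by rewrite mE Rfubini1.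
have base := log_sobolev_marginal WP (intg_cons Di0) (intg_cons w0i)
  (fun p => W0 _) (fun p => sqr_ge0 _) (fun p => _)
  (partial_derivative_cons0 partial_derivative_sqr_ord0) ltr01 a0.
have DWK p : D ord0 (rV_cons p) ^+ 2 <= 4 * W (rV_cons p) * w_ ord0 (rV_cons p) ^+ 2.
  by rewrite /D /W le_eqVlt; apply/orP; left; apply/eqP; ring.
have {base} := base DWK.
pose mP := \int[(lam \x L n)%E]_p W (rV_cons p).
pose k0 := \int[(lam \x L n)%E]_p (w_ ord0 (rV_cons p) ^+ 2).
move=> base.
have La0 (t : R) : 0 < expR t ^+ n by rewrite exprn_gt0// expR_gt0.
have mLa : measurable_fun setT (fun t : R => expR t ^+ n).
  by apply: measurable_funX; exact: measurable_expR.
(* The marginal is taken at scale 1, the slice over [t] at scale [expR t]. *)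
have [|||F1 _ F3] := @chain_step R _ _ (L n) (fun p => W (rV_cons p)) (fun t => expR t ^+ n)
  (fun t => n%:R * g t + kt t)
  (fun t => a * kt t - n%:R * g t * (1 + ln (pi * a) / 2)) 1
  (mP + 1 ^+ 2 * k0) (a * 1 ^+ 2 * k0 - mP * (1 + ln (pi * a) / 2))
  WP (fun p => W0 _) mLa La0 ltr01 _ _ _ base.
- apply: (ae_imp slices) => t St.
  have [h1 h2 h3] := log_sobolev_rV St (expR_gt0 t) a0.
  have E1 : expR t ^+ 2 * (\sum_j \int[L n]_v (w_ (lift ord0 j) (rV_cons (t, v)) ^+ 2)) = kt t.
    have [_ _ Ki _ _] := St.
    rewrite mulr_sumr; apply: eq_bigr => j _; rewrite -RintegralZ; last exact: (Ki j).1.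
    by apply: eq_Rintegral => v _; rewrite rV_cons0.
  split => //; first by rewrite -E1.
  by move=> /h3; rewrite -mulrA E1.
- by apply: intgD => //; exact: intgZ.
- apply: intgB; first exact: intgZ.
  by under eq_fun do rewrite mulrAC; exact: intgZ.
have FE p : F (rV_cons p) = W (rV_cons p) * ln (1 * expR p.1 ^+ n * W (rV_cons p) /
    \int[(lam \x L n)%E]_p W (rV_cons p)).
  by rewrite /F rV_cons0 mul1r -mE.
have mW : measurable_fun setT W by exact: integrable_measurable wi.
have mF : measurable_fun setT F.
  apply: measurable_funM => //; apply: measurableT_comp => //.
  apply: measurable_funM => //; apply: measurable_funM => //.
  by apply: measurable_funX; apply: measurable_weight; exact: continuous_expR.
split.
  apply: cons_intg; first by apply: measurable_maxr => //; exact: measurable_cst.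
  by under [X in EFin \o X]eq_fun do rewrite FE.
move=> fi; have FP := intg_cons fi; rewrite Rintegral_cons//.
under eq_Rintegral do rewrite FE.
apply: (le_trans (F3 _)).
  by under [X in EFin \o X]eq_fun do rewrite -FE.
rewrite RintegralB//; first last.
- by under eq_fun do rewrite mulrAC; exact: intgZ.
- exact: intgZ.
under [X in _ - X + _ <= _]eq_Rintegral do rewrite mulrAC.
have k0E : \int[L n.+1]_y (w_ ord0 y ^+ 2) = k0 by exact: Rintegral_cons.
rewrite !RintegralZ// gE /mP -mE ktE /kap k0E -[n.+1%:R]natr1.
by rewrite le_eqVlt; apply/orP; left; apply/eqP; ring.
Qed.

End theorem.

End weighted_log_sobolev.

(** * Transfer to the ball *)

Section change_of_variables.
Context (R : realType) (n : nat).
Local Notation L := (@lebesgue_rV R).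
Local Notation E := 'rV[R]_n.+1.
Local Notation hs := (@hspace R n.+1).
Local Notation intgL f := ((L n.+1).-integrable setT (EFin \o f)).
Implicit Types (F : E -> R) (x y : E).

(** By [sum_gf_sqr] this equals [4 / Qf x] at [y = gmap x]; that is how [psi] can undo [gmap]
    explicitly. *)
Definition qpsi y : R := (1 + expR (y ord0 ord0)) ^+ 2 + \sum_(k < n) y ord0 (lift ord0 k) ^+ 2.

Definition psi y : E :=
  \row_k (if k == ord0 then 1 - 2 * (1 + expR (y ord0 ord0)) * (qpsi y)^-1
          else 2 * y ord0 k * (qpsi y)^-1).

Lemma gmapK x : hs x -> psi (gmap x) = x.
Proof.
move=> hx; have [D0 Q0] := hspace_pos hx; have Q1 : Qf x != 0 by rewrite gt_eqF.
have qE : qpsi (gmap x) = 4 / Qf x.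
  rewrite /qpsi mxE expR_gf0// -(sum_gf_sqr hx); congr (_ + _).
  by apply: eq_bigr => k _; rewrite mxE.
apply/rowP => k; rewrite mxE qE; case: ifPn => [/eqP ->|k0].
  rewrite mxE expR_gf0//; have := DfE x; rewrite /zc eqxx mulr1n => ->; field; exact: Q1.
rewrite mxE /gf (negbTE k0); field; exact: Q1.
Qed.

Lemma measurable_psi : measurable_fun setT psi.
Proof.
have mq : measurable_fun setT qpsi.
  apply: measurable_funD.
    apply: measurable_funX; apply: measurable_funD => //.
    by apply: (measurableT_comp (@measurable_expR R)); exact: measurable_coord.
  by apply: measurable_sum => k; apply: measurable_funX; exact: measurable_coord.
apply: measurable_fun_rVP => k; under eq_fun do rewrite mxE.
case: (k == ord0).
  apply: measurable_funB => //; apply: measurable_funM; last exact: measurable_invr.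
  apply: measurable_funM => //; apply: measurable_funD => //.
  by apply: (measurableT_comp (@measurable_expR R)); exact: measurable_coord.
apply: measurable_funM; last exact: measurable_invr.
by apply: measurable_funM => //; exact: measurable_coord.
Qed.

Lemma measurable_comp_psi F : measurable_fun setT F -> measurable_fun setT (fun y => F (psi y)).
Proof. by move=> mF; apply: (measurableT_comp mF); exact: measurable_psi. Qed.

Lemma measurable_comp_gmap F : measurable_fun setT F -> measurable_fun setT (fun x => F (gmap x)).
Proof. by move=> mF; apply: (measurableT_comp mF); exact: measurable_gmap. Qed.

Section constant.
Variable c : R.
Hypothesis c1 : 1 <= c.
Hypothesis push : forall F, measurable_fun setT F ->
  (\int[L n.+1]_x (F (gmap x) * Jr x)%:E = \int[L n.+1]_y (F y * c)%:E)%E.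

Let c0 : 0 < c. Proof. exact: lt_le_trans c1. Qed.

Lemma intg_push F : measurable_fun setT F ->
  intgL (fun x => F (gmap x) * Jr x) <-> intgL F.
Proof.
move=> mF.
have mJ : measurable_fun setT (fun x : E => F (gmap x) * Jr x).
  by apply: measurable_funM; [exact: measurable_comp_gmap|exact: measurable_Jr].
have mN : measurable_fun setT (fun y => `|F y|) by exact: measurableT_comp.
have H := push mN.
have H1 : (\int[L n.+1]_x `|(F (gmap x) * Jr x)%:E| = \int[L n.+1]_y (`|F y| * c)%:E)%E.
  by rewrite -H; apply: eq_integral => x _; rewrite /= normrM (ger0_norm (Jr_ge0 _)).
split => [/integrableP[_]|Fi].
- rewrite H1 => h.
  have Fc : intgL (fun y => c * F y).
    apply/integrableP; split; first by apply/measurable_EFinP; exact: measurable_funM.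
    rewrite (_ : (\int[L n.+1]_x _)%E = (\int[L n.+1]_y (`|F y| * c)%:E)%E)//.
    by apply: eq_integral => y _; rewrite /= normrM (gtr0_norm c0) mulrC.
  have := intgZ c^-1 Fc; under [X in EFin \o X]eq_fun do rewrite mulKf ?gt_eqF//.
  by [].
- apply/integrableP; split; first exact/measurable_EFinP.
  rewrite H1; have := intgZ c (integrable_norm Fi) => /integrableP[_].
  rewrite (_ : (\int[L n.+1]_x _)%E = (\int[L n.+1]_y (`|F y| * c)%:E)%E)//.
  by apply: eq_integral => y _; rewrite /= normrM (gtr0_norm c0) normr_id mulrC.
Qed.

Lemma Rintegral_push F : measurable_fun setT F -> intgL F ->
  \int[L n.+1]_x (F (gmap x) * Jr x) = c * \int[L n.+1]_y F y.
Proof.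
move=> mF Fi; rewrite -RintegralZ// /Rintegral push//; congr fine.
by apply: eq_integral => y _; rewrite mulrC.
Qed.

End constant.

End change_of_variables.

Section weak_partial_weight0.
Context (R : realType) (n : nat).
Local Notation L := (@lebesgue_rV R).
Local Notation E := 'rV[R]_n.+1.
Local Notation intgL f := ((L n.+1).-integrable setT (EFin \o f)).

(** Both [phi ord0 * h] and [phi ord0 * dh] are again test factors, and the classical Leibniz rule
    on that factor gives the extra term. *)
Lemma weak_partial_weight0 (u v : E -> R) (h dh : R -> R) :
  (forall m, CkOn (fun _ : unit => 1 : R) setT m h) ->
  (forall m, CkOn (fun _ : unit => 1 : R) setT m dh) ->
  (forall t : R, is_derive t 1 h (dh t)) ->
  (forall phi, (forall k, smooth_compact (phi k)) -> intgL (fun y => u y * prodf phi y)) ->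
  (forall phi, (forall k, smooth_compact (phi k)) -> intgL (fun y => v y * prodf phi y)) ->
  weak_partial u ord0 v ->
  weak_partial (fun y => h (y ord0 ord0) * u y) ord0
    (fun y => h (y ord0 ord0) * v y + dh (y ord0 ord0) * u y).
Proof.
move=> sh sdh dhE ui vi H phi sp.
pose tl (i : 'I_n) := phi (lift ord0 i).
pose psi1 := fcons (fun t => phi ord0 t * h t) tl.
pose psi2 := fcons (fun t => phi ord0 t * dh t) tl.
have s1 m : smooth_compact (psi1 m) by apply: fcons_smooth_compact => [|i]; [exact: smooth_compactM|exact: sp].
have s2 m : smooth_compact (psi2 m) by apply: fcons_smooth_compact => [|i]; [exact: smooth_compactM|exact: sp].
have E1 (y : E) : h (y ord0 ord0) * prodf phi y = prodf psi1 y.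
  by rewrite [in LHS](fcons_eta phi) !prodf_fcons; ring.
have E2 (y : E) : dh (y ord0 ord0) * prodf phi y = prodf psi2 y.
  by rewrite [in LHS](fcons_eta phi) !prodf_fcons; ring.
have E3 (y : E) : h (y ord0 ord0) * prodf (der_at ord0 phi) y = prodf (der_at ord0 psi1) y - prodf psi2 y.
  rewrite [in LHS](fcons_eta phi) /psi1 !der_at_fcons !prodf_fcons.
  have := is_derive_mulr (smooth_is_derive (sp ord0).1 (y ord0 ord0)) (dhE (y ord0 ord0)).
  by move=> d; rewrite (@derive_val _ _ _ _ _ _ _ d); ring.
have i1 := ui _ (der_at_smooth_compact ord0 s1); have i2 := ui _ s2; have i3 := vi _ s1.
transitivity (\int[L n.+1]_y (u y * prodf (der_at ord0 psi1) y - u y * prodf psi2 y)).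
  by apply: eq_Rintegral => y _; rewrite -mulrBr -E3; ring.
rewrite RintegralB// H//.
transitivity (- (\int[L n.+1]_y (v y * prodf psi1 y + u y * prodf psi2 y))).
  by rewrite RintegralD// opprD.
by congr (- _); apply: eq_Rintegral => y _; rewrite -E1 -E2; ring.
Qed.

End weak_partial_weight0.

Section pullback.
Context (R : realType) (n : nat).
Local Notation lam := (@lebesgue_measure R).
Local Notation L := (@lebesgue_rV R).
Local Notation E := 'rV[R]_n.+1.
Local Notation hs := (@hspace R n.+1).
Local Notation b := (@basis_rV R n.+1).
Local Notation intgL f := ((L n.+1).-integrable setT (EFin \o f)).
Local Notation dens := (@hdensity R n.+1).

Lemma hvol_integral (f : E -> R) : measurable_fun setT f ->
  (\int[@hvol R n.+1]_x (f x)%:E = \int[L n.+1]_x (f x * dens x)%:E)%E.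
Proof.
by apply: integral_density => //; [exact: measurable_hdensity|exact: hdensity_ge0].
Qed.

Lemma hvol_integrable (f : E -> R) : measurable_fun setT f ->
  (@hvol R n.+1).-integrable setT (EFin \o f) <-> intgL (fun x => f x * dens x).
Proof.
by apply: integrable_density => //; [exact: measurable_hdensity|exact: hdensity_ge0].
Qed.

Lemma hdensityE x : hs x -> dens x = (2 / Df x) ^+ n.+1.
Proof. by move=> hx; rewrite /hdensity patchE mem_set. Qed.

Lemma hdensity_out x : ~ hs x -> dens x = 0.
Proof. by move=> hx; rewrite /hdensity patchE memNset. Qed.

Lemma Df_le1 (x : E) : Df x <= 1.
Proof. by rewrite /Df gerBl; apply: sumr_ge0 => i _; rewrite -expr2 sqr_ge0. Qed.

Lemma hdensity_ge1 x : hs x -> 1 <= dens x.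
Proof.
move=> hx; have [D0 _] := hspace_pos hx; rewrite hdensityE// exprn_ege1// ler_pdivlMr// mul1r.
by have := Df_le1 x; lra.
Qed.

Lemma hdensity_gf0 x : hs x -> dens x = expR (gf ord0 x) ^- n * Jr x.
Proof.
move=> hx; have [D0 Q0] := hspace_pos hx.
have D1 : Df x != 0 by rewrite gt_eqF.
have Q1 : Qf x != 0 by rewrite gt_eqF.
have qq : Qf x ^+ n * (Qf x)^-1 ^+ n = 1 by rewrite -exprMn divff// expr1n.
rewrite hdensityE// JrE// /Jf expR_gf0// -exprVn invf_div.
transitivity (2 ^+ n.+1 * ((Df x)^-1 * (Df x)^-1 ^+ n) * (Qf x ^+ n * (Qf x)^-1 ^+ n)).
  by rewrite qq mulr1 exprMn -exprS.
by rewrite [(Qf x / Df x) ^+ n]exprMn; ring.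
Qed.

Variables (u : E -> R) (X : E -> E).
Hypothesis uX : W12 u X.
Implicit Types (i j : 'I_n.+1) (x y : E).

(* ah is the 1-form of the weak gradient, and Vf j is its value on d/dg_j. *)
Definition uh : E -> R := u \_ hs.
Definition ah i : E -> R := (fun x => hmetric x (X x) (b i)) \_ hs.
Definition ef j x : R := if j == ord0 then - (Df x / (2 * Qf x)) else 2^-1.
Definition Vf j x : R := ef j x * \sum_i Rf j i x * ah i x.

Lemma uh_out x : ~ hs x -> uh x = 0.
Proof. by move=> hx; rewrite /uh patchE memNset. Qed.

Lemma ah_out i x : ~ hs x -> ah i x = 0.
Proof. by move=> hx; rewrite /ah patchE memNset. Qed.

Lemma ahE i x : hs x -> ah i x = hconf x ^+ 2 * X x ord0 i.
Proof.
move=> hx; rewrite /ah patchE mem_set// /hmetric /dotp (bigD1 i)//= big1 ?addr0.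
  by rewrite mxE !eqxx mulr1.
by move=> k /negbTE ki; rewrite mxE eqxx ki mulr0.
Qed.

Lemma measurable_uh : measurable_fun setT uh.
Proof.
have [mu _ _ _ _] := uX.
exact/(measurable_restrictT u (@measurable_hspace R n.+1)).
Qed.

Lemma measurable_ah i : measurable_fun setT (ah i).
Proof.
have [_ _ mX _ _] := uX.
have -> : ah i = (fun x => (2 * (Df x)^-1) ^+ 2) \* ((fun x => X x ord0 i) \_ hs).
  apply/funext => x /=; have [hx|nx] := pselect (hs x).
    by rewrite ahE// patchE mem_set.
  by rewrite ah_out// patchE memNset// mulr0.
apply: measurable_funM.
  apply: measurable_funX; apply: measurable_funM => //.
  by apply: measurable_invr; exact: measurable_Df.
apply/(measurable_restrictT (fun x => X x ord0 i) (@measurable_hspace R n.+1)).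
exact: (measurable_comp measurableT (@subsetT _ _) (measurable_coord i) mX).
Qed.

Lemma measurable_Vf j : measurable_fun setT (Vf j).
Proof.
apply: measurable_funM.
  rewrite /ef; case: (j == ord0) => //.
  under eq_fun do rewrite -mulN1r; apply: measurable_funM => //; apply: measurable_funM; first exact: measurable_Df.
  by apply: measurable_invr; apply: measurable_funM => //; exact: measurable_Qf.
apply: measurable_sum => i; apply: measurable_funM; last exact: measurable_ah.
have mz k : measurable_fun setT (@zc R n k) by apply: continuous_measurable_rV => x; exact: (CkOn_zc R 0 k).
apply: measurable_funB; first by apply: measurable_funM => //; exact: measurable_Qf.
by apply: measurable_funM => //; apply: measurable_funM.
Qed.

Lemma cfE j x : hs x -> cf j x = ef j x * Jr x.
Proof.
move=> hx; have [D0 Q0] := hspace_pos hx.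
have D1 : Df x != 0 by rewrite gt_eqF.
have Q1 : Qf x != 0 by rewrite gt_eqF.
rewrite JrE// /cf /ef /Jf; case: ifP => _; rewrite !exprS.
  by move: (2 ^+ n) ((Qf x)^-1 ^+ n) => a c; field; rewrite D1 Q1.
by move: (2 ^+ n) ((Qf x)^-1 ^+ n) => a c; field; rewrite ?D1 ?Q1.
Qed.

(** [Rf] is [Qf] times an orthogonal reflection, so it multiplies the Euclidean norm of the 1-form
    by [Qf]. Geometrically, the coordinate fields are orthogonal, of lengths [1] for [s] and
    [e^(-s)] for the horizontal ones. *)
Lemma Vf_energy x : hs x ->
  Vf ord0 x ^+ 2 + expR (gf ord0 x) ^+ 2 * \sum_(k < n) Vf (lift ord0 k) x ^+ 2 =
  hnorm x (X x) ^+ 2.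
Proof.
move=> hx; have [D0 Q0] := hspace_pos hx.
have D1 : Df x != 0 by rewrite gt_eqF.
have Q1 : Qf x != 0 by rewrite gt_eqF.
pose P j := \sum_i Rf j i x * ah i x.
have PE j : P j = Qf x * ah j x - 2 * zc j x * \sum_i zc i x * ah i x.
  rewrite /P /Rf; under eq_bigr do rewrite mulrBl.
  rewrite big_split/= sumrN mulr_sumr; congr (_ - _).
    rewrite (bigD1 j)//= eqxx big1 ?addr0 ?mulr1// => i /negbTE ->.
    by rewrite mulr0 mul0r.
  by apply: eq_bigr => i _; rewrite mulrA.
have sP : \sum_j P j ^+ 2 = Qf x ^+ 2 * \sum_i ah i x ^+ 2.
  set s := \sum_i zc i x * ah i x in PE.
  transitivity (\sum_j (Qf x ^+ 2 * ah j x ^+ 2 - 4 * Qf x * s * (zc j x * ah j x) +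
      4 * s ^+ 2 * (zc j x * zc j x))).
    by apply: eq_bigr => j _; rewrite PE; ring.
  rewrite !big_split/= sumrN -!mulr_sumr -/s -[\sum_i zc i x * zc i x]/(Qf x); ring.
have -> : expR (gf ord0 x) ^+ 2 * \sum_(k < n) Vf (lift ord0 k) x ^+ 2 =
    (Df x / (2 * Qf x)) ^+ 2 * \sum_(k < n) P (lift ord0 k) ^+ 2.
  rewrite expR_gf0// [LHS]mulr_sumr [RHS]mulr_sumr; apply: eq_bigr => k _.
  have -> : Vf (lift ord0 k) x = 2^-1 * P (lift ord0 k).
    by rewrite /Vf /ef eq_sym (negbTE (neq_lift _ _)).
  field; exact: Q1.
rewrite /Vf /ef eqxx -/(P ord0).
transitivity ((Df x / (2 * Qf x)) ^+ 2 * \sum_j P j ^+ 2); first by rewrite [in RHS]big_ord_recl; ring.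
rewrite sP /hnorm sqr_sqrtr /hmetric /dotp; last first.
  by rewrite mulr_ge0 ?sqr_ge0// sumr_ge0// => i _; rewrite -expr2 sqr_ge0.
under eq_bigr do rewrite ahE// exprMn.
rewrite -mulr_sumr /hconf -/(Df x).
under [in RHS]eq_bigr do rewrite -expr2.
by field; rewrite D1 Q1.
Qed.

End pullback.

Section integral_partial.
Context (R : realType) (n : nat).
Local Notation lam := (@lebesgue_measure R).
Local Notation L := (@lebesgue_rV R).
Local Notation E := 'rV[R]_n.+1.
Local Notation intgL f := ((L n.+1).-integrable setT (EFin \o f)).

(** On almost every line [W] is an integrable primitive of [D]; its limit at +oo is the integral of
    [D], which must be 0 by [intg_cvgy_eq0]. *)
Lemma Rintegral_partial0 (W D : E -> R) : intgL W -> intgL D ->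
  partial_derivative W ord0 D -> \int[L n.+1]_y D y = 0.
Proof.
move=> Wi Di WD; have WP := intg_cons Wi; have DP := intg_cons Di.
rewrite Rintegral_cons// (@Rfubini2 _ _ _ _ _ lam (L n) _ DP).
rewrite -[RHS](_ : \int[L n]_v 0 = 0); last by rewrite /Rintegral integral0.
apply: ae_eq_Rintegral.
- apply: (@measurable_Rintegral2 _ _ _ _ _ lam (fun p => _)).
  exact: integrable_measurable DP.
- exact: measurable_cst.
have [_ lines] := ae_prod (partial_derivative_cons0 WD).
apply: (ae_imp2 (ae_imp2 (ae_line Wi) (ae_line Di) (fun _ => pair)) lines) => v [Wv Dv] H.
apply: (@intg_cvgy_eq0 _ (prim (fun r => D (rV_cons (r, v))))); last exact: prim_cvgy.
apply: (@ae_eq_intg _ _ _ lam _ _ _ _ Wv) => [|].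
  by apply: continuous_measurable_fun; exact: continuous_prim.
exact: H.
Qed.

End integral_partial.

Section pullback_integrals.
Context (R : realType) (n : nat).
Local Notation lam := (@lebesgue_measure R).
Local Notation L := (@lebesgue_rV R).
Local Notation E := 'rV[R]_n.+1.
Local Notation hs := (@hspace R n.+1).
Local Notation b := (@basis_rV R n.+1).
Local Notation intgL f := ((L n.+1).-integrable setT (EFin \o f)).
Local Notation dens := (@hdensity R n.+1).
Implicit Types (i j : 'I_n.+1) (x y : E) (phi : 'I_n.+1 -> R -> R).

Lemma intg_L2_bounded (f g : E -> R) (C : R) : measurable_fun setT f ->
  intgL (fun x => f x ^+ 2) -> measurable_fun setT g -> (forall x, `|g x| <= C) ->
  (forall x, ~ hs x -> g x = 0) -> intgL (fun x => f x * g x).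
Proof.
move=> mf fi mg gC g0.
have gi : intgL (fun x => g x ^+ 2).
  apply: (@bounded_hspace_intg _ _ _ (C ^+ 2)); first exact: measurable_funX.
    by move=> x; rewrite normrX lerXn2r ?nnegrE// (le_trans _ (gC x)).
  by move=> x nx; rewrite g0// expr0n.
apply: (le_intg _ _ (intgD fi gi)); first exact: measurable_funM.
by move=> x; exact: normM_le_sqr.
Qed.

Variables (u : E -> R) (X : E -> E).
Hypothesis uX : W12 u X.
Local Notation uh := (@uh R n u).
Local Notation ah := (@ah R n X).
Local Notation Vf := (@Vf R n X).
Let mu := measurable_uh uX.
Let mV j := measurable_Vf uX j.

Definition HN x : R := Vf ord0 x ^+ 2 + expR (gf ord0 x) ^+ 2 * \sum_(k < n) Vf (lift ord0 k) x ^+ 2.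

Lemma Vf_out j x : ~ hs x -> Vf j x = 0.
Proof.
by move=> nx; rewrite /Vf big1 ?mulr0// => i _; rewrite ah_out// mulr0.
Qed.

Lemma HN_hnorm : HN = (fun x => hnorm x (X x) ^+ 2) \_ hs.
Proof.
apply/funext => x; rewrite patchE; case: ifPn => [|]; first by rewrite inE; exact: Vf_energy.
move=> /negP nx; have {}nx : ~ hs x by move=> hx; apply: nx; rewrite inE.
by rewrite /HN Vf_out// big1 ?mulr0 ?expr0n ?addr0// => k _; rewrite Vf_out// expr0n.
Qed.

Lemma measurable_HN : measurable_fun setT HN.
Proof.
apply: measurable_funD; first exact: measurable_funX.
apply: measurable_funM.
  apply: measurable_funX; apply: (measurableT_comp (@measurable_expR R)).
  exact: measurable_gf.
by apply: measurable_sum => k; exact: measurable_funX.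
Qed.

Lemma HN_ge0 x : 0 <= HN x.
Proof. by rewrite addr_ge0 ?sqr_ge0// mulr_ge0 ?sqr_ge0// sumr_ge0// => k _; rewrite sqr_ge0. Qed.

Lemma HN_dens_intg : intgL (fun x => HN x * dens x).
Proof.
have [_ _ _ Xi _] := uX; apply/(hvol_integrable measurable_HN).
rewrite HN_hnorm; move: Xi => /integrable_mkcond -/(_ (@measurable_hspace R n.+1)).
by apply: eq_integrable => // x _ /=; rewrite !patchE; case: ifP.
Qed.

Lemma uh_dens_intg : intgL (fun x => uh x ^+ 2 * dens x).
Proof.
have [_ ui _ _ _] := uX; apply/(hvol_integrable (measurable_funX 2 mu)).
move: ui => /integrable_mkcond -/(_ (@measurable_hspace R n.+1)).
by apply: eq_integrable => // x _ /=; rewrite /uh !patchE; case: ifP => _ //; rewrite expr0n.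
Qed.

Lemma uh_sqr_intg : intgL (fun x => uh x ^+ 2).
Proof.
apply: (le_intg _ _ uh_dens_intg); first exact: measurable_funX.
move=> x; rewrite ger0_norm ?sqr_ge0//; have [hx|nx] := pselect (hs x).
  by rewrite ler_peMr ?sqr_ge0// hdensity_ge1.
by rewrite uh_out// expr0n mul0r.
Qed.

Lemma ah_eta_intg phi i j : (forall k, smooth_compact (phi k)) ->
  intgL (fun x => ah i x * eta phi j i x).
Proof.
move=> sp; have tf := eta_test j i sp.
have ce : continuous (eta phi j i) by have [/(_ 0%N) h _ _] := tf; exact: h.
have eo x : ~ hs x -> eta phi j i x = 0 by move=> nx; rewrite /eta patchE memNset.
have [C HC] := continuous_hspace_bounded ce eo.
have [d d0 Hd] := prodf_gmap_support sp.
(* Near the boundary [ah] need not be square integrable for [dx]. The factor [Df / 2] brings it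
   under the hyperbolic energy, and its inverse stays bounded on the support of [eta]. *)
pose A x := ah i x * (Df x / 2); pose B x := eta phi j i x * (2 * (Df x)^-1).
have mA : measurable_fun setT A.
  apply: measurable_funM; first exact: measurable_ah uX i.
  by apply: measurable_funM => //; exact: measurable_Df.
have mB : measurable_fun setT B.
  apply: measurable_funM; first exact: continuous_measurable_rV.
  by apply: measurable_funM => //; apply: measurable_invr; exact: measurable_Df.
have Ai : intgL (fun x => A x ^+ 2).
  apply: (le_intg _ _ HN_dens_intg); first exact: measurable_funX.
  move=> x; rewrite ger0_norm ?sqr_ge0//; have [hx|nx] := pselect (hs x); last first.
    by rewrite /A ah_out// mul0r expr0n mulr_ge0 ?HN_ge0// hdensity_ge0.
  have [D0 _] := hspace_pos hx.
  apply: (@le_trans _ _ (HN x)); last by rewrite ler_peMr ?HN_ge0// hdensity_ge1.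
  rewrite HN_hnorm patchE mem_set// /hnorm sqr_sqrtr; last first.
    by rewrite /hmetric mulr_ge0 ?sqr_ge0// sumr_ge0// => k _; rewrite -expr2 sqr_ge0.
  rewrite /A ahE// /hmetric /hconf -/(Df x) /dotp (bigD1 i)//=.
  rewrite (_ : _ ^+ 2 = (2 / Df x) ^+ 2 * (X x ord0 i * X x ord0 i)); last by field; rewrite gt_eqF.
  rewrite ler_wpM2l ?sqr_ge0// lerDl sumr_ge0// => k _; by rewrite -expr2 sqr_ge0.
have BC x : `|B x| <= C * (2 * d^-1).
  have C0 : 0 <= C by exact: le_trans (normr_ge0 _) (HC x).
  have K0 : 0 <= C * (2 * d^-1) by rewrite !mulr_ge0// invr_ge0 ltW.
  have [e0|e0] := eqVneq (eta phi j i x) 0; first by rewrite /B e0 mul0r normr0.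
  have hx : hs x by apply: contrapT => /eo /eqP; rewrite (negbTE e0).
  have [D0 _] := hspace_pos hx.
  have [|dD _] := Hd x hx.
    by apply: contraNneq e0 => p0; rewrite etaE// p0 mul0r.
  rewrite /B normrM ler_pM// normrM (ger0_norm (ler0n _ 2)) ler_pM2l//.
  by rewrite ger0_norm ?invr_ge0 ?(ltW D0)// lef_pV2 ?posrE.
have Bo x : ~ hs x -> B x = 0 by move=> nx; rewrite /B eo// mul0r.
have := intg_L2_bounded mA Ai mB BC Bo.
rewrite (_ : (fun x => A x * B x) = (fun x => ah i x * eta phi j i x))//.
apply/funext => x; have [hx|nx] := pselect (hs x); last by rewrite /A /B ah_out// !mul0r.
have [D0 _] := hspace_pos hx; rewrite /A /B; field; by rewrite gt_eqF.
Qed.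

Lemma weak_eta phi i j : (forall k, smooth_compact (phi k)) ->
  \int[L n.+1]_x (uh x * 'D_(b i) (eta phi j i) x) = - \int[L n.+1]_x (ah i x * eta phi j i x).
Proof.
move=> sp; have [_ _ _ _ H] := uX.
have := H _ (eta_test j i sp) i; rewrite Rintegral_mkcond [in RHS]Rintegral_mkcond.
rewrite (_ : (fun x => _) \_ hs = (fun x => uh x * 'D_(b i) (eta phi j i) x)); last first.
  by apply/funext => x; rewrite /uh !patchE; case: ifP => _ //; rewrite mul0r.
rewrite (_ : (fun x => _) \_ hs = (fun x => ah i x * eta phi j i x))//.
by apply/funext => x; rewrite /ah !patchE; case: ifP => _ //; rewrite mul0r.
Qed.

Section constant.
Variable c : R.
Hypothesis c1 : 1 <= c.
Hypothesis push : forall F : E -> R, measurable_fun setT F ->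
  (\int[L n.+1]_x (F (gmap x) * Jr x)%:E = \int[L n.+1]_y (F y * c)%:E)%E.
Let c0 : 0 < c. Proof. exact: lt_le_trans c1. Qed.

Lemma psi_Jr (f : E -> R) x : f (psi (gmap x)) * Jr x = f x * Jr x.
Proof.
have [hx|nx] := pselect (hs x); first by rewrite gmapK.
by rewrite Jr_out// !mulr0.
Qed.

Lemma uh_psi_tests phi : (forall k, smooth_compact (phi k)) ->
  intgL (fun y => uh (psi y) * prodf phi y).
Proof.
move=> sp; have mF : measurable_fun setT (fun y => uh (psi y) * prodf phi y).
  by apply: measurable_funM; [exact: measurable_comp_psi|exact: prod_test_measurable].
apply/(intg_push c1 push mF).
under [X in EFin \o X]eq_fun do rewrite mulrAC psi_Jr -mulrA [Jr _ * _]mulrC.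
have [C HC] := prodf_gmap_bounded sp.
apply: (intg_L2_bounded mu uh_sqr_intg _ HC) => [|x nx]; last by rewrite Jr_out// mulr0.
by apply: measurable_funM; [exact: measurable_prodf_gmap|exact: measurable_Jr].
Qed.

Lemma Vf_gmap j phi x : Vf j (psi (gmap x)) * prodf phi (gmap x) * Jr x =
  \sum_i ah i x * eta phi j i x.
Proof.
rewrite mulrAC psi_Jr; have [hx|nx] := pselect (hs x); last first.
  by rewrite Jr_out// mulr0 mul0r big1// => i _; rewrite ah_out// mul0r.
rewrite /Vf mulr_sumr !mulr_suml; apply: eq_bigr => i _; rewrite etaE// cfE//; ring.
Qed.

Lemma Vf_psi_tests j phi : (forall k, smooth_compact (phi k)) ->
  intgL (fun y => Vf j (psi y) * prodf phi y).
Proof.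
move=> sp; have mF : measurable_fun setT (fun y => Vf j (psi y) * prodf phi y).
  by apply: measurable_funM; [exact: measurable_comp_psi (mV j)|exact: prod_test_measurable].
apply/(intg_push c1 push mF).
under [X in EFin \o X]eq_fun do rewrite Vf_gmap.
by apply: intg_sum => i; exact: ah_eta_intg.
Qed.

(** Pulled back to the ball, up to the factor [c], one side is [u] against the divergence of the
    field [eta phi j] and the other is the 1-form against the same field; summing the weak gradient
    identity over [i] equates them. *)
Lemma weak_partial_psi j : weak_partial (fun y => uh (psi y)) j (fun y => Vf j (psi y)).
Proof.
move=> phi sp; have sd := der_at_smooth_compact j sp.
apply: (mulfI (lt0r_neq0 c0)); rewrite mulrN.
rewrite -(Rintegral_push push); last exact: uh_psi_tests; last first.
  by apply: measurable_funM; [exact: measurable_comp_psi|exact: prod_test_measurable].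
rewrite -(Rintegral_push push); last exact: Vf_psi_tests; last first.
  by apply: measurable_funM; [exact: measurable_comp_psi (mV j)|exact: prod_test_measurable].
under [in RHS]eq_Rintegral do rewrite Vf_gmap.
rewrite Rintegral_sum; last by move=> i; exact: ah_eta_intg.
rewrite -sumrN; under [in RHS]eq_bigr do rewrite -weak_eta//.
have ui i : intgL (fun x => uh x * 'D_(b i) (eta phi j i) x).
  have tf := eta_test j i sp.
  have cf : continuous (fun x => 'D_(b i) (eta phi j i) x).
    by have [/(_ 1%N) [_ _ /(_ i) h] _ _] := tf; exact: h.
  have out x : ~ hs x -> 'D_(b i) (eta phi j i) x = 0 by exact: test_function_derive_out.
  have [C HC] := continuous_hspace_bounded cf out.
  exact: (intg_L2_bounded mu uh_sqr_intg (continuous_measurable_rV cf) HC out).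
rewrite -Rintegral_sum//; apply: eq_Rintegral => x _.
rewrite mulrAC psi_Jr -mulrA -mulr_sumr.
have [hx|nx] := pselect (hs x); first by rewrite div_eta// JrE// [Jf x * _]mulrC.
by rewrite uh_out// !mul0r.
Qed.

End constant.

End pullback_integrals.

Section ball_log_sobolev.
Context (R : realType) (n : nat).
Local Notation lam := (@lebesgue_measure R).
Local Notation L := (@lebesgue_rV R).
Local Notation E := 'rV[R]_n.+1.
Local Notation hs := (@hspace R n.+1).
Local Notation intgL f := ((L n.+1).-integrable setT (EFin \o f)).
Local Notation dens := (@hdensity R n.+1).
Implicit Types (i j : 'I_n.+1) (x y : E).

Definition eps (t : R) : R := expR (- (n%:R / 2) * t).
Definition deps (t : R) : R := - (n%:R / 2) * eps t.

Lemma smooth_eps k : CkOn (fun _ : unit => 1 : R) setT k eps.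
Proof.
apply: (@CkOn_comp _ _ _ _ setT setT) => //; [exact: openT|exact: Ck1_expR|].
by apply: CkOnZ; [exact: openT|apply: Ck1_id; exact: openT].
Qed.

Lemma smooth_deps k : CkOn (fun _ : unit => 1 : R) setT k deps.
Proof. by apply: CkOnZ; [exact: openT|exact: smooth_eps]. Qed.

Lemma is_derive_eps (t : R) : is_derive t 1 eps (deps t).
Proof.
have h1 : is_derive t 1 (fun t : R => - (n%:R / 2) * t) (- (n%:R / 2) * 1).
  by apply: is_derive_scale; exact: is_derive_id.
have h2 := is_derive_expR (- (n%:R / 2) * t).
by apply: is_derive_eqr (is_derive_comp1 h1 h2) _; rewrite /deps /eps; ring.
Qed.

Lemma eps_sqr t : expR t ^+ n * eps t ^+ 2 = 1.
Proof.
rewrite /eps -!expRM_natl -expRD -[RHS]expR0; congr expR; by field.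
Qed.

Variables (u : E -> R) (X : E -> E).
Hypothesis uX : W12 u X.
Variable c : R.
Hypothesis c1 : 1 <= c.
Hypothesis push : forall F : E -> R, measurable_fun setT F ->
  (\int[L n.+1]_x (F (gmap x) * Jr x)%:E = \int[L n.+1]_y (F y * c)%:E)%E.
Local Notation uh := (@uh R n u).
Local Notation Vf := (@Vf R n X).
Local Notation HN := (@HN R n X).
Let mu := measurable_uh uX.
Let mV j := measurable_Vf uX j.
Let c0 : 0 < c. Proof. exact: lt_le_trans c1. Qed.

Hypothesis u1 : \int[L n.+1]_x (uh x ^+ 2 * dens x) = 1.

Let w y := eps (y ord0 ord0) * uh (psi y).
Let w_ j y := eps (y ord0 ord0) * Vf j (psi y) +
  (if j == ord0 then deps (y ord0 ord0) * uh (psi y) else 0).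

Let meps : measurable_fun setT (fun y : E => eps (y ord0 ord0)).
Proof. by apply: measurable_weight; exact: (smooth_continuous smooth_eps). Qed.

Let mdeps : measurable_fun setT (fun y : E => deps (y ord0 ord0)).
Proof. by apply: measurable_weight; exact: (smooth_continuous smooth_deps). Qed.

Let mw : measurable_fun setT w.
Proof. by apply: measurable_funM => //; exact: measurable_comp_psi. Qed.

Let mw_ j : measurable_fun setT (w_ j).
Proof.
apply: measurable_funD; first by apply: measurable_funM => //; exact: measurable_comp_psi (mV j).
by case: (j == ord0) => //; apply: measurable_funM => //; exact: measurable_comp_psi.
Qed.

Lemma eps_dens x : eps (gf ord0 x) ^+ 2 * Jr x = dens x.
Proof.
have [hx|nx] := pselect (hs x); last by rewrite Jr_out// mulr0 hdensity_out.
rewrite hdensity_gf0//; congr (_ * _).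
have e0 : expR (gf ord0 x) ^+ n != 0 by rewrite expf_neq0// gt_eqF// expR_gt0.
by apply: (mulfI e0); rewrite eps_sqr mulfV.
Qed.

Let psi_dens (f : E -> R) x : eps (gmap x ord0 ord0) ^+ 2 * f (psi (gmap x)) * Jr x = f x * dens x.
Proof. by rewrite -mulrA psi_Jr mxE mulrCA eps_dens. Qed.

(** Transfers integrability and integral together between a function of the coordinates and its
    counterpart on the ball with respect to [dV]. *)
Let push_dens (H G : E -> R) : measurable_fun setT H ->
  (forall x, H (gmap x) * Jr x = G x * dens x) -> intgL (fun x => G x * dens x) ->
  intgL H /\ c * \int[L n.+1]_y H y = \int[L n.+1]_x (G x * dens x).
Proof.
move=> mH HG Gi; have Hi : intgL H.
  apply/(intg_push c1 push mH); by under [X in EFin \o X]eq_fun do rewrite HG.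
split => //; rewrite -(Rintegral_push push)//.
by apply: eq_Rintegral => x _; exact: HG.
Qed.

Let HNi := HN_dens_intg uX.
Let ui := uh_dens_intg uX.

Let mexp : measurable_fun setT (fun x : E => expR (gf ord0 x)).
Proof. by apply: (measurableT_comp (@measurable_expR R)); exact: measurable_gf. Qed.

(** The counterparts on the ball of [w_0^2], of the weighted horizontal terms and of [w w_0]; the
    shift by [n / 2] comes from differentiating [eps]. *)
Let G0 x := (Vf ord0 x - n%:R / 2 * uh x) ^+ 2.
Let Gk (k : 'I_n) x := expR (gf ord0 x) ^+ 2 * Vf (lift ord0 k) x ^+ 2.
Let G1 x := uh x * (Vf ord0 x - n%:R / 2 * uh x).

Let V0_le x : Vf ord0 x ^+ 2 <= HN x.
Proof. by rewrite /HN lerDl mulr_ge0 ?sqr_ge0// sumr_ge0// => k _; rewrite sqr_ge0. Qed.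

Let mdens : measurable_fun setT dens. Proof. exact: measurable_hdensity. Qed.

Let dens_le (f g : E -> R) : measurable_fun setT f -> (forall x, `|f x| <= g x) ->
  intgL (fun x => g x * dens x) -> intgL (fun x => f x * dens x).
Proof.
move=> mf fg; apply: le_intg; first exact: measurable_funM.
by move=> x; rewrite normrM (ger0_norm (hdensity_ge0 _)) ler_wpM2r// hdensity_ge0.
Qed.

(** Common majorant of [|G0|] and [|G1|]: [(V - a v)^2 <= 2 V^2 + 2 a^2 v^2] with [a = n / 2], and
    one more [v^2] for the product in [G1]. *)
Let bnd x := 2 * HN x + (1 + 2 * (n%:R / 2) ^+ 2) * uh x ^+ 2.

Let bndi : intgL (fun x => bnd x * dens x).
Proof.
rewrite (_ : (fun x => bnd x * dens x) = fun x => 2 * (HN x * dens x) +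
    (1 + 2 * (n%:R / 2) ^+ 2) * (uh x ^+ 2 * dens x)); last by apply/funext => x; rewrite /bnd; ring.
by apply: intgD; exact: intgZ.
Qed.

Let mVu : measurable_fun setT (fun x => Vf ord0 x - n%:R / 2 * uh x).
Proof. by apply: measurable_funB => //; exact: measurable_funM. Qed.

Let G0i : intgL (fun x => G0 x * dens x).
Proof.
apply: (dens_le _ _ bndi); first exact: measurable_funX.
move=> x; rewrite ger0_norm ?sqr_ge0// /bnd /G0.
have := V0_le x; set V := Vf _ _; set a := n%:R / 2; set v := uh x => hV.
by have := sqr_ge0 (V + a * v); have := sqr_ge0 v; lra.
Qed.

Let G1i : intgL (fun x => G1 x * dens x).
Proof.
apply: (dens_le _ _ bndi); first exact: measurable_funM.
move=> x; apply: le_trans (normM_le_sqr _ _) _; rewrite /bnd.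
have := V0_le x; set V := Vf _ _; set a := n%:R / 2; set v := uh x => hV.
by have := sqr_ge0 (V + a * v); have := sqr_ge0 v; lra.
Qed.

Let Gki k : intgL (fun x => Gk k x * dens x).
Proof.
apply: (dens_le _ _ HNi).
  by apply: measurable_funM; exact: measurable_funX.
move=> x; have g0 : 0 <= Gk k x by rewrite mulr_ge0 ?sqr_ge0.
rewrite ger0_norm// /HN /Gk (bigD1 k)//= mulrDr.
rewrite addrCA lerDl addr_ge0 ?sqr_ge0// mulr_ge0 ?sqr_ge0// sumr_ge0// => l _.
exact: sqr_ge0.
Qed.

Let wP : intgL (fun y => w y ^+ 2) /\ c * \int[L n.+1]_y (w y ^+ 2) = 1.
Proof.
rewrite -u1; apply: push_dens => //; first exact: measurable_funX.
by move=> x; rewrite /w exprMn (psi_dens (fun x => uh x ^+ 2)).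
Qed.

Let w0E y : w_ ord0 y = eps (y ord0 ord0) * (Vf ord0 (psi y) - n%:R / 2 * uh (psi y)).
Proof. by rewrite /w_ eqxx /deps; ring. Qed.

Let w0P : intgL (fun y => w_ ord0 y ^+ 2) /\
  c * \int[L n.+1]_y (w_ ord0 y ^+ 2) = \int[L n.+1]_x (G0 x * dens x).
Proof.
apply: push_dens => //; first exact: measurable_funX.
by move=> x; rewrite w0E exprMn (psi_dens (fun x => (Vf ord0 x - n%:R / 2 * uh x) ^+ 2)).
Qed.

Let wkP (k : 'I_n) : intgL (fun y : E => expR (y ord0 ord0) ^+ 2 * w_ (lift ord0 k) y ^+ 2) /\
  c * \int[L n.+1]_y (expR (y ord0 ord0) ^+ 2 * w_ (lift ord0 k) y ^+ 2) =
  \int[L n.+1]_x (Gk k x * dens x).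
Proof.
apply: push_dens; last exact: Gki.
  apply: measurable_funM; last exact: measurable_funX.
  by apply: measurable_funX; apply: measurable_weight; exact: continuous_expR.
move=> x; rewrite /w_ eq_sym (negbTE (neq_lift _ _)) addr0 exprMn -mulrA.
by rewrite (psi_dens (fun x => Vf (lift ord0 k) x ^+ 2)) mxE /Gk mulrA.
Qed.

Let weak j : weak_partial w j (w_ j).
Proof.
have H := weak_partial_psi uX c1 push j.
case: (unliftP ord0 j) H => [k ->|->] H.
  have := weak_partial_weight smooth_eps H.
  rewrite (_ : (fun y => _ * Vf _ _) = w_ (lift ord0 k))//.
  by apply/funext => y; rewrite /w_ eq_sym (negbTE (neq_lift _ _)) addr0.
have := weak_partial_weight0 smooth_eps smooth_deps is_derive_eps
  (uh_psi_tests uX c1 push) (Vf_psi_tests uX c1 push ord0) H.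
by rewrite (_ : (fun y => _ * Vf _ _ + _) = w_ ord0)//; apply/funext => y; rewrite /w_ eqxx.
Qed.

Let G1_0 : \int[L n.+1]_x (G1 x * dens x) = 0.
Proof.
have mH : measurable_fun setT (fun y => w y * w_ ord0 y) by exact: measurable_funM.
have [|Hi <-] := push_dens mH _ G1i.
  move=> x; rewrite /w w0E mulrACA -expr2 -/(G1 (psi (gmap x))).
  exact: (psi_dens G1).
have := Rintegral_partial0 wP.1 _ (weak_partial_sqr mw (mw_ ord0) wP.1 w0P.1 (weak ord0)).
under eq_Rintegral do rewrite -mulrA.
rewrite RintegralZ// => H.
have /eqP : 2 * \int[L n.+1]_y (w y * w_ ord0 y) = 0.
  by apply: H; under [X in EFin \o X]eq_fun do rewrite -mulrA; exact: intgZ.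
by rewrite mulf_eq0 pnatr_eq0/= => /eqP ->; rewrite mulr0.
Qed.

Definition energyH : R := \int[L n.+1]_x (HN x * dens x) - n%:R ^+ 2 / 4.

Let kap := \int[L n.+1]_y (w_ ord0 y ^+ 2) +
    \sum_(k < n) \int[L n.+1]_y (expR (y ord0 ord0) ^+ 2 * w_ (lift ord0 k) y ^+ 2).

Let kapE : c * kap = energyH.
Proof.
rewrite /kap mulrDr w0P.2 mulr_sumr; under eq_bigr do rewrite (wkP _).2.
have S : \sum_(k < n) \int[L n.+1]_x (Gk k x * dens x) = \int[L n.+1]_x \sum_(k < n) (Gk k x * dens x).
  by rewrite Rintegral_sum.
have Si : intgL (fun x => \sum_(k < n) (Gk k x * dens x)) by exact: intg_sum.
rewrite S -RintegralD//.
rewrite /energyH.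
(* Pointwise, [(V - n v / 2)^2 = V^2 - n v (V - n v / 2) - n^2 v^2 / 4], and the middle term
   integrates to 0 by [G1_0]. *)
have -> : \int[L n.+1]_x (HN x * dens x) - n%:R ^+ 2 / 4 = \int[L n.+1]_x (HN x * dens x) -
    n%:R * \int[L n.+1]_x (G1 x * dens x) - n%:R ^+ 2 / 4 * \int[L n.+1]_x (uh x ^+ 2 * dens x).
  by rewrite G1_0 u1; ring.
have I1 := intgZ n%:R G1i; have I2 := intgZ (n%:R ^+ 2 / 4) ui.
rewrite -!RintegralZ// -RintegralB// -RintegralB//; last exact: intgB.
apply: eq_Rintegral => x _; rewrite -mulr_suml -mulrDl.
rewrite /G0 /G1 /Gk -mulr_sumr /HN; by field.
Qed.

Lemma energyH_ge0 : 0 <= energyH.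
Proof.
rewrite -kapE mulr_ge0 ?(ltW c0)// addr_ge0//.
  by apply: Rintegral_ge0 => y _; exact: sqr_ge0.
by apply: sumr_ge0 => k _; apply: Rintegral_ge0 => y _; rewrite mulr_ge0 ?sqr_ge0.
Qed.

(** The constant [c] enters because [w^2] has mass [1 / c], which the normalisation by [m] divides
    out. *)
Definition entH x := uh x ^+ 2 * ln (c * uh x ^+ 2).

Lemma log_sobolev_ball (a : R) : 0 < a ->
  intgL (fun x => Num.max (entH x * dens x) 0) /\
  (intgL (fun x => entH x * dens x) ->
   \int[L n.+1]_x (entH x * dens x) <= a * energyH - n.+1%:R * (1 + ln (pi * a) / 2)).
Proof.
move=> a0.
have [] := weighted_log_sobolev mw mw_ wP.1 w0P.1 (fun k => (wkP k).1) weak a0.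
set m := \int[L n.+1]_y (w y ^+ 2); set F := fun y => _ * ln _; rewrite -/kap => F1 F2.
have cm : c * m = 1 := wP.2.
have mE : m^-1 = c.
  have m0 : m != 0 by apply: contra_eqN cm => /eqP ->; rewrite mulr0 eq_sym oner_eq0.
  by apply: (mulIf m0); rewrite mulVf// cm.
have FE x : F (gmap x) * Jr x = entH x * dens x.
  rewrite /F mE /w mxE.
  have [hx|nx] := pselect (hs x); last by rewrite Jr_out// hdensity_out// !mulr0.
  rewrite gmapK// exprMn (_ : expR _ ^+ n * (_ * _) * c = c * uh x ^+ 2); last first.
    by rewrite mulrA eps_sqr mul1r mulrC.
  by rewrite /entH -eps_dens; ring.
have mF : measurable_fun setT F.
  apply: measurable_funM; first exact: measurable_funX.
  apply: (measurableT_comp (@measurable_ln R)); apply: measurable_funM => //.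
  apply: measurable_funM; last exact: measurable_funX.
  by apply: measurable_funX; apply: measurable_weight; exact: continuous_expR.
split.
  have mF1 : measurable_fun setT (fun y => Num.max (F y) 0).
    by apply: measurable_maxr => //; exact: measurable_cst.
  move/(intg_push c1 push mF1) : F1.
  by under [X in EFin \o X]eq_fun do rewrite maxr_pMl ?Jr_ge0// mul0r FE.
move=> ei; have [Fi <-] := push_dens mF FE ei.
have := F2 Fi; rewrite -(ler_pM2l c0) => /le_trans; apply.
rewrite mulrBr mulrCA kapE; rewrite (_ : c * (_ * m * _) = n.+1%:R * (c * m) * (1 + ln (pi * a) / 2)).
  by rewrite cm mulr1.
by ring.
Qed.

End ball_log_sobolev.

(** * The inequality on hyperbolic space *)

Unset Implicit Arguments.
Set Strict Implicit.
Set Printing Implicit Defensive.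

Theorem theorem1p3 (R : realType) (N : nat) (hN : (3 <= N)%N)
  (u : 'rV[R]_N -> R) (gradu : 'rV[R]_N -> 'rV[R]_N)
  (hu : W12 u gradu) (hu1 : L2norm u = 1) :
  let H := @hspace R N in
  let dV := @hvol R N in
  let entropy := fun x => (`|u x| ^+ 2 * ln `|u x|)%:E in
  let energy :=
    \int[dV]_(x in H) (hnorm x (gradu x) ^+ 2)
    - N%:R ^+ 2 * (N%:R - 1) / (4 * (N%:R + 2)) *
      \int[dV]_(x in H) (`|u x| ^+ 2) in
  (* both sides are meaningful: the integral on the left exists in
     [-oo, +oo[ and the logarithm on the right has a positive argument *)
  [/\ (\int[dV]_(x in H) (entropy^\+ x) < +oo)%E,
      0 < energy &
      (\int[dV]_(x in H) entropy x <=
       (N%:R / 4 * ln (2 / (pi * N%:R * expR 1) * energy))%:E)%E].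
Proof.
case: N hN u gradu hu hu1 => // n hN u X hu hu1 H dV entropy energy.
have [c [c1 push]] := pushforward_horospherical R n.
pose L := @lebesgue_rV R n.+1; pose dens := @hdensity R n.+1.
pose v := uh u.
have mv : measurable_fun setT v by exact: measurable_uh hu.
have mdens : measurable_fun setT dens by exact: measurable_hdensity.
have mabs : measurable_fun setT (fun x => `|v x|) by exact: measurableT_comp.
have vE (f : R -> R) : f 0 = 0 -> (fun x => f (u x)) \_ H = (fun x => f (v x)).
  by move=> f0; apply/funext => x; rewrite /v /uh !patchE; case: ifP.
have EH (f : 'rV[R]_n.+1 -> R) g : measurable_fun setT g -> f \_ H = g ->
    (\int[dV]_(x in H) (f x)%:E = \int[L]_x (g x * dens x)%:E)%E.
  move=> mg fg; rewrite -(hvol_integral mg) integral_mkcond; apply: eq_integral => x _.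
  by rewrite -fg !patchE; case: ifP.
have RH (f : 'rV[R]_n.+1 -> R) g : measurable_fun setT g -> f \_ H = g ->
    \int[dV]_(x in H) f x = \int[L]_x (g x * dens x).
  by move=> mg fg; rewrite /Rintegral (EH _ _ mg fg).
have i2 : \int[dV]_(x in H) (`|u x| ^+ 2) = \int[L]_x (v x ^+ 2 * dens x).
  apply: RH; first exact: measurable_funX.
  rewrite (vE (fun t => `|t| ^+ 2)) ?normr0 ?expr0n//.
  by apply/funext => x; rewrite real_normK ?num_real.
have u1 : \int[L]_x (v x ^+ 2 * dens x) = 1.
  have I0 : 0 <= \int[L]_x (v x ^+ 2 * dens x).
    by apply: Rintegral_ge0 => x _; rewrite mulr_ge0 ?sqr_ge0// hdensity_ge0.
  by rewrite -(sqr_sqrtr I0) -i2; move: hu1; rewrite /L2norm => ->; rewrite expr1n.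
have iX : \int[dV]_(x in H) (hnorm x (X x) ^+ 2) = \int[L]_x (HN X x * dens x).
  by apply: RH; [exact: measurable_HN hu|rewrite HN_hnorm].
have N3 : 3 <= n.+1%:R :> R by rewrite ler_nat.
have E0 := energyH_ge0 hu c1 push u1.
(* Since [(N-1)^2 (N+2) - N^2 (N-1) = (N-1) (N-2)]. The surplus is positive for [N >= 3], so
   [energy] is positive even if [energyH] is 0. *)
have eE : energy = energyH X + (n.+1%:R - 1) * (n.+1%:R - 2) / (4 * (n.+1%:R + 2)).
  rewrite /energy iX i2 u1 /energyH.
  have -> : (n%:R : R) = n.+1%:R - 1 by rewrite -natr1 addrK.
  by field; lra.
have epos : energyH X < energy.
  by rewrite eE ltrDl divr_gt0 ?mulr_gt0//; lra.
have e0 : 0 < energy by exact: le_lt_trans epos.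
pose le x := `|v x| ^+ 2 * ln `|v x|.
have mle : measurable_fun setT le.
  by apply: measurable_funM; [exact: measurable_funX|apply: (measurableT_comp (@measurable_ln R))].
have leE : (fun x => `|u x| ^+ 2 * ln `|u x|) \_ H = le.
  by rewrite (vE (fun t => `|t| ^+ 2 * ln `|t|))// normr0 expr0n mul0r.
have c0 : 0 < c by exact: lt_le_trans c1.
have lnc : 0 <= ln c by exact: ln_ge0.
have entE x : entH u c x = 2 * le x + ln c * v x ^+ 2.
  rewrite /entH -/v /le real_normK ?num_real//; have [->|v0] := eqVneq (v x) 0.
    by rewrite expr0n !mul0r !mulr0 addr0.
  have v2 : 0 < `|v x| by rewrite normr_gt0.
  rewrite -(real_normK (num_real (v x))) lnM ?posrE ?exprn_gt0// lnXn// mulr2n; ring.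
have vi : L.-integrable setT (EFin \o (fun x => v x ^+ 2 * dens x)) by exact: uh_dens_intg hu.
have le_ent x : 2 * le x <= entH u c x by rewrite entE lerDl mulr_ge0 ?sqr_ge0.
pose lep x := Num.max (le x) 0.
have mlep : measurable_fun setT lep by apply: measurable_maxr => //; exact: measurable_cst.
have lepi : L.-integrable setT (EFin \o (fun x => lep x * dens x)).
  have [F1 _] := log_sobolev_ball hu c1 push u1 ltr01.
  apply: (le_intg _ _ F1); first exact: measurable_funM.
  move=> x; have d0 : 0 <= dens x by exact: hdensity_ge0.
  rewrite ger0_norm; last by rewrite mulr_ge0// le_max lexx orbT.
  rewrite /lep maxr_pMl// mul0r ge_max le_max; apply/andP; split; last first.
    by rewrite le_max lexx orbT.
  have := ler_wpM2r d0 (le_ent x); have [l0|l0] := leP 0 (le x * dens x).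
    by rewrite -mulrA => h; apply/orP; left; apply: le_trans h; rewrite ler_peMl// ler1n.
  by move=> _; rewrite (ltW l0) orbT.
have posE : (\int[dV]_(x in H) (entropy^\+ x) = \int[L]_x (lep x * dens x)%:E)%E.
  rewrite -(EH (fun x => Num.max (`|u x| ^+ 2 * ln `|u x|) 0) _ mlep).
    by apply: eq_integral => x _; rewrite funeposE EFin_max.
  by rewrite (vE (fun t => Num.max (`|t| ^+ 2 * ln `|t|) 0))// normr0 expr0n mul0r maxxx.
have pos_fin : (\int[dV]_(x in H) (entropy^\+ x) < +oo)%E.
  by rewrite posE -(EFin_Rintegral lepi) ltry.
split => //.
(* If the negative part has infinite integral, the left side is [-oo], the positive part being
   finite. *)
have [negoo|negfin] := eqVneq (\int[dV]_(x in H) (entropy^\- x))%E +oo%E.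
  rewrite [leLHS]integralE negoo posE -(EFin_Rintegral lepi).
  by rewrite addeNy leNye.
pose len x := Num.max (- le x) 0.
have mlen : measurable_fun setT len.
  by apply: measurable_maxr; [exact: measurableT_comp|exact: measurable_cst].
have negE : (\int[dV]_(x in H) (entropy^\- x) = \int[L]_x (len x * dens x)%:E)%E.
  rewrite -(EH (fun x => Num.max (- (`|u x| ^+ 2 * ln `|u x|)) 0) _ mlen).
    by apply: eq_integral => x _; rewrite funenegE EFin_max.
  by rewrite (vE (fun t => Num.max (- (`|t| ^+ 2 * ln `|t|)) 0))// normr0 expr0n mul0r oppr0 maxxx.
have leni : L.-integrable setT (EFin \o (fun x => len x * dens x)).
  apply/integrableP; split; first by apply/measurable_EFinP; exact: measurable_funM.
  rewrite (_ : (\int[L]_x _)%E = \int[dV]_(x in H) (entropy^\- x))%E; first by rewrite ltey.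
  rewrite negE; apply: eq_integral => x _ /=; rewrite ger0_norm// mulr_ge0 ?hdensity_ge0//.
  by rewrite le_max lexx orbT.
have lei : L.-integrable setT (EFin \o (fun x => le x * dens x)).
  rewrite (_ : (fun x => le x * dens x) = fun x => lep x * dens x - len x * dens x); first exact: intgB.
  apply/funext => x; rewrite -mulrBl; congr (_ * _); rewrite /lep /len.
  by have [l0|l0] := leP 0 (le x); [rewrite max_r ?oppr_le0// subr0|rewrite max_l ?oppr_ge0 ?(ltW l0)// sub0r opprK].
rewrite (EH _ _ mle leE) -(EFin_Rintegral lei) lee_fin.
have ei : L.-integrable setT (EFin \o (fun x => entH u c x * dens x)).
  rewrite (_ : (fun x => _) = fun x => 2 * (le x * dens x) + ln c * (v x ^+ 2 * dens x)).
    by apply: intgD; exact: intgZ.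
  by apply/funext => x; rewrite entE; ring.
(* The minimiser of [a E - N (1 + ln (pi a) / 2)] for [E = energy]; there [a E = N / 2]. *)
pose a := n.+1%:R / (2 * energy).
have a0 : 0 < a by rewrite divr_gt0 ?mulr_gt0//; lra.
have [_ /(_ ei) B] := log_sobolev_ball hu c1 push u1 a0.
have le2 : 2 * \int[L]_x (le x * dens x) <= \int[L]_x (entH u c x * dens x).
  rewrite -RintegralZ//; apply: ae_le_Rintegral => //; first exact: intgZ.
  by apply: aeW => x; rewrite mulrA ler_wpM2r// hdensity_ge0.
have aE : a * energyH X <= n.+1%:R / 2.
  apply: (@le_trans _ _ (a * energy)); first by rewrite ler_wpM2l// ltW.
  by rewrite le_eqVlt; apply/orP; left; apply/eqP; rewrite /a; field; rewrite gt_eqF.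
have pi0 : 0 < pi :> R by exact: pi_gt0.
have N0 : 0 < n.+1%:R :> R by lra.
(* For this [a], [2 E / (pi N e) = 1 / (pi a e)], so both bounds become affine in [ln (pi a)]. *)
have lnE : ln (2 / (pi * n.+1%:R * expR 1) * energy) = - (ln (pi * a) + 1).
  have alg (p q x z : R) : p != 0 -> q != 0 -> x != 0 -> z != 0 ->
      2 / (p * q * x) * z = (p * (q / (2 * z)) * x)^-1.
    by move=> p0 q0 x0 z0; field; rewrite p0 q0 x0 z0.
  have pa : 0 < pi * a by exact: mulr_gt0.
  rewrite alg ?gt_eqF ?expR_gt0// lnV; last by rewrite posrE mulr_gt0 ?expR_gt0.
  by rewrite lnM ?posrE ?expR_gt0// expRK.
rewrite lnE; move: (ln (pi * a)) B => l B.
have := le_trans le2 B; move: aE; set I := \int[_]_x _ => aE H2.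
by move: aE H2; lra.
Qed.
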